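(* Let $k\ge 3$ be an integer. There exists $n_0$ such that for every integer $n\ge n_0$ and every $f\in C([0,1])$, $$\omega_2(f,\delta)\le 5\cdot\|f-S_{n,k}f\|_\infty ,\qquad\text{where}\qquad \delta=\delta_{n,k}=\frac{h}{\sqrt{4d_k+2\varepsilon_{n,k}\,\zeta(3/2)}},\quad h=\frac1n .$$
   Context: $C([0,1])$ is the space of real-valued continuous functions on $[0,1]$ with the supremum norm $\|\cdot\|_\infty$. For integers $n,k>0$ put $x_j=j/n$ for $0\le j\le n$, $x_j=0$ for $-k\le j\le 0$ and $x_j=1$ for $n\le j\le n+k$. The normalized B-splines of degree $k$ are $$N_{j,k}(x)=(x_{j+k+1}-x_j)\,[x_j,\ldots,x_{j+k+1}](\cdot-x)_+^k,\qquad -k\le j\le n-1,$$ where $[\ldots]$ is the divided difference (in the Hermite sense for repeated knots), with values taken by right-continuity on $[0,1)$ and by left limits at $x=1$. The nodes are $\xi_{j,k}=\frac{x_{j+1}+\cdots+x_{j+k}}{k}$ for $-k\le j\le n-1$. The (uniform) Schoenberg operator is $$S_{n,k}f(x)=\sum_{j=-k}^{n-1} f(\xi_{j,k})N_{j,k}(x)\quad (0\le x<1),\qquad S_{n,k}f(1)=\lim_{y\nearrow 1}S_{n,k}f(y).$$ The second order modulus of smoothness is, for $f\in C([0,1])$ and $0<t\le\frac12$, $$\omega_2(f,t)=\sup_{0<\eta<t}\ \sup_{x\in[0,1-2\eta]}|f(x)-2f(x+\eta)+f(x+2\eta)|.$$ $\zeta$ is the Riemann zeta function. $d_k>0$ is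 a constant depending only on $k$ such that, for all $n$ and all real coefficients $c=(c_j)_{j=-k}^{n-1}$, $$d_k^{-1}\max_j|c_j|\le \Big\|\sum_{j=-k}^{n-1}c_jN_{j,k}\Big\|_\infty\le \max_j|c_j|$$ (such a constant exists by a known theorem of de Boor). The number $\varepsilon_{n,k}\ge 0$ is defined by $$\varepsilon_{n,k}^2=\sup_{2-k\le i\le n-1}\ \sum_{j=-k}^{n-1}\frac{\big(N_{j,k}(\xi_{i,k})-2N_{j,k}(\xi_{i-1,k})+N_{j,k}(\xi_{i-2,k})\big)^2}{\overline N_{j,k}(\xi_{i,k})},$$ where $\overline N_{j,k}(\xi_{i,k})=N_{j,k}(\xi_{i,k})$ if $N_{j,k}(\xi_{i,k})\ne 0$ and $\overline N_{j,k}(\xi_{i,k})=1$ if $N_{j,k}(\xi_{i,k})=0$. *)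

(* Defs.v *)
From HB Require Import structures.
From mathcomp Require Import all_boot all_order all_algebra.
From mathcomp Require Import all_classical all_reals all_analysis.

Set Implicit Arguments.
Unset Strict Implicit.
Unset Printing Implicit Defensive.

Import Order.TTheory GRing.Theory Num.Theory.
Import numFieldNormedType.Exports.

Local Open Scope classical_set_scope.
Local Open Scope ring_scope.

(* MathComp-Analysis development, over an arbitrary realType. *)

(* The divided difference [u 0, ..., u m] f in the Hermite sense, for a
   nondecreasing sequence of knots: u 0 = u m then means that the m + 1 knots
   coincide. *)
Fixpoint divdiff (R : realType) (f : R -> R) (u : nat -> R) (m : nat) : R :=
  if m is m'.+1 then
    if u 0%N == u m then derive1n m f (u 0%N) / m`!%:R
    else (divdiff f (fun i => u i.+1) m' - divdiff f u m') / (u m - u 0%N)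
  else f (u 0%N).

(* (t - x)_+^k as a function of t; the convention is the usual one for k > 0. *)
Definition truncpow (R : realType) (k : nat) (x t : R) : R :=
  Num.max (t - x) 0 ^+ k.

Definition knot (R : realType) (n : nat) (j : int) : R :=
  if j <= 0 then 0 else if n%:Z <= j then 1 else j%:~R / n%:R.

(* The integers -k, ..., n - 1. *)
Definition bindex (n k : nat) : seq int :=
  [seq i%:Z - k%:Z | i <- iota 0 (n + k)].

Definition bspline_raw (R : realType) (n k : nat) (j : int) (x : R) : R :=
  (knot R n (j + k.+1%:Z) - knot R n j) *
  divdiff (truncpow k x) (fun i => knot R n (j + i%:Z)) k.+1.

(* bspline_raw is only meaningful off the knots, where truncpow k x has the
   derivatives required at the repeated knots 0 and 1. *)
Definition bspline (R : realType) (n k : nat) (j : int) (x : R) : R :=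
  if x < 1 then lim (bspline_raw n k j y @[y --> x^'+])
  else lim (bspline_raw n k j y @[y --> (1 : R)^'-]).

Definition node (R : realType) (n k : nat) (j : int) : R :=
  (\sum_(1 <= i < k.+1) knot R n (j + i%:Z)) / k%:R.

Definition spline (R : realType) (n k : nat) (c : int -> R) (x : R) : R :=
  \sum_(j <- bindex n k) c j * bspline n k j x.

Definition schoenberg (R : realType) (n k : nat) (f : R -> R) (x : R) : R :=
  if x < 1 then spline n k (fun j => f (node R n k j)) x
  else lim (spline n k (fun j => f (node R n k j)) y @[y --> (1 : R)^'-]).

Definition supnorm (R : realType) (g : R -> R) : R :=
  sup [set `|g x| | x in `[(0 : R), 1]].

Definition omega2 (R : realType) (f : R -> R) (t : R) : R :=
  sup [set sup [set `|f x - 2 * f (x + eta) + f (x + 2 * eta)|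
               | x in `[(0 : R), 1 - 2 * eta]]
      | eta in `](0 : R), t[].

Definition zeta (R : realType) (s : R) : R := limn (series (riemannR s)).

(* d is an admissible value for the constant d_k. *)
Definition de_boor_constant (R : realType) (k : nat) (d : R) : Prop :=
  0 < d /\
  forall n : nat, (0 < n)%N -> forall c : int -> R,
    let cmax := \big[Num.max/0]_(j <- bindex n k) `|c j| in
    d^-1 * cmax <= supnorm (spline n k c) /\ supnorm (spline n k c) <= cmax.

Definition nonzero_or_one (R : realType) (a : R) : R :=
  if a == 0 then 1 else a.

(* The supremum ranges over 2 - k <= i <= n - 1; its terms are nonnegative. *)
Definition epsilon (R : realType) (n k : nat) : R :=
  Num.sqrt (\big[Num.max/0]_(i <- bindex n k | 2 - k%:Z <= i)
    \sum_(j <- bindex n k)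
      (bspline n k j (node R n k i)
       - 2 * bspline n k j (node R n k (i - 1))
       + bspline n k j (node R n k (i - 2))) ^+ 2
      / nonzero_or_one (bspline n k j (node R n k i))).

(* Main.v *)
Require Import Defs.
From Stdlib Require Import ZArith.
From HB Require Import structures.
From mathcomp Require Import all_boot all_order all_algebra.
From mathcomp Require Import all_classical all_reals all_analysis.
From mathcomp Require Import complex.
From mathcomp Require Import ring lra zify ssrZ.

Set Implicit Arguments.
Unset Strict Implicit.
Unset Printing Implicit Defensive.

Import Order.TTheory GRing.Theory Num.Theory.
Import numFieldNormedType.Exports.

Local Open Scope classical_set_scope.
Local Open Scope ring_scope.

Ltac nlia := match goal with R : realType |- _ => clear dependent R end; lia.

(* Multiplying by [n] makes the knots integers.  Put [g = f - S f] and let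
    [S f] have coefficients [c]; its second derivative is a spline whose
    coefficients [ccurv c] are weighted second differences of [c], and
    [c_i - S c (xi_i) = g (xi_i)].  A second difference of [f] with step
    [eta < delta] is at most [4 |g|] plus [eta^2 max |ccurv c|], so it is enough
    that [|ccurv c| <= (4 d + 2 epsilon zeta(3/2)) |g|].

    For [k <= 20] the map from [ccurv c] to [c - S c] at the nodes is diagonally
    dominant; the finitely many different rows are checked by computation.

    For [k >= 21] compare [c] with a convex sequence [q] for which [S q - q] is
    nearly 1: where [|ccurv c| / ccurv q = A] is largest, [e = A q - c] is convex
    and flat, so after subtracting a line it vanishes at three neighbouring nodes,
    and there [S e] is at most [k^2] times its own second difference, which
    the second difference of [g] controls.  That local bound follows from the
    monotone likelihood ratios [B_(j+1) / B_j] of B-splines.  This gives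
    [|ccurv c| <= O(k^4) |g|].

    Conversely de Boor's constant is exponential in [k]: for [n = 1] the splines
    are the Bernstein polynomials, and the Chebyshev polynomial has Bernstein
    coefficients [+- C(2k,2i) / C(k,i)], hence [4 d >= 2^(k+1)].  Only for [k = 3]
    is [epsilon] needed. *)

(** * The Cox-de Boor recursion *)

(** Both methods use that [S] is positive and reproduces lines, so that it raises convex sequences
    at the nodes and keeps them convex. Diagonal dominance cannot serve every degree: far from the
    ends it requires [2 * hinge_value > qdefect], where [qdefect = (k+1)/24], while the nodes
    weighted by the B-splines have variance [(k+1)/12], so that
    [2 * hinge_value <= sqrt ((k+1)/12)]; it fails for large [k]. The comparison sequence replaces
    the entrywise estimate by control of [S q - q] alone, at the cost of a factor polynomial in [k].
    The exponential size of de Boor's constant pays for it, and 21 is the first degree from 3 on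
    with [44/9 k^2 (1 + 4 k^2) <= 2^(k+1)], which is where the two methods meet. *)

Section CoxDeBoor.
Variables (R : realFieldType) (t : nat -> R).
Hypothesis t_homo : {homo t : i j / (i <= j)%N >-> i <= j}.

(* The polynomial that the B-spline of degree [p] with knots [t_j, ..., t_(j+p+1)]
   equals on the piece between [t_r] and [t_(r+1)]; empty knot intervals
   contribute 0 since [x / 0 = 0]. *)
Fixpoint bs (r p j : nat) (x : R) : R :=
  if p is p'.+1 then
    (x - t j) / (t (j + p)%N - t j) * bs r p' j x +
    (t (j + p).+1 - x) / (t (j + p).+1 - t j.+1) * bs r p' j.+1 x
  else (j == r)%:R.

Lemma bsS r p j x : bs r p.+1 j x =
  (x - t j) / (t (j + p.+1)%N - t j) * bs r p j x +
  (t (j + p.+1).+1 - x) / (t (j + p.+1).+1 - t j.+1) * bs r p j.+1 x.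
Proof. by []. Qed.

Lemma bs_out r p j x : (r < j)%N || (j + p < r)%N -> bs r p j x = 0.
Proof.
elim: p j => [|p IH] j h /=; first by case: eqP h => // ->; rewrite addn0 ltnn.
by rewrite !IH ?mulr0 ?addr0 //; lia.
Qed.

Lemma bs_ge0 r p j x : t r <= x <= t r.+1 -> 0 <= bs r p j x.
Proof.
move=> /andP[h1 h2]; elim: p j => [|p IH] j; first by rewrite /= ler0n.
rewrite bsS addr_ge0 //.
- have [jr|jr] := leqP j r; last by rewrite bs_out ?mulr0 // jr.
  rewrite mulr_ge0 ?IH // divr_ge0 // subr_ge0.
    by rewrite (le_trans _ h1)// t_homo.
  by rewrite t_homo// leq_addr.
- have [jr|jr] := leqP r (j + p.+1); last by rewrite bs_out ?mulr0 //; lia.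
  rewrite mulr_ge0 ?IH // divr_ge0 // subr_ge0.
    by rewrite (le_trans h2)// t_homo.
  by rewrite t_homo//; lia.
Qed.

Lemma t_lt r i j : t r < t r.+1 -> (i <= r)%N -> (r < j)%N -> t i < t j.
Proof.
by move=> h ir rj; rewrite (le_lt_trans (t_homo ir))// (lt_le_trans h)// t_homo.
Qed.

Lemma bs_gt0 r p j x : t r < x < t r.+1 -> (j <= r <= j + p)%N ->
  0 < bs r p j x.
Proof.
move=> /andP[h1 h2]; have h := lt_trans h1 h2.
have hx : t r <= x <= t r.+1 by rewrite !ltW.
elim: p j => [|p IH] j jr.
  by rewrite /= (_ : j == r) ?ltr01//; apply/eqP; lia.
rewrite bsS; have [rp|rp] := leqP r (j + p).
- rewrite ltr_wpDr//; last first.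
    rewrite mulr_gt0 ?IH ?divr_gt0 ?subr_gt0 //; try lia.
      by rewrite (le_lt_trans _ h1) // t_homo; lia.
    by apply: t_lt h _ _; lia.
  rewrite mulr_ge0 ?bs_ge0// divr_ge0 // subr_ge0 ?t_homo//; try lia.
  by rewrite (le_trans (ltW h2))// t_homo//; lia.
- rewrite ltr_wpDl//.
    rewrite mulr_ge0 ?bs_ge0// divr_ge0 // subr_ge0 ?t_homo//; try lia.
    by rewrite (le_trans _ (ltW h1)) // t_homo//; lia.
  rewrite mulr_gt0 ?IH ?divr_gt0 ?subr_gt0 //; try lia.
    by rewrite (lt_le_trans h2) // t_homo; lia.
  by apply: t_lt h _ _; lia.
Qed.

(** One step of de Boor's algorithm: the recursion is transposed from the B-splines to the
    coefficients. Since [p < r < M], the terms at both ends vanish, among them [j = 0], where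
    [c j.-1] would be wrong. *)
Lemma sum_bsS r p M (c : nat -> R) x : t r < t r.+1 -> (p < r < M)%N ->
  \sum_(j < M) c j * bs r p.+1 j x =
  \sum_(j < M) (c j * (x - t j) + c j.-1 * (t (j + p.+1)%N - x)) /
    (t (j + p.+1)%N - t j) * bs r p j x.
Proof.
move=> hr /andP[pr rM]; case: M rM => // M rM.
rewrite (eq_bigr (fun j : 'I_M.+1 =>
    c j * ((x - t j) / (t (j + p.+1)%N - t j) * bs r p j x) +
    c j * ((t (j + p.+1).+1 - x) / (t (j + p.+1).+1 - t j.+1) *
      bs r p j.+1 x))); last by move=> j _; rewrite bsS mulrDr.
rewrite big_split /= [X in _ + X]big_ord_recr /= bs_out ?rM// !mulr0 addr0.
rewrite [in RHS]big_ord_recl [in RHS]/= [in RHS]bs_out ?mulr0 ?add0r; last first.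
  by rewrite add0n pr orbT.
rewrite big_ord_recl /= bs_out ?mulr0 ?add0r; last by rewrite add0n pr orbT.
by rewrite -big_split; apply: eq_bigr => j _ /=; ring.
Qed.

(* If [bs r p j x] is not 0, then [t j <= t r < t r.+1 <= t (j + p.+1)]. *)
Lemma bs_cancel r p j x : t r < t r.+1 ->
  (t (j + p.+1)%N - t j) / (t (j + p.+1)%N - t j) * bs r p j x = bs r p j x.
Proof.
move=> hr; have [jr|jr] := boolP (j <= r <= j + p)%N; last first.
  by rewrite bs_out ?mulr0//; lia.
by rewrite divff ?mul1r// subr_eq0 gt_eqF//; apply: t_lt hr _ _; lia.
Qed.

Lemma sum_bs r p M x : t r < t r.+1 -> (p <= r < M)%N ->
  \sum_(j < M) bs r p j x = 1.
Proof.
move=> hr; elim: p => [|p IH] /andP[pr rM].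
  rewrite (bigD1 (Ordinal rM)) //= eqxx big1 ?addr0// => i.
  by rewrite -val_eqE /= => /negbTE->.
transitivity (\sum_(j < M) 1 * bs r p.+1 j x).
  by apply: eq_bigr => j _; rewrite mul1r.
rewrite (@sum_bsS r p M (fun=> 1))// ?pr// -[RHS]IH; last by rewrite rM ltnW.
apply: eq_bigr => j _; rewrite -[RHS]bs_cancel//; congr (_ / _ * _); ring.
Qed.

(** [s1] and [(s1^2 - s2)/2] are the elementary symmetric functions of the [p] inner knots of
    B-spline [j], so [sum_bs1] and [sum_bs2] are the linear and quadratic cases of Marsden's
    identity. *)
Definition s1 p j : R := \sum_(i < p) t (j + i.+1)%N.
Definition s2 p j : R := \sum_(i < p) t (j + i.+1)%N ^+ 2.

Lemma s1S p j : s1 p.+1 j = s1 p j + t (j + p.+1)%N.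
Proof. by rewrite /s1 big_ord_recr. Qed.

Lemma s2S p j : s2 p.+1 j = s2 p j + t (j + p.+1)%N ^+ 2.
Proof. by rewrite /s2 big_ord_recr. Qed.

Lemma s1Sl p j : s1 p.+1 j = t j.+1 + s1 p j.+1.
Proof.
rewrite /s1 big_ord_recl addn1; congr (_ + _); apply: eq_bigr => i _.
by rewrite /= ?bump0 ?add1n addnS addSn ?addnS.
Qed.

Lemma s2Sl p j : s2 p.+1 j = t j.+1 ^+ 2 + s2 p j.+1.
Proof.
rewrite /s2 big_ord_recl addn1; congr (_ + _); apply: eq_bigr => i _.
by rewrite /= ?bump0 ?add1n addnS addSn ?addnS.
Qed.

Lemma sum_bs1 r p M x : t r < t r.+1 -> (p <= r < M)%N ->
  \sum_(j < M) s1 p j * bs r p j x = p%:R * x.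
Proof.
move=> hr; elim: p => [|p IH] /andP[pr rM].
  by rewrite mul0r big1// => j _; rewrite /s1 big_ord0 mul0r.
rewrite (@sum_bsS r p M (s1 p.+1))// ?pr//.
transitivity (\sum_(j < M) (s1 p j * bs r p j x + x * bs r p j x)); last first.
  rewrite big_split /= IH ?rM ?andbT 1?ltnW// -mulr_sumr sum_bs ?mulr1//; first last.
    by rewrite rM ltnW.
  by rewrite -natr1; ring.
apply: eq_bigr => -[[|j] jM] _ /=.
  by rewrite bs_out ?mulr0 ?addr0// add0n pr orbT.
rewrite -mulrDl -[in RHS](@bs_cancel r p j.+1 x hr) mulrA; congr (_ * _ ).
by rewrite [RHS]mulrA s1S s1Sl; congr (_ / _); ring.
Qed.

Lemma sum_bs2 r p M x : t r < t r.+1 -> (p <= r < M)%N ->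
  \sum_(j < M) (s1 p j ^+ 2 - s2 p j) * bs r p j x = p%:R * (p%:R - 1) * x ^+ 2.
Proof.
move=> hr; elim: p => [|p IH] /andP[pr rM].
  by rewrite !mul0r big1// => j _; rewrite /s1 /s2 !big_ord0; ring.
rewrite (@sum_bsS r p M (fun j => s1 p.+1 j ^+ 2 - s2 p.+1 j))// ?pr//.
transitivity (\sum_(j < M) ((s1 p j ^+ 2 - s2 p j) * bs r p j x +
   2 * x * (s1 p j * bs r p j x))); last first.
  rewrite big_split /= IH ?rM ?andbT 1?ltnW// -mulr_sumr sum_bs1 //; first last.
    by rewrite rM ltnW.
  by rewrite -natr1; ring.
apply: eq_bigr => -[[|j] jM] _ /=.
  by rewrite bs_out ?mulr0 ?addr0// add0n pr orbT.
rewrite [X in _ = _ + X]mulrA -mulrDl -[in RHS](@bs_cancel r p j.+1 x hr) mulrA; congr (_ * _ ).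
by rewrite [RHS]mulrA s1S s1Sl s2S s2Sl; congr (_ / _); ring.
Qed.

Definition dbs r p j x : R :=
  if p is p'.+1 then
    p%:R * (bs r p' j x / (t (j + p)%N - t j) -
            bs r p' j.+1 x / (t (j + p).+1 - t j.+1))
  else 0.

(** A vanishing outer span forces the inner one to vanish, and then both sides are 0 because
    [0^-1 = 0]; this lets the derivative formula cover repeated knots. *)
Lemma divff_cancel i j k l : (i <= j <= k)%N -> (k <= l)%N ->
  (t l - t i) / (t l - t i) / (t k - t j) = (t k - t j)^-1.
Proof.
move=> /andP[ij jk] kl; have [e|e] := eqVneq (t l) (t i); last first.
  by rewrite divff ?mul1r// subr_eq0.
suff -> : t k = t j by rewrite subrr invr0 mulr0.
by apply/eqP; rewrite eq_le (t_homo jk) andbT (le_trans (t_homo kl))// e t_homo.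
Qed.

(** The difference formula [dbs] obeys the recursion obtained by differentiating [bsS];
    [bs_poly_deriv] then follows by induction. *)
Lemma dbsS r p j x : dbs r p.+1 j x =
  bs r p j x / (t (j + p.+1)%N - t j) +
  (x - t j) / (t (j + p.+1)%N - t j) * dbs r p j x -
  bs r p j.+1 x / (t (j + p.+1).+1 - t j.+1) +
  (t (j + p.+1).+1 - x) / (t (j + p.+1).+1 - t j.+1) * dbs r p j.+1 x.
Proof.
case: p => [|p]; first by rewrite /dbs; ring.
have e1 : (t (j + p.+2)%N - t j) / (t (j + p.+2)%N - t j) /
  (t (j + p.+1).+1 - t j.+1) = (t (j + p.+1).+1 - t j.+1)^-1.
  by rewrite -addnS; apply: divff_cancel; lia.
have e2 : (t (j + p.+2).+1 - t j.+1) / (t (j + p.+2).+1 - t j.+1) /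
  (t (j + p.+1).+1 - t j.+1) = (t (j + p.+1).+1 - t j.+1)^-1.
  by apply: divff_cancel; lia.
rewrite /dbs !bsS (_ : p.+2%:R = p.+1%:R + 1 :> R) ?natr1// !addSn !addnS in e1 e2 *.
move: e1 e2.
set a := (_ - _)^-1; set b := (t _ - t j.+1)^-1; set c := (t _ - t j.+1)^-1.
set d := (t (j + p).+1 - t j)^-1; set e := (t (j + p).+3 - t j.+2)^-1.
set P := (p.+1)%:R.
move=> e1 e2; have -> : p.+2%:R = P + 1 by rewrite /P natr1.
apply/eqP; rewrite -subr_eq0; set E := (X in X == 0).
suff -> : E = P * bs r p j.+1 x * (((t (j + p).+2 - t j) * a * b - b) -
   ((t (j + p).+3 - t j.+1) * c * b - b)) by rewrite e1 e2 !subrr mulr0.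
by rewrite /E; ring.
Qed.

Fixpoint bs_poly (r p j : nat) : {poly R} :=
  if p is p'.+1 then
    ((t (j + p)%N - t j)^-1)%:P * ('X - (t j)%:P) * bs_poly r p' j +
    ((t (j + p).+1 - t j.+1)^-1)%:P * ((t (j + p).+1)%:P - 'X) * bs_poly r p' j.+1
  else ((j == r)%:R)%:P.

Lemma bs_polyE r p j x : (bs_poly r p j).[x] = bs r p j x.
Proof.
by elim: p j => [|p IH] j; rewrite /= !hornerE// !IH; ring.
Qed.

Lemma bs_poly_deriv r p j x : (bs_poly r p j)^`().[x] = dbs r p j x.
Proof.
elim: p j => [|p IH] j; first by rewrite /= derivC hornerE.
rewrite dbsS /= !(derivD, derivM, derivC, derivX, derivN).
rewrite !(mul0r, add0r, subr0, sub0r, mulr1, mulrN1).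
by rewrite !(hornerD, hornerN, hornerM, hornerC, hornerX) !IH !bs_polyE; ring.
Qed.

Lemma sum_dbs r p M (c : nat -> R) x : t r < t r.+1 -> (p < r < M)%N ->
  \sum_(j < M) c j * dbs r p.+1 j x =
  p.+1%:R * \sum_(j < M) (c j - c j.-1) / (t (j + p.+1)%N - t j) * bs r p j x.
Proof.
move=> hr /andP[pr rM]; case: M rM => // M rM.
rewrite (eq_bigr (fun j : 'I_M.+1 =>
    p.+1%:R * (c j * (bs r p j x / (t (j + p.+1)%N - t j))) -
    p.+1%:R * (c j * (bs r p j.+1 x / (t (j + p.+1).+1 - t j.+1)))));
  last by move=> j _; rewrite /dbs; ring.
rewrite sumrB /= -!mulr_sumr -mulrBr; congr (_ * _).
rewrite [X in _ - X]big_ord_recr /= bs_out ?rM// mul0r mulr0 addr0.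
rewrite [in RHS]big_ord_recl [in RHS]/= [in RHS]bs_out ?mulr0 ?add0r; last first.
  by rewrite add0n pr orbT.
rewrite big_ord_recl /= bs_out ?mulr0 ?mul0r ?mulr0 ?add0r; last by rewrite add0n pr orbT.
by rewrite -sumrB; apply: eq_bigr => j _ /=; ring.
Qed.

(** Continuity at a simple knot, from degree 1 on: the recursion has the same coefficients on both
    pieces, so only degree 1 is checked. *)
Lemma bs_glue r p j : t r < t r.+1 -> t r.+1 < t r.+2 ->
  bs r p.+1 j (t r.+1) = bs r.+1 p.+1 j (t r.+1).
Proof.
move=> h1 h2; elim: p j => [|p IH] j; last by rewrite !(bsS _ p.+1) !IH.
rewrite /= !addn1.
have [->|jr] := eqVneq j r.
  rewrite (ltn_eqF (ltnSn r)) (gtn_eqF (ltnSn r)) eqxx.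
  by rewrite !mulr1 !mulr0 addr0 add0r !divff// subr_eq0 gt_eqF.
have [->|jr1] := eqVneq j r.+1.
  by rewrite subrr !mul0r (gtn_eqF (ltnW (ltnSn r.+1))) (gtn_eqF (ltnSn r.+1)) !mulr0 addr0.
rewrite eqSS (negbTE jr) !mulr0; have [->|] := eqVneq j.+1 r; last by rewrite mulr0.
by rewrite subrr !mul0r addr0.
Qed.

Lemma bs_knot_gt0 r p j : t r < t r.+1 -> t r.+1 < t r.+2 ->
  (j <= r <= j + p)%N -> 0 < bs r.+1 p.+1 j (t r.+1).
Proof.
move=> h1 h2; elim: p j => [|p IH] j jr; rewrite bsS.
  have -> : j = r by lia.
  rewrite [bs _ 0 _ _]/= (ltn_eqF (ltnSn r)) mulr0 add0r /= eqxx mulr1.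
  by rewrite divr_gt0 ?subr_gt0 ?addn1.
have hx : t r.+1 <= t r.+1 <= t r.+2 by rewrite lexx ltW.
have tj i : (i <= r)%N -> t i < t r.+1 by move=> ir; exact: t_lt h1 ir _.
have tj' i : (r.+2 <= i)%N -> t r.+1 < t i by move=> ir; apply: t_lt h2 _ _.
have [e|e] := leqP r (j + p).
  rewrite ltr_wpDr//.
    rewrite mulr_ge0 ?bs_ge0// divr_ge0// subr_ge0 t_homo//; lia.
  rewrite mulr_gt0 ?IH//; last by lia.
  by rewrite divr_gt0// subr_gt0; [apply: tj|apply: t_lt h1 _ _]; lia.
rewrite ltr_wpDl//.
  rewrite mulr_ge0 ?bs_ge0// divr_ge0// subr_ge0 ?t_homo//; lia.
rewrite mulr_gt0 ?IH//; last by lia.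
by rewrite divr_gt0// subr_gt0; [apply: tj'|apply: t_lt h2 _ _]; lia.
Qed.

(** The B-spline scaled so that its integral does not depend on [j]: the derivative is then the
    degree times a difference of neighbours, and the recursion has polynomial coefficients. *)
Definition bd r p j x : R := bs r p j x / (t (j + p).+1 - t j).

Lemma bs_bd r p j x : bs r p.+1 j x =
  (x - t j) * bd r p j x + (t (j + p).+2 - x) * bd r p j.+1 x.
Proof. by rewrite bsS /bd !addSn !addnS; ring. Qed.

Lemma bd_ge0 r p j x : t r < x < t r.+1 -> 0 <= bd r p j x.
Proof.
move=> /andP[h1 h2]; apply: divr_ge0; first by rewrite bs_ge0// !ltW.
by rewrite subr_ge0 t_homo//; lia.
Qed.

Lemma bd_gt0 r p j x : t r < x < t r.+1 -> (j <= r <= j + p)%N -> 0 < bd r p j x.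
Proof.
move=> h jr; rewrite divr_gt0 ?bs_gt0// subr_gt0; case/andP: h => h1 h2.
by apply: (t_lt (lt_trans h1 h2)); lia.
Qed.

Lemma bd_out r p j x : (r < j)%N || (j + p < r)%N -> bd r p j x = 0.
Proof. by move=> h; rewrite /bd bs_out ?mul0r. Qed.

(* The positivity behind the monotone likelihood ratio of adjacent B-splines. *)
Lemma bs_wronskian r p j x : t r < x < t r.+1 ->
  0 <= (bd r p j.+1 x - bd r p j x) * bs r p.+1 j.+1 x +
       (bd r p j.+1 x - bd r p j.+2 x) * bs r p.+1 j x.
Proof.
move=> hx; have /andP[h1 h2] := hx; have hr := lt_trans h1 h2.
have bs0 p' j' : 0 <= bs r p' j' x by rewrite bs_ge0// !ltW.
have D0 p' j' : 0 <= bd r p' j' x by exact: bd_ge0.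
elim: p j => [|p IH] j.
  have [e|ne] := eqVneq r j.+1; last first.
    rewrite !bs_bd; have -> : bd r 0 j.+1 x = 0.
      by rewrite /bd /= eq_sym (negbTE ne) mul0r.
    rewrite !sub0r !mulr0 addr0 add0r; have [e|e] := eqVneq r j.
      have -> : bd r 0 j.+2 x = 0 by rewrite bd_out// e; lia.
      by rewrite !mulr0 oppr0 mul0r addr0.
    have -> : bd r 0 j x = 0 by rewrite /bd /= eq_sym (negbTE e) mul0r.
    by rewrite !mulr0 oppr0 mul0r addr0.
  have -> : bd r 0 j x = 0 by rewrite bd_out// e; lia.
  have -> : bd r 0 j.+2 x = 0 by rewrite bd_out// e; lia.
  by rewrite !subr0 addr_ge0// mulr_ge0.
have [jr|jr] := boolP (j < r <= j.+1 + p.+1)%N; last first.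
  have m0 : bd r p.+1 j.+1 x = 0 by rewrite bd_out//; lia.
  rewrite !bs_bd m0 !sub0r !mulr0 addr0 add0r.
  suff q0 : bd r p.+1 j x * bd r p.+1 j.+2 x = 0.
    set u := bd r _ j x in q0 *; set v := bd r _ j.+2 x in q0 *.
    rewrite [X in 0 <= X](_ : _ = u * v * - (x - t j + (t (j.+1 + p.+1).+2 - x))).
      by rewrite q0 mul0r.
    by ring.
  have [e|e] := leqP r j; first by rewrite [X in _ * X]bd_out ?mulr0//; lia.
  by rewrite bd_out ?mul0r//; lia.
have m0 : 0 < bd r p.+1 j.+1 x by rewrite bd_gt0.
have a0 : 0 < x - t j.+1 by rewrite subr_gt0 (le_lt_trans _ h1)// t_homo; lia.
have b0 : 0 < t (j + p).+3 - x.
  by rewrite subr_gt0 (lt_le_trans h2)// t_homo; lia.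
(* With both spans cleared this is the induction hypothesis multiplied by
   [(x - t i) * (t (i + p).+3 - x)]. If one of the two [bd] factors on the left vanishes it is
   immediate. *)
have claim i : (i <= r)%N -> (r <= i + p.+2)%N -> (i = j \/ i = j.+1) ->
    (x - t i + (t (i + p).+3 - x)) * bd r p.+1 i x * bd r p.+1 i.+1 x <=
    ((x - t i) * bd r p.+1 i x + (t (i + p).+3 - x) * bd r p.+1 i.+1 x) *
    bd r p i.+1 x.
  move=> ir rip _.
  have ai : 0 <= x - t i by rewrite subr_ge0 (le_trans _ (ltW h1))// t_homo.
  have bi : 0 <= t (i + p).+3 - x.
    by rewrite subr_ge0 (le_trans (ltW h2))// t_homo//; lia.
  have [e|e] := leqP r (i + p.+1); last first.
    rewrite (bd_out (j := i)) ?e ?orbT// !mulr0 mul0r add0r.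
    exact: mulr_ge0 (mulr_ge0 bi (D0 _ _)) (D0 _ _).
  have [e'|e'] := leqP r i.
    by rewrite !(bd_out (j := i.+1)) ?ltnS ?e'// !mulr0.
  have dU : 0 < t (i + p.+1).+1 - t i by rewrite subr_gt0 (t_lt hr)//; lia.
  have dV : 0 < t (i.+1 + p.+1).+1 - t i.+1 by rewrite subr_gt0 (t_lt hr)//; lia.
  have EU : bs r p.+1 i x = bd r p.+1 i x * (t (i + p.+1).+1 - t i).
    by rewrite /bd divfK// gt_eqF.
  have EV : bs r p.+1 i.+1 x = bd r p.+1 i.+1 x * (t (i.+1 + p.+1).+1 - t i.+1).
    by rewrite /bd divfK// gt_eqF.
  have EU' := bs_bd r p i x; have EV' := bs_bd r p i.+1 x.
  have := IH i; rewrite -subr_ge0 => X.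
  rewrite -subr_ge0 -(pmulr_rge0 _ dU) -(pmulr_rge0 _ dV).
  rewrite !addSn !addnS in EU EV EU' EV' *.
  set q0 := bd r p.+1 i x in EU EV *; set m := bd r p.+1 i.+1 x in EU EV *.
  have X' := mulr_ge0 (mulr_ge0 ai bi) X.
  have w1 : bd r p i.+1 x * (t (i + p).+3 - t i.+1) - bs r p.+1 i.+1 x =
      (t (i + p).+3 - x) * (bd r p i.+1 x - bd r p i.+2 x) by rewrite EV'; ring.
  have w2 : bd r p i.+1 x * (t (i + p).+2 - t i) - bs r p.+1 i x =
      (x - t i) * (bd r p i.+1 x - bd r p i x) by rewrite EU'; ring.
  rewrite [X in 0 <= X](_ : _ =
    (x - t i) * bs r p.+1 i x *
      (bd r p i.+1 x * (t (i + p).+3 - t i.+1) - bs r p.+1 i.+1 x) +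
    (t (i + p).+3 - x) * bs r p.+1 i.+1 x *
      (bd r p i.+1 x * (t (i + p).+2 - t i) - bs r p.+1 i x)).
    by rewrite w1 w2; move: X'; rewrite subr0; set L := (X in 0 <= X -> _);
      move=> X'; rewrite [X in 0 <= X](_ : _ = L)// /L; ring.
  by rewrite EU EV; ring.
have c1 : 0 <= bs r p.+2 j.+1 x by [].
have c0 : 0 <= bs r p.+2 j x by [].
have jr1 : (j <= r)%N by case/andP: jr => /ltnW.
have jr2 : (r <= j + p.+2)%N by case/andP: jr; rewrite addSn -addnS.
have jr3 : (r <= j.+1 + p.+2)%N by lia.
have jr4 : (j < r)%N by case/andP: jr.
have := claim j jr1 jr2 (or_introl erefl).
have := claim j.+1 jr4 jr3 (or_intror erefl).
have EU := bs_bd r p.+1 j x; have EV := bs_bd r p.+1 j.+1 x.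
have EM : bs r p.+1 j.+1 x = bd r p.+1 j.+1 x * (t (j.+1 + p.+1).+1 - t j.+1).
  by rewrite /bd divfK// gt_eqF// subr_gt0 (t_lt hr)//; lia.
have EM' := bs_bd r p j.+1 x.
rewrite !addSn !addnS in EU EV EM EM' *.
move: EM EM'.
set m := bd r p.+1 j.+1 x in m0 EU EV *.
set q0 := bd r p.+1 j x in EU *; set q1 := bd r p.+1 j.+2 x in EV *.
set a := x - t j in EU *; set a' := x - t j.+1 in a0 EV *.
set b' := t (j + p).+3 - x in b0 EU *; set b := t (j + p).+4 - x in EV *.
set r0 := bd r p j.+1 x; set r1 := bd r p j.+2 x.
move=> -> EM C1 C0.
have {}EM : m * (a' + b') = a' * r0 + b' * r1 by rewrite -EM /a' /b'; ring.
rewrite -EV in C1; rewrite -EU in C0.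
(* After multiplication by [m * a' * b'] the goal is the sum of the claims at [j] and [j.+1], with
   weights [a'] times B-spline [j.+1] and [b'] times B-spline [j]; the recursion for [m] merges [r0]
   and [r1]. *)
rewrite -(pmulr_rge0 _ m0) -(pmulr_rge0 _ a0) -(pmulr_rge0 _ b0).
have C0' := ler_wpM2l (mulr_ge0 (ltW a0) c1) C0.
have C1' := ler_wpM2l (mulr_ge0 (ltW b0) c0) C1.
have := lerD C0' C1'; rewrite -subr_ge0.
rewrite (_ : a' * bs r p.+2 j.+1 x * (bs r p.+2 j x * r0) +
  b' * bs r p.+2 j x * (bs r p.+2 j.+1 x * r1) =
  (a' * r0 + b' * r1) * bs r p.+2 j x * bs r p.+2 j.+1 x); last by ring.
rewrite -EM; set L := (X in 0 <= X -> _) => hL.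
rewrite [X in 0 <= X](_ : _ = L)// /L EU EV; ring.
Qed.
End CoxDeBoor.

Section BsTransforms.
Variable R : realFieldType.
Implicit Types t : nat -> R.

Lemma bs_shift t t' s c r p j x :
  (forall i, (j <= i <= j + p.+1)%N -> t' (i + s)%N = t i + c) ->
  bs t' (r + s) p (j + s) (x + c) = bs t r p j x.
Proof.
elim: p j => [|p IH] j ht; first by rewrite /= eqn_add2r.
have IHj : bs t' (r + s) p (j + s) (x + c) = bs t r p j x.
  by apply: IH => i hi; apply: ht; lia.
have IHj1 : bs t' (r + s) p (j + s).+1 (x + c) = bs t r p j.+1 x.
  by rewrite -addSn; apply: IH => i hi; apply: ht; lia.
rewrite !bsS IHj IHj1 addnAC -!addSn !ht; try lia.
by congr (_ / _ * _ + _ / _ * _); ring.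
Qed.

Lemma bs_scale t t' a r p j x : a != 0 -> (forall i, t' i = a * t i) ->
  bs t' r p j (a * x) = bs t r p j x.
Proof.
move=> a0 ht; elim: p j => [//|p IH] j; rewrite !bsS !IH !ht -!mulrBr.
by rewrite -!mulf_div !divff// !mul1r.
Qed.

Lemma bs_refl t t' c m r r' p j j' x : (r + r').+1 = m -> (j + j' + p).+1 = m ->
  (forall i i', (i + i')%N = m -> t' i' = c - t i) ->
  bs t' r' p j' (c - x) = bs t r p j x.
Proof.
move=> hr + ht; elim: p j j' => [|p IH] j j' hj.
  by rewrite /=; congr (_%:R); apply/eqP/eqP; lia.
rewrite !bsS (IH j.+1 j') ?(IH j j'.+1); try lia.
rewrite (ht (j + p.+1).+1 j') ?(ht j.+1 (j' + p.+1)%N)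
  ?(ht j (j' + p.+1).+1) ?(ht (j + p.+1)%N j'.+1); try lia.
rewrite addrC; by congr (_ / _ * _ + _ / _ * _); ring.
Qed.

End BsTransforms.

Arguments bs : simpl never.
Arguments dbs : simpl never.
Arguments bs_poly : simpl never.

(** * Derivatives of piecewise functions *)

Section Calculus.
Variable R : realType.
Implicit Types (f df : R -> R) (x d a b : R).

(** In this epsilon form a derivative can be glued from the two sides by a case split, as in
    [is_derive_glue]. *)
Lemma is_deriveP f x d : is_derive x 1 f d <->
  forall e, 0 < e -> exists2 r, 0 < r &
    forall y, `|y - x| < r -> `|f y - f x - d * (y - x)| <= e * `|y - x|.
Proof.
split=> [[df <-] e e0|h].
  have /cvgrPdist_le /(_ e e0) [r /= r0 hr] := df.
  exists r => // y yr; have [->|yx] := eqVneq y x.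
    by rewrite !subrr mulr0 subrr normr0 mulr0.
  have yx0 : y - x != 0 by rewrite subr_eq0.
  have := hr (y - x); rewrite /ball/= sub0r normrN => /(_ yr yx0).
  rewrite /GRing.scale/= mulr1 subrK -(ler_pM2r (x := `|y - x|)) ?normr_gt0//.
  rewrite -normrM mulrBl mulrAC mulVf// mul1r.
  by rewrite -normrN opprB.
have cv : (fun t => t^-1 *: ((f \o shift x) (t *: 1) - f x)) @ (0:R)^' --> d.
  apply/cvgrPdist_le => e e0; have [r r0 hr] := h e e0.
  exists r => //= t; rewrite /ball/= sub0r normrN => tr t0.
  have := hr (t + x); rewrite addrK => /(_ tr).
  move=> H; rewrite /GRing.scale/= mulr1 -(ler_pM2r (x := `|t|)) ?normr_gt0//.
  by rewrite -normrM mulrBl mulrAC mulVf// mul1r -normrN opprB.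
split; first by apply/cvg_ex; exists d.
exact: cvg_lim cv.
Qed.

Lemma is_derive_glue f (g h : R -> R) x d (r : R) : 0 < r ->
  (forall y, x - r < y <= x -> f y = g y) -> (forall y, x <= y < x + r -> f y = h y) ->
  is_derive x 1 g d -> is_derive x 1 h d -> is_derive x 1 f d.
Proof.
move=> r0 fg fh /is_deriveP dg /is_deriveP dh; apply/is_deriveP => e e0.
have [r1 r10 h1] := dg e e0; have [r2 r20 h2] := dh e e0.
exists (Num.min r (Num.min r1 r2)); first by rewrite !lt_min r0 r10 r20.
move=> y; rewrite !lt_min => /and3P[yr yr1 yr2].
have [yx|xy] := leP y x.
  rewrite fg ?[f x]fg ?h1//; first by rewrite lexx ltrBlDr ltrDl r0.
  by rewrite yx andbT; move: yr; rewrite ltr_norml => /andP[]; lra.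
rewrite fh ?[f x]fh ?h2//; first by rewrite lexx ltrDl r0.
by rewrite ltW//=; move: yr; rewrite ltr_norml => /andP[]; lra.
Qed.

(** Clamping the index below [n] continues the outermost pieces beyond both ends, so the derivative
    exists on the whole line and one-sided derivatives at the ends do not arise. *)
Lemma is_derive_pieces (g dg : nat -> R -> R) n x : (0 < n)%N ->
  (forall q, (q.+1 < n)%N -> g q q.+1%:R = g q.+1 q.+1%:R) ->
  (forall q, (q.+1 < n)%N -> dg q q.+1%:R = dg q.+1 q.+1%:R) ->
  (forall q (y : R), is_derive y 1 (g q) (dg q y)) ->
  let idx (y : R) := minn (Num.truncn y) n.-1 in
  is_derive x 1 (fun y => g (idx y) y) (dg (idx x) x).
Proof.
move=> n0 hg hdg dg' idx.
have idxP q y : (q < n)%N -> ((q = 0)%N \/ q%:R <= y) ->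
    ((q.+1 = n)%N \/ y < q.+1%:R) -> idx y = q.
  move=> qn hl hr; rewrite /idx.
  have h1 : (q <= Num.truncn y)%N.
    by case: hl => [->//|hl]; rewrite truncn_ge_nat// (le_trans _ hl).
  case: hr => [hr|hr]; first by move: (Num.truncn y) h1 hr qn => u; lia.
  rewrite -truncn_le_nat in hr.
  by move: (Num.truncn y) h1 hr qn => u; lia.
set q := idx x.
have qn : (q < n)%N by rewrite /q /idx; move: (Num.truncn x) => u; lia.
have qx : (q <= Num.truncn x)%N by rewrite /q /idx geq_minl.
have xr : q.+1 = n \/ x < q.+1%:R.
  have [e|e] := eqVneq q.+1 n; [by left|right].
  rewrite -truncn_le_nat; move: e; rewrite /q /idx.
  by move: (Num.truncn x) => u; lia.
have xl : (q = 0)%N \/ q%:R <= x.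
  have [q0|q0] := posnP q; [by left|right].
  have x1 : 1 <= x by rewrite -truncn_gt0 (leq_trans q0 qx).
  by rewrite -truncn_ge_nat// (le_trans ler01 x1).
have [r r0 hr] : exists2 r, 0 < r & forall y, x <= y < x + r -> idx y = q.
  case: xr => [e|e].
    by exists 1 => // y /andP[xy _]; apply: idxP; [|case: xl; [left|right; lra]|left].
  exists (q.+1%:R - x) => [|y /andP[xy yr]]; first by rewrite subr_gt0.
  by apply: idxP; [|case: xl; [left|right; lra]|right; lra].
have [xq|xq] := eqVneq x q%:R; last first.
  have [r' r'0 hr'] : exists2 r, 0 < r & forall y, x - r < y <= x -> idx y = q.
    case: xl => [e|e].
      exists 1 => // y /andP[_ xy]; apply: idxP; [by []|by left|].
      by case: xr => [?|?]; [left|right; lra].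
    have {}e : q%:R < x by rewrite lt_neqAle e eq_sym xq.
    exists (x - q%:R) => [|y /andP[yr xy]]; first by rewrite subr_gt0.
    by apply: idxP; [by []|right; lra|case: xr => [?|?]; [left|right; lra]].
  apply: (@is_derive_glue _ (g q) (g q) _ _ (Num.min r r')).
  - by rewrite lt_min r0 r'0.
  - by move=> y /andP[h1 h2]; rewrite hr'// h2 andbT; move: h1; rewrite ltrBlDr -ltrBlDl lt_min; lra.
  - by move=> y /andP[h1 h2]; rewrite hr// h1/=; move: h2; rewrite -ltrBlDl lt_min => /andP[]; lra.
have [q0|q0] := posnP q.
  apply: (@is_derive_glue _ (g q) (g q) _ _ r) => //.
  - move=> y /andP[_ h2]; rewrite (_ : idx y = q)//; apply: idxP => //; first by left.
    by case: xr => [?|?]; [left|right; lra].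
  - by move=> y /hr ->.
have e : q.-1.+1 = q by rewrite prednK.
apply: (@is_derive_glue _ (g q.-1) (g q) _ _ (Num.min r 1)).
- by rewrite lt_min r0 ltr01.
- move=> y /andP[h1 h2]; have [->|yx] := eqVneq y x.
    have hq := hg q.-1; rewrite e in hq.
    by rewrite -/q xq hq.
  rewrite (_ : idx y = q.-1)//; apply: idxP; first lia; right; last first.
    by rewrite e -xq lt_neqAle yx.
  have : (q.-1)%:R + 1 = x by rewrite natr1 e xq.
  by move: h1; rewrite ltrBlDr -ltrBlDl lt_min => /andP[]; lra.
- by move=> y /andP[h1 h2]; rewrite hr// h1/=; move: h2; rewrite -ltrBlDl lt_min => /andP[]; lra.
- have hq := hdg q.-1; rewrite e in hq.
  by have -> : dg q x = dg q.-1 x by rewrite xq hq.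
Qed.

Lemma derive_mvt f df a b : (forall x : R, is_derive x 1 f (df x)) -> a < b ->
  exists2 c, a < c < b & f b - f a = df c * (b - a).
Proof.
move=> h ab; have [//|c] := @MVT _ f df a b ab; last by rewrite in_itv; exists c.
by apply: derivable_within_continuous => x _; have [] := h x.
Qed.

Lemma derive_ge0 f df a b : (forall x : R, is_derive x 1 f (df x)) -> a <= b ->
  (forall x, a < x < b -> 0 <= df x) -> f a <= f b.
Proof.
move=> h; rewrite le_eqVlt => /predU1P[->//|ab] df0.
have [c hc e] := derive_mvt h ab.
by rewrite -subr_ge0 e mulr_ge0 ?df0// subr_ge0 ltW.
Qed.

Lemma derive_le0 f df a b : (forall x : R, is_derive x 1 f (df x)) -> a <= b ->
  (forall x, a < x < b -> df x <= 0) -> f b <= f a.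
Proof.
move=> h; rewrite le_eqVlt => /predU1P[->//|ab] df0.
have [c hc e] := derive_mvt h ab.
by rewrite -subr_le0 e mulr_le0_ge0 ?df0// subr_ge0 ltW.
Qed.

Lemma is_derive_affine f a l x d :
  is_derive (a + l * x) 1 f d -> is_derive x 1 (fun s => f (a + l * s)) (l * d).
Proof.
move=> df; have dl : is_derive x 1 (fun s : R => a + l * s) l.
  have -> : (fun s : R => a + l * s) = horner (a%:P + l%:P * 'X).
    by apply/funext => y; rewrite hornerD hornerM !hornerC hornerX.
  apply: (@is_derive_eq _ _ _ _ _ _ _ _ (is_derive_poly _ _)).
  by rewrite derivD derivM !derivC derivX mul0r add0r add0r mulr1 hornerC.
have h := @is_derive1_comp _ f (fun s : R => a + l * s) x _ _ df dl.
by apply: (@is_derive_eq _ _ _ _ _ _ _ _ h); rewrite mulrC.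
Qed.

Lemma is_derive_cvg f x d : is_derive x 1 f d -> f z @[z --> x] --> f x.
Proof.
by move=> df; apply: differentiable_continuous; apply/derivable1_diffP; apply: ex_derive.
Qed.

End Calculus.

(** * Splines on the scaled uniform knots *)

Section Uniform.
Variables (R : realType) (n k : nat).
Hypothesis n_gt0 : (0 < n)%N.

(* [n] times the paper's knots, with the index [-k] shifted to 0; the subtraction
   is truncated, so that the first [k + 1] knots are 0. *)
Definition uknot (j : nat) : R := (minn (j - k) n)%:R.

Lemma tt_homo : {homo uknot : i j / (i <= j)%N >-> i <= j}.
Proof. by move=> i j ij; rewrite ler_nat; lia. Qed.

Lemma tt_mid q : (q <= n)%N -> uknot (k + q) = q%:R.
Proof. by move=> qn; rewrite /uknot; congr _%:R; lia. Qed.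

Lemma tt_ge0 j : 0 <= uknot j. Proof. exact: ler0n. Qed.

Lemma tt_le j : uknot j <= n%:R. Proof. by rewrite ler_nat geq_minr. Qed.

(* The piece containing [x], the last piece being closed on the right; outside
   [[0, n]] the splines below continue their outermost polynomials. *)
Definition pc (x : R) := (k + minn (Num.truncn x) n.-1)%N.

Lemma pc_bd x : (k <= pc x < k + n)%N.
Proof. by rewrite /pc; move: (Num.truncn x) => u; lia. Qed.

Lemma tt_piece r : (k <= r < k + n)%N -> uknot r < uknot r.+1.
Proof. by move=> hr; rewrite ltr_nat; lia. Qed.

Lemma tt_pc_lt x : uknot (pc x) < uknot (pc x).+1.
Proof. exact: tt_piece (pc_bd x). Qed.

Lemma tt_pc x : 0 <= x <= n%:R -> uknot (pc x) <= x <= uknot (pc x).+1.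
Proof.
move=> /andP[x0 xn]; have /andP[h1 h2] := truncn_itv x0.
rewrite /pc -addnS !tt_mid; last 2 first.
- by move: (Num.truncn x) => u; lia.
- by move: (Num.truncn x) => u; lia.
apply/andP; split.
  by rewrite (le_trans _ h1)// ler_nat geq_minl.
have [e|e] := leqP (Num.truncn x) n.-1.
  exact: ltW.
by rewrite prednK.
Qed.

Lemma pcE x r : (k <= r < k + n)%N -> uknot r <= x < uknot r.+1 -> pc x = r.
Proof.
move=> hr /andP[h1 h2]; have e : r = (k + (r - k))%N by lia.
move: h1 h2; rewrite e -addnS !tt_mid; try lia.
move=> h1 h2; rewrite /pc (truncn_def (n := (r - k)%N)) ?h1//; lia.
Qed.

Lemma pc_cases x r : (k <= r < k + n)%N -> uknot r <= x <= uknot r.+1 ->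
  pc x = r \/ (x = uknot r.+1 /\ (r.+1 < k + n)%N /\ pc x = r.+1).
Proof.
move=> hr /andP[h1]; rewrite le_eqVlt => /predU1P[->|h2]; last first.
  by left; apply: pcE => //; rewrite h1.
have [e|e] := leqP (k + n) r.+1; last first.
  right; split=> //; split=> //; apply: pcE; first lia.
  by rewrite lexx tt_piece//; lia.
left; have er : r = (k + n.-1)%N by lia.
by rewrite er -addnS prednK// tt_mid// /pc natrK; lia.
Qed.

Definition ubs p j x := bs uknot (pc x) p j x.
Definition udbs p j x := dbs uknot (pc x) p j x.

(** At a knot the piece on the left gives the same value, by continuity; hence the closed interval
    and the degree at least 1. *)
Lemma B_piece r p j x : (k <= r < k + n)%N -> uknot r <= x <= uknot r.+1 ->
  ubs p.+1 j x = bs uknot r p.+1 j x.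
Proof.
move=> hr hx; rewrite /ubs; have [->//|[xr [rk ->]]] := pc_cases hr hx.
by rewrite xr -bs_glue// tt_piece//; lia.
Qed.

Lemma is_derive_bs t r p j (x : R) : {homo t : i j / (i <= j)%N >-> i <= j} ->
  is_derive x 1 (bs t r p j) (dbs t r p j x).
Proof.
move=> t_homo; rewrite -bs_poly_deriv//.
rewrite (_ : bs t r p j = horner (bs_poly t r p j)); first exact: is_derive_poly.
by apply/funext => y; rewrite bs_polyE.
Qed.

Lemma is_derive_B p j (x : R) : is_derive x 1 (ubs p.+2 j) (udbs p.+2 j x).
Proof.
have := @is_derive_pieces R (fun q => bs uknot (k + q) p.+2 j)
  (fun q => dbs uknot (k + q) p.+2 j) n x n_gt0; apply.
- move=> q qn; rewrite addnS -[q.+1%:R](tt_mid (ltnW qn)) addnS bs_glue ?tt_piece//; lia.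
- move=> q qn; rewrite addnS -[q.+1%:R](tt_mid (ltnW qn)) /dbs addnS.
  by rewrite !(bs_glue (r := (k + q)%N)) ?tt_piece//; lia.
- by move=> q y; apply: is_derive_bs; exact: tt_homo.
Qed.

Lemma B_ge0 p j x : 0 <= x <= n%:R -> 0 <= ubs p j x.
Proof. by move=> /tt_pc; apply: bs_ge0; exact: tt_homo. Qed.

Lemma tt_refl i i' : (i + i')%N = (n + k.*2)%N -> uknot i' = n%:R - uknot i.
Proof.
move=> h; apply/eqP; rewrite eq_sym subr_eq -natrD eqr_nat; apply/eqP; lia.
Qed.

Lemma B_refl p j j' x : (j + j' + p).+2 = (n + k.*2)%N -> 0 <= x <= n%:R ->
  ubs p.+1 j' (n%:R - x) = ubs p.+1 j x.
Proof.
move=> hj hx; have := pc_bd x; have := tt_pc hx.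
rewrite [ubs _ j x]/ubs; move: (pc x) => r /andP[h1 h2] hr.
rewrite (B_piece (r := n + k.*2 - r.+1)); first last.
- have e1 : (r.+1 + (n + k.*2 - r.+1) = n + k.*2)%N by clear h1 h2 hx; lia.
  have e2 : (r + (n + k.*2 - r.+1).+1 = n + k.*2)%N by clear h1 h2 hx; lia.
  by rewrite (tt_refl e1) (tt_refl e2) !lerB.
- by clear h1 h2 hx; lia.
by apply: bs_refl tt_refl; clear h1 h2 hx; lia.
Qed.

Lemma sum_B p x : (p <= k)%N -> \sum_(j < n + k) ubs p j x = 1.
Proof.
by move=> pk; apply: sum_bs; [exact: tt_homo|exact: tt_pc_lt|have := pc_bd x; lia].
Qed.

Definition greville j := s1 uknot k j / k%:R.

Definition bsum p (c : nat -> R) x := \sum_(j < n + k) c j * ubs p j x.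

(* The B-spline coefficients of [x^2 / 2]. *)
Definition qcoef j := (s1 uknot k j ^+ 2 - s2 uknot k j) / (2 * k%:R * (k%:R - 1)).

Lemma splD p c c' x : bsum p (fun j => c j + c' j) x = bsum p c x + bsum p c' x.
Proof. by rewrite /bsum -big_split; apply: eq_bigr => j _; rewrite mulrDl. Qed.

Lemma splB p c c' x : bsum p (fun j => c j - c' j) x = bsum p c x - bsum p c' x.
Proof. by rewrite /bsum -sumrB; apply: eq_bigr => j _; rewrite mulrBl. Qed.

Lemma splZ p a c x : bsum p (fun j => a * c j) x = a * bsum p c x.
Proof. by rewrite /bsum mulr_sumr; apply: eq_bigr => j _; rewrite mulrA. Qed.

Lemma eq_spl p c c' x : (forall j, (j < n + k)%N -> c j = c' j) ->
  bsum p c x = bsum p c' x.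
Proof. by move=> h; apply: eq_bigr => j _; rewrite h. Qed.

Lemma spl_cst p a x : (p <= k)%N -> bsum p (fun=> a) x = a.
Proof. by move=> pk; rewrite /bsum -mulr_sumr sum_B// mulr1. Qed.

Lemma spl_ge0 p c x : 0 <= x <= n%:R ->
  (forall j, (j < n + k)%N -> 0 <= c j) -> 0 <= bsum p c x.
Proof. by move=> hx h; apply: sumr_ge0 => j _; rewrite mulr_ge0 ?h ?B_ge0. Qed.

Lemma le_spl p c c' x : 0 <= x <= n%:R ->
  (forall j, (j < n + k)%N -> c j <= c' j) -> bsum p c x <= bsum p c' x.
Proof.
by move=> hx h; rewrite -subr_ge0 -splB spl_ge0// => j jn; rewrite subr_ge0 h.
Qed.

Lemma spl_xi x : (0 < k)%N -> bsum k greville x = x.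
Proof.
move=> k0; have k0' : k%:R != 0 :> R by rewrite pnatr_eq0 -lt0n.
have := @sum_bs1 R uknot tt_homo (pc x) k (n + k) x (tt_pc_lt x).
have := pc_bd x => hx; rewrite (_ : (k <= pc x < n + k)%N); last by lia.
move=> /(_ isT) h; rewrite -[RHS](mulKf k0') -h mulr_sumr.
by apply: eq_bigr => j _; rewrite /greville mulrAC mulrC.
Qed.

Lemma spl_q2 x : (1 < k)%N -> bsum k qcoef x = x ^+ 2 / 2.
Proof.
move=> k1; have k0' : k%:R != 0 :> R by rewrite pnatr_eq0 -lt0n ltnW.
have k1' : k%:R - 1 != 0 :> R by rewrite subr_eq0 (eqr_nat _ _ 1); lia.
have := @sum_bs2 R uknot tt_homo (pc x) k (n + k) x (tt_pc_lt x).
have := pc_bd x => hx; rewrite (_ : (k <= pc x < n + k)%N); last by lia.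
move=> /(_ isT) h.
transitivity ((2 * k%:R * (k%:R - 1))^-1 * (k%:R * (k%:R - 1) * x ^+ 2)).
  by rewrite -h mulr_sumr; apply: eq_bigr => j _; rewrite /qcoef mulrAC mulrC.
by field; rewrite k0' k1'.
Qed.

(* The coefficients of the derivative of a spline of degree [p]. *)
Definition dc p (c : nat -> R) j := p%:R * (c j - c j.-1) / (uknot (j + p)%N - uknot j).

Lemma is_derive_spl p c (x : R) : (p.+2 <= k)%N ->
  is_derive x 1 (bsum p.+2 c) (bsum p.+1 (dc p.+2 c) x).
Proof.
move=> pk; have -> : bsum p.+2 c = \sum_(j < n + k) (c j *: ubs p.+2 j).
  by apply/funext => y; rewrite /bsum fct_sumE; apply: eq_bigr.
have -> : bsum p.+1 (dc p.+2 c) x = \sum_(j < n + k) c j *: udbs p.+2 j x.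
  have hp : (p.+1 < pc x < n + k)%N by have := pc_bd x; move: (pc x) => r; lia.
  rewrite -[RHS]/(\sum_(j < n + k) c j * dbs uknot (pc x) p.+2 j x).
  rewrite (@sum_dbs _ _ (pc x) p.+1 _ c x (tt_pc_lt x) hp).
  by rewrite mulr_sumr; apply: eq_bigr => j _; rewrite /dc /ubs !mulrA.
apply: is_derive_sum => j; have := is_derive_B p j x => h.
exact: is_deriveZ.
Qed.

Lemma B_at0 p j : (p <= k)%N -> ubs p j 0 = (j == (k - p)%N)%:R.
Proof.
have -> : ubs p j 0 = bs uknot k p j 0.
  by rewrite /ubs /pc (_ : Num.truncn 0 = 0%N) ?min0n ?addn0//; apply/truncn0Pn; rewrite ler10.
elim: p j => [|p IH] j pk; first by rewrite subn0.
rewrite bsS !IH ?(ltnW pk)//.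
have t0 i : (i <= k)%N -> uknot i = 0 by move=> h; rewrite /uknot (_ : (i - k)%N = 0%N) ?min0n; [|nlia].
have [e|e] := eqVneq j (k - p)%N.
  have e1 : (j.+1 == (k - p)%N) = false by nlia.
  have e2 : (j == (k - p.+1)%N) = false by nlia.
  by rewrite e1 e2 mulr0 addr0 mulr1 (t0 j) ?subrr ?mul0r//; nlia.
rewrite mulr0 add0r; have [e'|e'] := eqVneq j.+1 (k - p)%N.
  have -> : (j == (k - p.+1)%N) = true by nlia.
  have tj : uknot j.+1 = 0 by apply: t0; nlia.
  have tj' : 0 < uknot (j + p.+1).+1.
    rewrite -(t0 k)//; apply: (t_lt tt_homo (r := k)); [|nlia|nlia].
    by apply: tt_piece; nlia.
  by rewrite tj !subr0 divff ?mulr1// gt_eqF.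
have -> : (j == (k - p.+1)%N) = false by nlia.
by rewrite mulr0.
Qed.

Lemma spl_at0 p c : (p <= k)%N -> bsum p c 0 = c (k - p)%N.
Proof.
move=> pk; have h : (k - p < n + k)%N by nlia.
rewrite /bsum (bigD1 (Ordinal h)) //= B_at0// eqxx mulr1 big1 ?addr0// => j jn.
have e : (j == (k - p)%N :> nat) = false.
  by apply/negbTE; apply: contra jn => /eqP e; apply/eqP/val_inj.
by rewrite B_at0// e mulr0.
Qed.

Lemma B_refl0 p j j' x : (0 < p)%N -> (j + j' + p).+1 = (n + k.*2)%N ->
  0 <= x <= n%:R -> ubs p j' (n%:R - x) = ubs p j x.
Proof. by case: p => // p _ h; apply: B_refl; rewrite -addnS. Qed.

Lemma spl_refl c x : (0 < k)%N -> 0 <= x <= n%:R ->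
  bsum k c (n%:R - x) = bsum k (fun j => c (n + k - j.+1)%N) x.
Proof.
move=> k0 hx; rewrite /bsum (reindex_inj rev_ord_inj) /=; apply: eq_bigr => j _.
congr (_ * _); apply: B_refl0 => //.
by have := ltn_ord j; move: (nat_of_ord j) => i; nlia.
Qed.

Lemma spl_atn c : (0 < k)%N -> bsum k c n%:R = c (n + k).-1.
Proof.
move=> k0; have := @spl_refl c 0 k0; rewrite subr0 => -> //.
  by rewrite spl_at0// subnn subn1.
by rewrite lexx ler0n.
Qed.

Lemma left_piece x : 0 < x <= n%:R ->
  exists2 r, (k <= r < k + n)%N & uknot r < x <= uknot r.+1.
Proof.
move=> /andP[x0 xn]; have := tt_pc (x := x); rewrite (ltW x0) xn => /(_ isT).
have := pc_bd x; move: (pc x) => q hq /andP[h1 h2].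
move: h1; rewrite le_eqVlt => /predU1P[e|h1]; last by exists q; rewrite ?h1.
have q0 : (k < q)%N.
  rewrite ltn_neqAle; case/andP: hq => -> _; rewrite andbT.
  by apply/eqP => kp; move: x0; rewrite -e -kp -[X in uknot X]addn0 tt_mid// ltxx.
have e' : q.-1.+1 = q by nlia.
exists q.-1; first nlia.
by rewrite e' e lexx andbT -e -{2}e' tt_piece//; nlia.
Qed.

(** At [x = 0] this fails: the repeated knot 0 makes one B-spline equal to 1 there. *)
Lemma B_out_l p j x : 0 < x <= n%:R -> x <= uknot j -> ubs p.+1 j x = 0.
Proof.
move=> hx xj; have [r hr /andP[h1 h2]] := left_piece hx.
rewrite (B_piece _ _ hr) ?(ltW h1)// bs_out//; apply/orP; left.
rewrite ltnNge; apply/negP => /tt_homo jr.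
by have := lt_le_trans h1 xj; rewrite ltNge jr.
Qed.

Lemma B_out_r p j x : 0 <= x < n%:R -> uknot (j + p.+2) <= x -> ubs p.+1 j x = 0.
Proof.
move=> /andP[x0 xn] xj; have hp := pc_bd x.
have /andP[h1] : uknot (pc x) <= x <= uknot (pc x).+1 by rewrite tt_pc// x0 ltW.
rewrite le_eqVlt => /predU1P[e|h2].
  have e' : pc x = (k + n.-1)%N.
    apply/eqP; rewrite eqn_leq; apply/andP; split.
      by move: (pc x) hp => q hq; nlia.
    rewrite leqNgt; apply/negP => lt; have hq : (k <= (pc x).+1 < k + n)%N.
      by move: (pc x) hp lt => q hq lt; nlia.
    have : pc x = (pc x).+1 by apply: pcE => //; apply/andP; split; [rewrite -e|rewrite [X in X < _]e tt_piece].
    by move: (pc x) => q; nlia.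
  by move: xn; rewrite e e' -addnS prednK// tt_mid// ltxx.
rewrite /ubs bs_out//; apply/orP; right.
rewrite ltnNge; apply/negP => rj.
by have := le_lt_trans xj h2; rewrite ltNge tt_homo//; move: (pc x) rj => q; nlia.
Qed.

Lemma B_gt0 p j x : 0 < x < n%:R -> uknot j < x < uknot (j + p.+2) -> 0 < ubs p.+1 j x.
Proof.
move=> /andP[x0 xn] /andP[jx xj].
have [|r hr /andP[h1 h2]] := @left_piece x; first by rewrite x0 ltW.
have jr : (j <= r)%N.
  rewrite -ltnS ltnNge; apply/negP => /tt_homo h.
  by have := le_lt_trans (le_trans h2 h) jx; rewrite ltxx.
rewrite (B_piece _ _ hr) ?(ltW h1)//.
move: h2; rewrite le_eqVlt => /predU1P[e|h2].
  have rn : (r.+1 < k + n)%N.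
    rewrite ltnNge; apply/negP => /tt_homo.
    by rewrite tt_mid// leNgt -e xn.
  have rj : (r.+1 < j + p.+2)%N.
    by rewrite ltnNge; apply/negP => /tt_homo; rewrite leNgt -e xj.
  have h3 : uknot r < uknot r.+1 by exact: tt_piece.
  have h4 : uknot r.+1 < uknot r.+2 by apply: tt_piece; nlia.
  rewrite e bs_glue// bs_knot_gt0//; first exact: tt_homo.
  nlia.
apply: bs_gt0; [exact: tt_homo|by rewrite h1|].
have : (r < j + p.+2)%N.
  by rewrite ltnNge; apply/negP => /tt_homo; rewrite leNgt (lt_trans h1 xj).
nlia.
Qed.

(** The length of the support of B-spline [l.+1] of degree [k - 2], the one that [ccurv c l]
    multiplies in the second derivative of a spline. *)
Definition kgap l : R := uknot (l + k) - uknot l.+1.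

Lemma T_gt0 l : (0 < l)%N -> (l.+1 < n + k)%N -> (1 < k)%N -> 1 <= kgap l.
Proof.
move=> l0 ln k1; rewrite /kgap lerBrDr addrC natr1 ler_nat; nlia.
Qed.

End Uniform.

(** * Control polygons and convexity *)

Section ControlPolygon.
Variables (R : realType) (n k : nat).
Hypotheses (n0 : (0 < n)%N) (k3 : (3 <= k)%N).
Local Notation N := (n + k)%N.
Local Notation t := (uknot R n k).
Local Notation xi := (greville R n k).
Local Notation spl := (bsum n k).
Local Notation S := (spl k).
Local Notation T := (kgap R n k).
Local Notation q2 := (qcoef R n k).
Implicit Types (c : nat -> R) (x y z : R).

(** Slopes are indexed by their right node: [cslope c i.+1] belongs to the edge from node [i] to
    node [i.+1] of the control polygon, and [cjump c l] is its break at node [l]. At [l = 0] the gap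
    [kgap] is 0, which makes [ccurv c 0 = 0]. *)
Definition cslope c := dc n k k c.
Definition cjump c l := cslope c l.+1 - cslope c l.
Definition ccurv c l := (k%:R - 1) * cjump c l / T l.
Definition cconvex c := forall l, (0 < l)%N -> (l.+1 < N)%N -> 0 <= cjump c l.

Lemma kR_gt0 : 0 < k%:R :> R. Proof. by rewrite ltr0n; nlia. Qed.

Lemma k1R_gt0 : 0 < k%:R - 1 :> R.
Proof. by rewrite subr_gt0 ltr1n; nlia. Qed.

Lemma is_derive_spl' p c x : (2 <= p <= k)%N ->
  is_derive x 1 (spl p c) (spl p.-1 (dc n k p c) x).
Proof. by case: p => [|[|p]] // pk; apply: is_derive_spl. Qed.

Lemma is_derive_S c x : is_derive x 1 (S c) (spl k.-1 (cslope c) x).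
Proof. by apply: is_derive_spl'; nlia. Qed.

Lemma is_derive_S1 c x :
  is_derive x 1 (spl k.-1 (cslope c)) (spl k.-2 (dc n k k.-1 (cslope c)) x).
Proof. by apply: is_derive_spl'; nlia. Qed.

Lemma dc_ac c l : dc n k k.-1 (cslope c) l.+1 = ccurv c l.
Proof.
rewrite /dc /ccurv /cjump /=; congr (_ * _ / _).
  by rewrite -[k in RHS](ltn_predK k3) -natr1 addrK.
by rewrite /T addSn -addnS (ltn_predK k3).
Qed.

Lemma dc_ac0 c : dc n k k.-1 (cslope c) 0 = 0.
Proof. by rewrite /dc /= subrr mulr0 mul0r. Qed.

Lemma tt0 i : (i <= k)%N -> t i = 0.
Proof.
move=> ik; have e : (i - k)%N = 0%N by nlia.
by rewrite /uknot e min0n.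
Qed.

Lemma T0 : T 0 = 0.
Proof. by rewrite /kgap add0n !tt0 ?subrr//; nlia. Qed.

Lemma ac0 c : ccurv c 0 = 0.
Proof. by rewrite /ccurv T0 invr0 mulr0. Qed.

Lemma xiS j : xi j.+1 - xi j = (t (j + k).+1 - t j.+1) / k%:R.
Proof.
rewrite /greville -mulrBl; congr (_ / _).
have := s1S t k j; rewrite s1Sl addnS => h.
by rewrite -[s1 _ k j.+1](addKr (t j.+1)) h; ring.
Qed.

Lemma xi_lt j : (j.+1 < N)%N -> xi j < xi j.+1.
Proof.
move=> jN; rewrite -subr_gt0 xiS divr_gt0 ?kR_gt0// subr_gt0 /uknot ltr_nat; nlia.
Qed.

Lemma xi_le i j : (i <= j)%N -> xi i <= xi j.
Proof.
move=> ij; rewrite /greville ler_pM2r ?invr_gt0 ?kR_gt0//.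
by apply: ler_sum => p _; apply: tt_homo; move: (nat_of_ord p) => q; nlia.
Qed.

Lemma xi0 : xi 0 = 0.
Proof. by rewrite /greville /s1 big1 ?mul0r// => i _; rewrite tt0// add0n. Qed.

Lemma xiN : xi N.-1 = n%:R.
Proof.
rewrite /greville /s1 (eq_bigr (fun=> n%:R)) => [|i _].
  rewrite sumr_const card_ord -[X in X / _]mulr_natr mulfK// gt_eqF ?kR_gt0//.
by rewrite /uknot; congr _%:R; move: (nat_of_ord i) => j; nlia.
Qed.

Lemma xi_itv j : (j < N)%N -> 0 <= xi j <= n%:R.
Proof.
move=> jN; rewrite -{1}xi0 -xiN !xi_le//; nlia.
Qed.

Lemma slE c i : cslope c i.+1 = (c i.+1 - c i) / (xi i.+1 - xi i).
Proof. by rewrite xiS invf_div /cslope /dc /= addSn mulrA [k%:R * _]mulrC. Qed.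

Lemma sl_mul c i : (i.+1 < N)%N -> cslope c i.+1 * (xi i.+1 - xi i) = c i.+1 - c i.
Proof. by move=> iN; rewrite slE divfK// gt_eqF// subr_gt0 xi_lt. Qed.

Lemma sl_homo c a b : cconvex c -> (0 < a)%N -> (a <= b)%N -> (b < N)%N -> cslope c a <= cslope c b.
Proof.
move=> cc a0; elim: b => [|b IH] ab bN; first by rewrite leqn0 in ab; rewrite (eqP ab).
move: ab; rewrite leq_eqVlt => /predU1P[->//|ab].
rewrite (le_trans (IH _ _))//; [nlia|].
by rewrite -subr_ge0; apply: cc => //; nlia.
Qed.

Lemma cvx_line c i j : cconvex c -> (0 < i)%N -> (i.+1 < N)%N -> (j < N)%N ->
  c i + cslope c i.+1 * (xi j - xi i) <= c j.
Proof.
move=> cc i0 iN jN; have [ij|ji] := leqP i j.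
  elim: j ij jN => [|j IH] ij jN; first by rewrite leqn0 in ij; rewrite (eqP ij) subrr mulr0 addr0.
  move: ij; rewrite leq_eqVlt => /predU1P[<-|ij]; first by rewrite subrr mulr0 addr0.
  have h := sl_homo cc (ltn0Sn i) ij jN.
  have h1 := IH ij (ltnW jN); have h2 := sl_mul c jN.
  have h3 : 0 <= (cslope c j.+1 - cslope c i.+1) * (xi j.+1 - xi j).
    by rewrite mulr_ge0// subr_ge0// ltW// xi_lt.
  rewrite -subr_ge0 in h1; rewrite -subr_ge0.
  have := addr_ge0 h1 h3; congr (0 <= _); rewrite mulrBl h2; ring.
suff H d : (d <= i)%N -> c i + cslope c i.+1 * (xi (i - d)%N - xi i) <= c (i - d)%N.
  by have := H (i - j)%N; rewrite leq_subr subKn ?(ltnW ji)//; apply.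
elim: d => [|d IH] di; first by rewrite subn0 subrr mulr0 addr0.
have := IH (ltnW di); have e : (i - d = (i - d.+1).+1)%N by nlia.
have jN' : ((i - d.+1).+1 < N)%N by nlia.
have h : cslope c (i - d) <= cslope c i.+1 by apply: sl_homo => //; nlia.
move: h; rewrite e; move: (i - d.+1)%N jN' => u uN h h1.
have h2 := sl_mul c uN.
have h3 : 0 <= (cslope c i.+1 - cslope c u.+1) * (xi u.+1 - xi u).
  by rewrite mulr_ge0// subr_ge0// ltW// xi_lt.
rewrite -subr_ge0 in h1; rewrite -subr_ge0.
have := addr_ge0 h1 h3; congr (0 <= _); rewrite mulrBl h2; ring.
Qed.

Lemma S_line a b x : S (fun j => a + b * xi j) x = a + b * x.
Proof. by rewrite (@splD R n k k (fun=> a) (fun j => b * xi j)) splZ spl_cst// spl_xi//; nlia. Qed.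

(** [S] is positive and reproduces the supporting line of [c] at node [i]. *)
Lemma jensen c i : cconvex c -> (0 < i)%N -> (i.+1 < N)%N -> c i <= S c (xi i).
Proof.
move=> cc i0 iN; have hx : 0 <= xi i <= n%:R by apply: xi_itv; nlia.
have := @le_spl R n k n0 k (fun j => (c i - cslope c i.+1 * xi i) + cslope c i.+1 * xi j) c (xi i) hx.
rewrite S_line subrK; apply => j jN.
by have := cvx_line cc i0 iN jN; congr (_ <= _); ring.
Qed.

Lemma S0 c : S c 0 = c 0.
Proof. by rewrite spl_at0// subnn. Qed.

Lemma Sn c : S c n%:R = c N.-1.
Proof. by rewrite spl_atn//; nlia. Qed.

Lemma T_ge1 l : (0 < l)%N -> (l.+1 < N)%N -> 1 <= T l.
Proof. by move=> l0 lN; apply: T_gt0 => //; nlia. Qed.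

Lemma T_gt0' l : (0 < l)%N -> (l.+1 < N)%N -> 0 < T l.
Proof. by move=> l0 lN; rewrite (lt_le_trans ltr01)// T_ge1. Qed.

Lemma ac_ge0 c l : cconvex c -> (l.+1 < N)%N -> 0 <= ccurv c l.
Proof.
move=> cc lN; have [->|l0] := posnP l; first by rewrite ac0.
by rewrite /ccurv divr_ge0 ?mulr_ge0 ?cc// ltW ?k1R_gt0 ?T_gt0'.
Qed.

Lemma S2_ge0 c x : cconvex c -> 0 <= x <= n%:R ->
  0 <= spl k.-2 (dc n k k.-1 (cslope c)) x.
Proof.
move=> cc hx; apply: spl_ge0 => // -[|l] lN; first by rewrite dc_ac0.
by rewrite dc_ac ac_ge0.
Qed.

Lemma S1_homo c x y : cconvex c -> 0 <= x -> x <= y -> y <= n%:R ->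
  spl k.-1 (cslope c) x <= spl k.-1 (cslope c) y.
Proof.
move=> cc x0 xy yn; apply: derive_ge0 (is_derive_S1 c) xy _ => z /andP[xz zy].
by apply: S2_ge0 => //; rewrite (le_trans x0) ?(ltW xz)//= (le_trans (ltW zy)).
Qed.

Lemma S_cvx c x y z : cconvex c -> 0 <= x -> x <= y -> y <= z -> z <= n%:R ->
  (S c y - S c x) * (z - y) <= (S c z - S c y) * (y - x).
Proof.
move=> cc x0; rewrite le_eqVlt => /predU1P[->|xy].
  by rewrite !subrr mul0r mulr0.
rewrite le_eqVlt => /predU1P[->|yz] zn; first by rewrite !subrr mul0r mulr0.
have [u /andP[xu uy] eu] := derive_mvt (is_derive_S c) xy.
have [v /andP[yv vz] ev] := derive_mvt (is_derive_S c) yz.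
rewrite eu ev mulrAC [leRHS]mulrAC -!mulrA [(z - y) * _]mulrC.
apply: ler_wpM2r; first by rewrite mulr_ge0// subr_ge0 ltW.
apply: S1_homo => //; [lra|lra|lra].
Qed.

Lemma jumpE c l : (0 < l)%N -> (l.+1 < N)%N -> cjump c l =
  (c l.+1 - c l) / (xi l.+1 - xi l) - (c l - c l.-1) / (xi l - xi l.-1).
Proof. by case: l => // l _ lN; rewrite /cjump !slE. Qed.

Lemma cvx_S c : cconvex c -> cconvex (fun j => S c (xi j)).
Proof.
move=> cc l l0 lN; rewrite jumpE//.
have h1 : 0 < xi l.+1 - xi l by rewrite subr_gt0 xi_lt.
have h2 : 0 < xi l - xi l.-1.
  by case: l l0 lN {h1} => // l _ lN; rewrite subr_gt0 xi_lt//; nlia.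
rewrite subr_ge0 ler_pdivrMr// mulrAC ler_pdivlMr//.
have lN' : (l.-1 < N)%N by nlia.
have /andP[a1 _] := xi_itv lN'; have /andP[_ a2] := xi_itv lN.
by apply: S_cvx => //; rewrite -subr_ge0 ltW.
Qed.

Lemma jumpD c c' l : cjump (fun j => c j + c' j) l = cjump c l + cjump c' l.
Proof. by rewrite /cjump /cslope /dc; ring. Qed.

Lemma jumpZ a c l : cjump (fun j => a * c j) l = a * cjump c l.
Proof. by rewrite /cjump /cslope /dc; ring. Qed.

Lemma jumpB c c' l : cjump (fun j => c j - c' j) l = cjump c l - cjump c' l.
Proof. by rewrite /cjump /cslope /dc; ring. Qed.

Lemma jump_line a b l : (0 < l)%N -> (l.+1 < N)%N -> cjump (fun j => a + b * xi j) l = 0.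
Proof.
move=> l0 lN; rewrite jumpE//.
have h1 : xi l.+1 - xi l != 0 by rewrite gt_eqF// subr_gt0 xi_lt.
have h2 : xi l - xi l.-1 != 0.
  by case: l l0 lN {h1} => // l _ lN; rewrite gt_eqF// subr_gt0 xi_lt//; nlia.
have E u v : a + b * u - (a + b * v) = b * (u - v) by ring.
by rewrite !E !mulfK ?subrr.
Qed.

Lemma ac_q2 l : (0 < l)%N -> (l.+1 < N)%N -> ccurv q2 l = 1.
Proof.
move=> l0 lN; have k1 := k1R_gt0; have k0 := kR_gt0.
have sq i : (i.+1 < N)%N -> cslope q2 i.+1 = s1 t k.-1 i.+1 / (k%:R - 1).
  move=> iN; have e : k = k.-1.+1 by nlia.
  have dt : t (i + k).+1 - t i.+1 != 0.
    by have := xi_lt iN; rewrite -subr_gt0 xiS pmulr_lgt0 ?invr_gt0// => /gt_eqF ->.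
  rewrite /cslope /dc /= /qcoef addSn.
  have E1 : s1 t k i.+1 = s1 t k.-1 i.+1 + t (i + k).+1.
    by rewrite [X in s1 _ X]e s1S addSn -e.
  have E2 : s1 t k i = t i.+1 + s1 t k.-1 i.+1 by rewrite [X in s1 _ X]e s1Sl.
  have E3 : s2 t k i.+1 = s2 t k.-1 i.+1 + t (i + k).+1 ^+ 2.
    by rewrite [X in s2 _ X]e s2S addSn -e.
  have E4 : s2 t k i = t i.+1 ^+ 2 + s2 t k.-1 i.+1 by rewrite [X in s2 _ X]e s2Sl.
  rewrite E1 E2 E3 E4; move: (s1 _ _ _) (s2 _ _ _) (t _) (t _) dt => u v y z dt.
  by field; rewrite dt !gt_eqF.
have T0' : T l != 0 by rewrite gt_eqF// T_gt0'.
case: l l0 lN T0' => // l _ lN T0'.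
rewrite /ccurv /cjump !sq//; last by nlia.
have e : k.-1 = k.-2.+1 by nlia.
have E : s1 t k.-1 l.+2 - s1 t k.-1 l.+1 = T l.+1.
  have := s1S t k.-1 l.+1; rewrite s1Sl => h.
  rewrite -[s1 _ _ l.+2](addKr (t l.+2)) h /kgap.
  rewrite (_ : (l.+1 + k.-1.+1 = l.+1 + k)%N); last by nlia.
  by ring.
rewrite -mulrBl E; move: (T _) T0' => u u0.
by field; rewrite u0 gt_eqF.
Qed.

(** Both [A * q2 + c] and [A * q2 - c] are convex, hence so are [A x^2 / 2] plus and minus [S c]. *)
Lemma S_second c A x y : (forall l, (0 < l)%N -> (l.+1 < N)%N -> `|ccurv c l| <= A) ->
  0 <= x -> 0 <= y -> x + 2 * y <= n%:R ->
  `|S c x - 2 * S c (x + y) + S c (x + 2 * y)| <= A * y ^+ 2.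
Proof.
move=> hA x0; rewrite le_eqVlt => /predU1P[<-|y0] xn.
  by rewrite !mulr0 !addr0 expr0n /= mulr0 (_ : _ - _ + _ = 0) ?normr0//; ring.
have key e : (e = 1 \/ e = -1) ->
    0 <= A * y ^+ 2 + e * (S c x - 2 * S c (x + y) + S c (x + 2 * y)).
  move=> he; have cc : cconvex (fun j => A * q2 j + e * c j).
    move=> l l0 lN; rewrite jumpD !jumpZ.
    have T1 := T_gt0' l0 lN; have k1 := k1R_gt0.
    have jE c' : cjump c' l = ccurv c' l * (T l / (k%:R - 1)).
      rewrite /ccurv; move: (T l) T1 (cjump c' l) => u u0 v.
      by field; rewrite !gt_eqF.
    rewrite !jE ac_q2// mul1r (mulrA e) -mulrDl.
    apply: mulr_ge0; last by rewrite divr_ge0// ltW.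
    have := hA l l0 lN; rewrite ler_norml => /andP[h1 h2].
    by case: he => ->; rewrite ?mul1r ?mulN1r; lra.
  have := @S_cvx _ x (x + y) (x + 2 * y) cc x0.
  rewrite !splD !splZ !spl_q2; try nlia.
  move=> H; have {H} := H ltac:(lra) ltac:(lra) xn.
  have e1 : x + 2 * y - (x + y) = y by ring.
  have e2 : x + y - x = y by ring.
  rewrite e1 e2 ler_pM2r// -subr_ge0; congr (0 <= _).
  by move: (S c _) (S c _) (S c _) => u v w; field.
rewrite ler_norml; have h1 := key 1 (or_introl erefl).
have h2 := key (-1) (or_intror erefl).
by apply/andP; split; lra.
Qed.

(** Since [chinge l] vanishes at node [l], [hinge_value] and [qdefect] are the increments of the
    hinge and of [q2] under [S] at that node. The hinge has a single break, of size 1, at [l]. *)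
Definition chinge l j : R := Num.max (xi l - xi j) 0.
Definition hinge_value l := S (chinge l) (xi l).
Definition qdefect l := xi l ^+ 2 / 2 - q2 l.

Lemma hinge_jump l i : (0 < i)%N -> (i.+1 < N)%N -> (0 < l)%N -> (l.+1 < N)%N ->
  cjump (chinge l) i = (i == l)%:R.
Proof.
move=> i0 iN l0 lN; have lt a b : (a < b)%N -> (b < N)%N -> xi a < xi b.
  move=> ab bN; apply: lt_le_trans (xi_lt _) (xi_le ab); nlia.
have hl a : (a <= l)%N -> chinge l a = xi l - xi a.
  by move=> al; rewrite /chinge; apply/max_idPl; rewrite subr_ge0 xi_le.
have hr a : (l <= a)%N -> chinge l a = 0.
  by move=> al; rewrite /chinge; apply/max_idPr; rewrite subr_le0 xi_le.
have d1 : xi i - xi i.-1 != 0 by rewrite gt_eqF// subr_gt0 lt//; nlia.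
have d2 : xi i.+1 - xi i != 0 by rewrite gt_eqF// subr_gt0 lt//; nlia.
rewrite jumpE//; have [il|li|e] := ltngtP i l.
- rewrite !hl; [|nlia..].
  have e u v : xi l - u - (xi l - v) = - (u - v) by ring.
  by rewrite !e !mulNr !divff// subrr.
- rewrite !hr; [|nlia..].
  by rewrite !subrr !mul0r subrr.
- rewrite (hr i.+1) ?(hr i) ?(hl i.-1); [|nlia..].
  rewrite subrr mul0r !sub0r -e opprB.
  by rewrite -opprB mulNr opprK divff.
Qed.

Lemma acE c l : (0 < l)%N -> (l.+1 < N)%N -> cjump c l = ccurv c l * (T l / (k%:R - 1)).
Proof.
move=> l0 lN; have T1 := T_gt0' l0 lN; have k1 := k1R_gt0.
rewrite /ccurv; move: (T l) T1 (cjump c l) => u u0 v.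
by field; rewrite !gt_eqF.
Qed.

(* Jensen's inequality for the convex sequence [2 A (q2 - hinge) - (A q2 - c)],
   whose curvature at [l] vanishes. *)
Lemma ac_max_bound c l G : (0 < l)%N -> (l.+1 < N)%N ->
  (forall i, (0 < i)%N -> (i.+1 < N)%N -> `|ccurv c i| <= `|ccurv c l|) ->
  `|c l - S c (xi l)| <= G ->
  `|ccurv c l| * (2 * (T l / (k%:R - 1)) * hinge_value l - qdefect l) <= G.
Proof.
move=> l0 lN; wlog h : c / 0 <= ccurv c l => [W hmax hG|].
  have [h|h] := leP 0 (ccurv c l); first exact: W.
  have aN i : ccurv (fun j => -1 * c j) i = - ccurv c i by rewrite /ccurv jumpZ; ring.
  have := W (fun j => -1 * c j); rewrite !aN normrN splZ; apply.
  - by rewrite oppr_ge0 ltW.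
  - by move=> i i0 iN; rewrite aN normrN hmax.
  - by rewrite -mulrBr normrM normrN1 mul1r.
rewrite (ger0_norm h); set A := ccurv c l => hmax hG.
set b := T l / (k%:R - 1); have b0 : 0 < b by rewrite divr_gt0 ?T_gt0' ?k1R_gt0.
have cz : cconvex (fun j => 2 * A * (q2 j - b * chinge l j) - (A * q2 j - c j)).
  move=> i i0 iN; rewrite !(jumpB, jumpZ) hinge_jump// !acE// ac_q2//.
  have := hmax i i0 iN; rewrite ler_norml => /andP[h1 _].
  have bi : 0 < T i / (k%:R - 1) by rewrite divr_gt0 ?T_gt0' ?k1R_gt0.
  have [->|il] := eqVneq i l.
    rewrite -/A -/b le_eqVlt; apply/orP; left; apply/eqP.
    have -> : true%:R = 1 :> R by [].
    by ring.
  rewrite mulr0 subr0 mul1r (_ : _ - _ = (A + ccurv c i) * (T i / (k%:R - 1))).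
    by apply: mulr_ge0; [lra|exact: ltW].
  by ring.
have := jensen cz l0 lN.
have k1 : (1 < k)%N by nlia.
rewrite splB splZ splB splZ splB splZ !(spl_q2 n0 _ k1) -/(hinge_value l).
have -> : chinge l l = 0 by rewrite /chinge subrr maxxx.
move: hG; rewrite ler_norml /qdefect; move: (S c (xi l)) => s /andP[hG _].
move: (xi l ^+ 2 / 2) (q2 l) (hinge_value l) (c l) hG => x q f u hG H.
by move: hG H; clear; lra.
Qed.

Lemma ac_argmax c : exists l, [/\ (0 < l)%N, (l.+1 < N)%N &
  forall i, (0 < i)%N -> (i.+1 < N)%N -> `|ccurv c i| <= `|ccurv c l|].
Proof.
have h1 : (1 < N)%N by nlia.
pose P := [pred i : 'I_N | (0 < i)%N && (i.+1 < N)%N].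
have P1 : P (Ordinal h1) by rewrite inE /=; nlia.
case: (@arg_maxP _ _ _ (Ordinal h1) P (fun i => `|ccurv c i|) P1) => l /andP[l0 lN] hl.
exists l; split=> // i i0 iN.
have iN' : (i < N)%N by nlia.
by apply: (hl (Ordinal iN')); rewrite inE /= i0.
Qed.

Lemma ac_bound_dd c G P : 0 < P ->
  (forall l, (0 < l)%N -> (l.+1 < N)%N ->
    1 <= P * (2 * (T l / (k%:R - 1)) * hinge_value l - qdefect l)) ->
  (forall i, (0 < i)%N -> (i.+1 < N)%N -> `|c i - S c (xi i)| <= G) ->
  forall i, (0 < i)%N -> (i.+1 < N)%N -> `|ccurv c i| <= P * G.
Proof.
move=> P0 hP hG i i0 iN; have [l [l0 lN hl]] := ac_argmax c.
apply: le_trans (hl i i0 iN) _; have := ac_max_bound l0 lN hl (hG l l0 lN).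
rewrite -(ler_pM2l P0) => h; apply: le_trans h.
rewrite mulrCA -[leLHS]mulr1; apply: ler_wpM2l => //; exact: hP.
Qed.

Lemma T_refl l l' : (l + l').+1 = N -> T l' = T l.
Proof.
move=> h; rewrite /kgap (@tt_refl R n k n0 l.+1 (l' + k)) ?(@tt_refl R n k n0 (l + k) l'.+1).
- by ring.
- nlia.
- nlia.
Qed.

Lemma sum_refl (f : R -> R) l l' : (l + l').+1 = N ->
  \sum_(i < k) f (t (l' + i.+1)%N) = \sum_(i < k) f (n%:R - t (l + i.+1)%N).
Proof.
move=> h; rewrite (reindex_inj rev_ord_inj) /=; apply: eq_bigr => i _.
congr f; apply: tt_refl; move: (ltn_ord i); move: (nat_of_ord i) => j; nlia.
Qed.

Lemma s1_refl l l' : (l + l').+1 = N -> s1 t k l' = k%:R * n%:R - s1 t k l.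
Proof.
move=> h; rewrite /s1 (sum_refl id h) sumrB sumr_const card_ord.
by rewrite -[X in X - _]mulr_natl.
Qed.

Lemma s2_refl l l' : (l + l').+1 = N ->
  s2 t k l' = k%:R * n%:R ^+ 2 - 2 * n%:R * s1 t k l + s2 t k l.
Proof.
move=> h; rewrite /s2 (sum_refl (fun u => u ^+ 2) h).
rewrite (eq_bigr (fun i : 'I_k => n%:R ^+ 2 - 2 * n%:R * t (l + i.+1)%N + t (l + i.+1)%N ^+ 2)).
  rewrite big_split sumrB sumr_const card_ord -mulr_sumr /=.
  by rewrite (mulr_natl (n%:R ^+ 2) k).
by move=> i _; ring.
Qed.

Lemma xi_refl l l' : (l + l').+1 = N -> xi l' = n%:R - xi l.
Proof.
move=> h; rewrite /greville (s1_refl h) mulrBl mulrAC divff ?mul1r// gt_eqF//.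
exact: kR_gt0.
Qed.

Lemma vr_refl l l' : (l + l').+1 = N -> qdefect l' = qdefect l.
Proof.
move=> h; rewrite /qdefect /greville /qcoef (s1_refl h) (s2_refl h).
have k0 := kR_gt0; have k1 := k1R_gt0.
move: (s1 _ _ _) (s2 _ _ _) => u v.
by field; rewrite !gt_eqF.
Qed.

Lemma S_refl c x : 0 <= x <= n%:R -> S c (n%:R - x) = S (fun j => c (N - j.+1)%N) x.
Proof. by move=> hx; apply: spl_refl => //; nlia. Qed.

Lemma hinge_flip l : (l < N)%N -> S (fun j => Num.max (xi j - xi l) 0) (xi l) = hinge_value l.
Proof.
move=> lN; rewrite (@eq_spl R n k k _ (fun j => chinge l j + (- xi l + 1 * xi j))).
  by rewrite splD S_line mul1r addNr addr0.
move=> j _; rewrite /chinge mul1r; have [h|h] := leP (xi j) (xi l).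
  by rewrite (max_idPr _) ?(max_idPl _); lra.
by rewrite (max_idPl _) ?(max_idPr _); lra.
Qed.

Lemma Fh_refl l l' : (l + l').+1 = N -> hinge_value l' = hinge_value l.
Proof.
move=> h; have lN : (l < N)%N by nlia.
rewrite {1}/hinge_value (xi_refl h) S_refl ?xi_itv// -(hinge_flip lN).
apply: eq_spl => j jN; rewrite /chinge (xi_refl h) (@xi_refl j (N - j.+1)); last by nlia.
by congr Num.max; ring.
Qed.

End ControlPolygon.

(** * Likelihood ratios and the local estimate *)

Section LikelihoodRatio.
Variables (R : realType) (n k : nat).
Hypothesis n0 : (0 < n)%N.
Local Notation t := (uknot R n k).
Local Notation B := (ubs n k).
Local Notation dB := (udbs n k).
Implicit Types (x y z : R).

Lemma tt_simple i : 0 < t i < n%:R -> t i < t i.+1.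
Proof. by rewrite !ltr_nat (ltr_nat _ 0); nlia. Qed.

(** Carries the sign in [bs_wronskian], known inside a piece, to the knots. *)
Lemma horner_le0_closed (P : {poly R}) (a b : R) : a < b ->
  (forall y, a < y < b -> P.[y] <= 0) -> forall y, a <= y <= b -> P.[y] <= 0.
Proof.
move=> ab hP y hy; rewrite leNgt; apply/negP => Py.
have /cvgrPdist_lt /(_ _ Py) [d /= d0 hd] := @continuous_horner R P y.
have [z hz zy] : exists2 z, a < z < b & `|y - z| < d.
  have [yb|by'] := ltP y b.
    exists (y + Num.min (d / 2) ((b - y) / 2)).
      have : 0 < Num.min (d / 2) ((b - y) / 2) by rewrite lt_min !divr_gt0 ?subr_gt0.
      have : Num.min (d / 2) ((b - y) / 2) <= (b - y) / 2 by rewrite ge_min lexx orbT.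
      by move: hy => /andP[]; lra.
    have : 0 < Num.min (d / 2) ((b - y) / 2) by rewrite lt_min !divr_gt0 ?subr_gt0.
    have : Num.min (d / 2) ((b - y) / 2) <= d / 2 by rewrite ge_min lexx.
    by move=> h1 h2; rewrite opprD addrA subrr sub0r normrN gtr0_norm//; lra.
  exists (y - Num.min (d / 2) ((b - a) / 2)).
    have : 0 < Num.min (d / 2) ((b - a) / 2) by rewrite lt_min !divr_gt0 ?subr_gt0.
    have : Num.min (d / 2) ((b - a) / 2) <= (b - a) / 2 by rewrite ge_min lexx orbT.
    by move: hy => /andP[]; lra.
  have : 0 < Num.min (d / 2) ((b - a) / 2) by rewrite lt_min !divr_gt0 ?subr_gt0.
  have : Num.min (d / 2) ((b - a) / 2) <= d / 2 by rewrite ge_min lexx.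
  by move=> h1 h2; rewrite opprB addrC subrK gtr0_norm//; lra.
have := hd z zy; have := hP z hz => Pz.
by rewrite gtr0_norm; [lra|rewrite subr_gt0 (le_lt_trans Pz)].
Qed.

Lemma B_wronskian p j x : 0 <= x <= n%:R ->
  dB p.+1 j x * B p.+1 j.+1 x - B p.+1 j x * dB p.+1 j.+1 x <= 0.
Proof.
move=> hx; have := @tt_pc R n k n0 x hx; have := @tt_pc_lt R n k n0 x.
rewrite /udbs /ubs; move: (pc n k x) => r hr.
pose P := (bs_poly t r p.+1 j)^`() * bs_poly t r p.+1 j.+1 -
  bs_poly t r p.+1 j * (bs_poly t r p.+1 j.+1)^`().
have th := @tt_homo R n k n0.
have PE y : P.[y] = dbs t r p.+1 j y * bs t r p.+1 j.+1 y -
    bs t r p.+1 j y * dbs t r p.+1 j.+1 y.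
  by rewrite /P hornerD hornerN hornerM [X in _ - X]hornerM !(bs_poly_deriv th) !bs_polyE.
rewrite -PE; apply: (horner_le0_closed hr) => y hy; rewrite PE.
have := @bs_wronskian R t th r p j y hy; rewrite /dbs /bd !addSn !addnS.
move: (_ / _) (_ / _) (_ / _) (bs t r p.+1 j y) (bs t r p.+1 j.+1 y) => u v w U V.
move=> h; have p0 : 0 <= p.+1%:R :> R by [].
rewrite -oppr_ge0; have := mulr_ge0 p0 h.
by congr (0 <= _); ring.
Qed.

Lemma is_derive_ratio (u v : R -> R) (x du dv : R) : v x != 0 ->
  is_derive x 1 u du -> is_derive x 1 v dv ->
  is_derive x 1 (fun z => u z / v z) ((du * v x - u x * dv) / v x ^+ 2).
Proof.
move=> v0 hu hv; have hV := is_deriveV v0 hv.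
have h := @is_deriveM _ _ u (fun z => (v z)^-1) x 1 du _ hu hV.
apply: (@is_derive_eq _ _ _ _ _ _ _ _ h).
rewrite /GRing.scale/=; move: (u x) (v x) v0 => a b b0.
by field.
Qed.

(** Where B-spline [j] is positive the ratio [B_(j+1) / B_j] has a nonnegative derivative by
    [B_wronskian]; otherwise the left product is 0. *)
Lemma B_mlr p j y y' : 0 < y -> y <= y' -> y' < n%:R ->
  B p.+2 j.+1 y * B p.+2 j y' <= B p.+2 j.+1 y' * B p.+2 j y.
Proof.
move=> y0 yy yn.
have hy : 0 <= y <= n%:R by rewrite (ltW y0) (le_trans yy (ltW yn)).
have hy' : 0 <= y' <= n%:R by rewrite (le_trans (ltW y0) yy) ltW.
have R0 : 0 <= B p.+2 j.+1 y' * B p.+2 j y by rewrite mulr_ge0 ?B_ge0.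
have [yl|ly] := leP y (t j.+1).
  by rewrite B_out_l ?mul0r// y0 (le_trans yy (ltW yn)).
have [yr|ry] := leP (t (j + p.+3)) y'.
  by rewrite [X in _ * X]B_out_r ?mulr0// (le_trans (ltW y0) yy).
have pos z : y <= z <= y' -> 0 < B p.+2 j z.
  move=> /andP[yz zy]; apply: B_gt0 => //.
    by rewrite (lt_le_trans y0 yz) (le_lt_trans zy yn).
  rewrite (le_lt_trans zy ry) andbT (lt_le_trans _ yz)// (le_lt_trans _ ly)//.
  exact: tt_homo.
move: yy; rewrite le_eqVlt => /predU1P[->//|yy].
have p1 : 0 < B p.+2 j y by rewrite pos// lexx ltW.
have p2 : 0 < B p.+2 j y' by rewrite pos// lexx ltW.
rewrite -ler_pdivrMr// mulrAC -ler_pdivlMr//.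
have hd z : z \in `[y, y'] -> is_derive z 1 (fun z => B p.+2 j.+1 z / B p.+2 j z)
   ((dB p.+2 j.+1 z * B p.+2 j z - B p.+2 j.+1 z * dB p.+2 j z) / B p.+2 j z ^+ 2).
  rewrite in_itv /= => /pos z0; apply: is_derive_ratio.
  - by rewrite gt_eqF.
  - exact: is_derive_B.
  - exact: is_derive_B.
have hd' z : z \in `]y, y'[ -> is_derive z 1 (fun z => B p.+2 j.+1 z / B p.+2 j z)
   ((dB p.+2 j.+1 z * B p.+2 j z - B p.+2 j.+1 z * dB p.+2 j z) / B p.+2 j z ^+ 2).
  by rewrite in_itv /= => /andP[a b]; apply: hd; rewrite in_itv /= !ltW.
have [|z] := MVT yy hd'.
  by apply: derivable_within_continuous => z /hd [].
rewrite in_itv /= => /andP[yz zy] e.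
rewrite -subr_ge0 e mulr_ge0 ?subr_ge0 ?(ltW yy)// divr_ge0 ?sqr_ge0//.
have := @B_wronskian p.+1 j z; rewrite (le_trans (ltW y0) (ltW yz)) (ltW (lt_trans zy yn)).
move=> /(_ isT); rewrite -oppr_ge0; congr (0 <= _).
by move: (dB _ _ _) (dB _ _ _) (B _ _ _) (B _ _ _) => *; ring.
Qed.

Lemma B_mlr_le p i l y y' : (i <= l)%N -> 0 < y -> y <= y' -> y' < n%:R ->
  B p.+2 l y * B p.+2 i y' <= B p.+2 l y' * B p.+2 i y.
Proof.
move=> il y0 yy yn; have yn0 := lt_le_trans y0 yy; have y'n := le_lt_trans yy yn.
have hy : 0 <= y <= n%:R by rewrite !ltW.
have hy' : 0 <= y' <= n%:R by rewrite !ltW.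
have b0 q j : 0 <= B q j y by exact: B_ge0.
have b0' q j : 0 <= B q j y' by exact: B_ge0.
have th := @tt_homo R n k n0.
rewrite -(subnKC il); elim: (l - i)%N => [|d IH]; first by rewrite addn0 mulrC.
rewrite addnS; set m := (i + d)%N in IH *.
have outl z : 0 < z < n%:R -> z <= t m -> B p.+2 m.+1 z = 0.
  move=> /andP[z0 zn] zt.
  by apply: B_out_l; [exact: n0|rewrite z0 ltW|rewrite (le_trans zt)// th].
have [ly|ly] := leP y (t m); first by rewrite outl ?y0// mul0r mulr_ge0.
have [ry|ry] := leP (t (m + p.+3)) y'.
  by rewrite [X in _ * X]B_out_r ?mulr0 ?mulr_ge0// ?yn ?(ltW yn0)// (le_trans _ ry)// th//; nlia.
have p1 : 0 < B p.+2 m y by apply: B_gt0; rewrite ?y0 ?ly ?(le_lt_trans yy ry).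
have p2 : 0 < B p.+2 m y'.
  by apply: B_gt0; rewrite ?yn0 ?yn ?ry ?(lt_le_trans ly yy).
have h1 := @B_mlr p m y y' y0 yy yn.
rewrite -(ler_pM2r p1) -(ler_pM2r p2).
have := ler_pM (mulr_ge0 (b0 _ _) (b0' _ _)) (mulr_ge0 (b0 _ _) (b0' _ _)) h1 IH.
by rewrite -subr_ge0 => H; rewrite -subr_ge0; move: H; congr (0 <= _); ring.
Qed.

(** The derivative is proportional to [D0 - D1], and [D1 / D0] is nondecreasing: the sign [D0 >= D1]
    at [x] persists to the left, the opposite one to the right. *)
Lemma B_unimodal q j x : 0 < x < n%:R -> t j < x < t (j + q.+4) ->
  (forall y y', 0 < y -> y <= y' -> y' <= x -> B q.+3 j y <= B q.+3 j y') \/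
  (forall y y', x <= y -> y <= y' -> y' < n%:R -> B q.+3 j y' <= B q.+3 j y).
Proof.
move=> /andP[x0 xn] /andP[jx xj]; have th := @tt_homo R n k n0.
pose a := (t (j + q.+3)%N - t j)^-1; pose b := (t (j + q.+3).+1 - t j.+1)^-1.
have a0 : 0 <= a by rewrite invr_ge0 subr_ge0 th// leq_addr.
have b0 : 0 <= b by rewrite invr_ge0 subr_ge0 th//; nlia.
pose D0 z := B q.+2 j z * a; pose D1 z := B q.+2 j.+1 z * b.
have dE z : dB q.+3 j z = q.+3%:R * (D0 z - D1 z) by [].
have D0_ge0 z : 0 <= z <= n%:R -> 0 <= D0 z by move=> hz; rewrite mulr_ge0 ?B_ge0.
have D1_ge0 z : 0 <= z <= n%:R -> 0 <= D1 z by move=> hz; rewrite mulr_ge0 ?B_ge0.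
have hx : 0 <= x <= n%:R by rewrite !ltW.
have mlr y y' : 0 < y -> y <= y' -> y' < n%:R -> D1 y * D0 y' <= D1 y' * D0 y.
  move=> y0 yy yn; rewrite /D1 /D0 mulrACA [leRHS]mulrACA ler_wpM2r ?mulr_ge0//.
  exact: B_mlr.
(* Both terms could vanish only at a knot [t j.+1 = x = t (j + q.+3)], impossible since the knots
   inside are simple. *)
have pos : 0 < D0 x + D1 x.
  have [h|h] := ltP x (t (j + q.+3)).
    rewrite ltr_wpDr ?D1_ge0// mulr_gt0//; first by apply: B_gt0; rewrite ?x0 ?jx.
    by rewrite invr_gt0 subr_gt0 (lt_trans jx).
  have j1x : t j.+1 < x.
    rewrite lt_neqAle (le_trans _ h) ?th//; last by nlia.
    rewrite andbT; apply/eqP => e; have := @tt_simple j.+1.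
    rewrite e x0 xn ltNge => /(_ isT)/negP; apply; apply: le_trans h.
    by apply: th; nlia.
  rewrite ltr_wpDl ?D0_ge0// mulr_gt0//.
    by apply: B_gt0; rewrite ?x0// addSn -addnS xj andbT.
  by rewrite invr_gt0 subr_gt0 (lt_trans j1x)// -addnS.
have [h|h] := leP (D1 x) (D0 x).
  left => y y' y0 yy yx; apply: derive_ge0 (@is_derive_B R n k n0 q.+1 j) yy _ => z /andP[yz zy].
  rewrite dE mulr_ge0// subr_ge0.
  have D0x : 0 < D0 x by lra.
  rewrite -(ler_pM2r D0x); have z0 := lt_trans y0 yz.
  have zx := le_trans (ltW zy) yx.
  apply: le_trans (mlr z x z0 zx xn) _; rewrite mulrC ler_wpM2l// D0_ge0//.
  by rewrite (ltW z0) (le_trans zx (ltW xn)).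
right => y y' xy yy yn.
apply: derive_le0 (@is_derive_B R n k n0 q.+1 j) yy _ => z /andP[yz zy].
have xz := le_trans xy (ltW yz); have zn := lt_trans zy yn.
have z0 := lt_le_trans x0 xz.
rewrite dE mulr_ge0_le0// subr_le0.
have D1x : 0 < D1 x by have := D0_ge0 x hx; lra.
rewrite -(ler_pM2r D1x) mulrC.
apply: le_trans (mlr x z x0 xz zn) _.
by rewrite ler_wpM2l ?(ltW h)// D1_ge0// !ltW.
Qed.

End LikelihoodRatio.

Section LocalEstimate.
Variables (R : realType) (n k : nat).
Hypotheses (n0 : (0 < n)%N) (k5 : (5 <= k)%N).
Local Notation N := (n + k)%N.
Local Notation t := (uknot R n k).
Local Notation xi := (greville R n k).
Local Notation spl := (bsum n k).
Local Notation S := (spl k).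
Local Notation T := (kgap R n k).
Local Notation B := (ubs n k).
Local Notation sl := (cslope n k).
Local Notation ac := (ccurv n k).
Local Notation jump := (cjump n k).
Local Notation cvx := (cconvex n k).
Local Notation hinge := (chinge R n k).
Local Notation Fh := (hinge_value R n k).
Implicit Types (c e : nat -> R) (x y z : R).

Let k3 : (3 <= k)%N. Proof. by nlia. Qed.

Lemma chord_bound (F Q f : R -> R) a x h :
  (forall z : R, is_derive z 1 F (Q z)) -> (forall z : R, is_derive z 1 Q (f z)) ->
  F a = 0 -> Q a = 0 -> 0 < h -> h <= x - a ->
  (forall y y', a < y -> y <= y' -> y' <= x -> f y <= f y') ->
  F x * h ^+ 2 <= (x - a) ^+ 2 * (Q x * h - (F x - F (x - h))).
Proof.
move=> dF dQ Fa Qa h0 hL fm; have L0 : 0 < x - a by lra.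
have chord z : a < z -> z < x -> Q z * (x - a) <= Q x * (z - a).
  move=> az zx; have [u /andP[au uz]] := derive_mvt dQ az.
  have [v /andP[zv vx] ev] := derive_mvt dQ zx.
  rewrite Qa subr0 => eu.
  have h1 : f u <= f v by apply: fm => //; [lra|lra].
  have h2 : (Q z) * (x - z) <= (Q x - Q z) * (z - a).
    rewrite ev eu -!mulrA [(x - z) * _]mulrC ler_wpM2r// mulr_ge0//; lra.
  have -> : x - a = (x - z) + (z - a) by ring.
  have -> : Q x = (Q x - Q z) + Q z by ring.
  by rewrite mulrDr mulrDl lerD2r.
pose G y := Q x * (y - a) ^+ 2 / (2 * (x - a)) - F y.
have dG y : is_derive y 1 G (Q x * (y - a) / (x - a) - Q y).
  have := dF y => dFy.
  pose P := (Q x / (2 * (x - a)))%:P * (('X - a%:P) * ('X - a%:P)).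
  have PE z : P.[z] = Q x * (z - a) ^+ 2 / (2 * (x - a)).
    by rewrite /P hornerM hornerC hornerM hornerXsubC; ring.
  have -> : G = horner P - F by apply/funext => z; rewrite /G -PE.
  have hP := is_derive_poly P y.
  apply: (@is_derive_eq _ _ _ _ _ _ _ _ (is_deriveB hP dFy)).
  congr (_ - _); rewrite /P derivM derivC mul0r add0r derivM derivXsubC.
  rewrite mulr1 mul1r hornerM hornerC hornerD hornerXsubC.
  by field; rewrite gt_eqF.
have Gm y y' : a <= y -> y <= y' -> y' <= x -> G y <= G y'.
  move=> ay yy yx; apply: (derive_ge0 dG yy) => z /andP[yz zy].
  rewrite subr_ge0 ler_pdivlMr//; apply: chord; lra.
have Ga : G a = 0 by rewrite /G Fa subrr expr0n mulr0 mul0r subr0.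
have := Gm a x (lexx _) _ (lexx _); rewrite Ga => /(_ (ltac:(lra))).
have := Gm (x - h) x _ _ (lexx _) => /(_ (ltac:(lra)) (ltac:(lra))).
have e1 y : G y = Q x * ((y - a) ^+ 2 / (2 * (x - a))) - F y by rewrite /G mulrA.
rewrite !e1.
set L := x - a in L0 hL *; have -> : x - h - a = L - h by rewrite /L; ring.
have e2 : L ^+ 2 / (2 * L) = L / 2 by field; rewrite gt_eqF.
have e3 : (L - h) ^+ 2 / (2 * L) = L / 2 - h + h ^+ 2 / (2 * L) by field; rewrite gt_eqF.
rewrite e2 e3; move: (Q x) (F x) (F (x - h)) => q u v.
set w := h ^+ 2 / (2 * L) => H1 H2.
have w0 : 0 < w by rewrite divr_gt0 ?exprn_gt0 ?mulr_gt0.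
have hw : h ^+ 2 = w * (2 * L) by rewrite /w divfK// mulf_neq0// gt_eqF.
have H3 : q * w <= q * h - (u - v) by lra.
apply: le_trans (_ : L ^+ 2 * (q * w) <= _); last by rewrite ler_pM2l ?exprn_gt0.
rewrite hw; have -> : L ^+ 2 * (q * w) = (q * (L / 2)) * (w * (2 * L)) by field.
by apply: ler_wpM2r; [rewrite ltW// mulr_gt0// mulr_gt0|lra].
Qed.

Lemma B_mlr_le' d i l y y' : (2 <= d)%N -> (i <= l)%N -> 0 < y -> y <= y' -> y' < n%:R ->
  B d l y * B d i y' <= B d l y' * B d i y.
Proof. by case: d => [|[|d]] // _; apply: B_mlr_le. Qed.

Lemma B_unimodal' d j x : (3 <= d)%N -> 0 < x < n%:R -> t j < x < t (j + d.+1) ->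
  (forall y y', 0 < y -> y <= y' -> y' <= x -> B d j y <= B d j y') \/
  (forall y y', x <= y -> y <= y' -> y' < n%:R -> B d j y' <= B d j y).
Proof. by case: d => [|[|[|d]]] // _; apply: B_unimodal. Qed.

Lemma B_gt0' d j x : (1 <= d)%N -> 0 < x < n%:R -> t j < x < t (j + d.+1) -> 0 < B d j x.
Proof. by case: d => // d _; apply: B_gt0. Qed.

Lemma B_out_l' d j x : (1 <= d)%N -> 0 < x <= n%:R -> x <= t j -> B d j x = 0.
Proof. by case: d => // d _; apply: B_out_l. Qed.

Lemma s1_bounds p j : (0 < p)%N -> p%:R * t j.+1 <= s1 t p j <= p%:R * t (j + p).
Proof.
move=> p0; rewrite -[p in p%:R](card_ord p) !mulr_natl -!sumr_const.
by apply/andP; split; apply: ler_sum => i _; apply: tt_homo => //;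
  have := ltn_ord i; move: (nat_of_ord i) => q; nlia.
Qed.

(** The node is the mean of [k] knots between [t i.+1] and [t (i + k)], both included, so either
    extreme pulls it away from the other by at least [T i / k]. This is the step used in the local
    estimate. *)
Lemma xi_T i : (0 < i)%N -> (i.+1 < N)%N ->
  t i.+1 + T i / k%:R <= xi i /\ xi i + T i / k%:R <= t (i + k).
Proof.
move=> i0 iN; have k0 : 0 < k%:R :> R by rewrite ltr0n; nlia.
have e1 : (t i.+1 + T i / k%:R) * k%:R = k.-1%:R * t i.+1 + t (i + k).
  have -> : k.-1%:R = k%:R - 1 :> R by rewrite -[k in RHS](ltn_predK k3) -natr1 addrK.
  by rewrite /kgap; field; rewrite gt_eqF.
have e2 : (t (i + k) - T i / k%:R) * k%:R = k.-1%:R * t (i + k) + t i.+1.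
  have -> : k.-1%:R = k%:R - 1 :> R by rewrite -[k in RHS](ltn_predK k3) -natr1 addrK.
  by rewrite /kgap; field; rewrite gt_eqF.
have kk : k = k.-1.+1 by nlia.
have k1 : (0 < k.-1)%N by nlia.
split; last rewrite -lerBrDr.
  rewrite -(ler_pM2r k0) e1 /greville divfK ?gt_eqF// [X in s1 _ X]kk s1S -kk lerD2r.
  by have /andP[] := s1_bounds i k1.
rewrite -(ler_pM2r k0) e2 /greville divfK ?gt_eqF// [X in s1 _ X]kk s1Sl addrC lerD2r.
have /andP[_ h] := s1_bounds i.+1 k1; apply: le_trans h _.
by rewrite addSnnS -kk.
Qed.

Lemma S1_lin a b c c' x : spl k.-1 (sl (fun j => a * c j - b * c' j)) x =
  a * spl k.-1 (sl c) x - b * spl k.-1 (sl c') x.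
Proof.
rewrite -!splZ -splB; apply: eq_spl => j _.
by rewrite /cslope /dc /=; ring.
Qed.

Lemma S2_lin a b c c' x : spl k.-2 (dc n k k.-1 (sl (fun j => a * c j - b * c' j))) x =
  a * spl k.-2 (dc n k k.-1 (sl c)) x - b * spl k.-2 (dc n k k.-1 (sl c')) x.
Proof.
rewrite -!splZ -splB; apply: eq_spl => j _.
by rewrite /cslope /dc /=; ring.
Qed.

Lemma S1_refl c x : 0 < x < n%:R ->
  spl k.-1 (sl c) (n%:R - x) = - spl k.-1 (sl (fun j => c (N - j.+1)%N)) x.
Proof.
move=> /andP[x0 xn]; set c' := fun j => _.
have d1 := is_derive_S n0 k3 c (n%:R - x).
have d2 : is_derive x 1 (fun y : R => n%:R - y) (-1).
  have h := is_deriveB (is_derive_cst (n%:R : R) x 1) (is_derive_id x 1).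
  by apply: (@is_derive_eq _ _ _ _ _ _ _ _ h); rewrite sub0r.
have d3 : is_derive x 1 (S c \o (fun y : R => n%:R - y)) (- spl k.-1 (sl c) (n%:R - x)).
  have h := @is_derive1_comp _ (S c) (fun y : R => n%:R - y) x _ _ d1 d2.
  by apply: (@is_derive_eq _ _ _ _ _ _ _ _ h); rewrite mulrN1.
have d4 := is_derive_S n0 k3 c' x.
have d5 : is_derive x 1 (S c') (- spl k.-1 (sl c) (n%:R - x)).
  move/is_deriveP : d3 => d3; apply/is_deriveP => e /d3 [r r0 hr].
  have r1 : 0 < Num.min r (Num.min x (n%:R - x)) by rewrite !lt_min r0 x0 subr_gt0.
  exists (Num.min r (Num.min x (n%:R - x))) => // y; rewrite !lt_min => /and3P[yr yx yn].
  have := hr y yr; rewrite /= !(@S_refl R n k n0 k3)//; first by lra.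
  by move: yx yn; rewrite !ltr_norml; lra.
by rewrite -(derive_val (is_derive := d4)) (derive_val (is_derive := d5)) opprK.
Qed.

Lemma S1_line a b x : spl k.-1 (sl (fun j => a + b * xi j)) x = b.
Proof.
have d1 := is_derive_S n0 k3 (fun j => a + b * xi j) x.
have d2 : is_derive x 1 (S (fun j => a + b * xi j)) b.
  have -> : S (fun j => a + b * xi j) = horner (a%:P + b%:P * 'X).
    by apply/funext => y; rewrite S_line// hornerD hornerM !hornerC hornerX.
  apply: (@is_derive_eq _ _ _ _ _ _ _ _ (is_derive_poly _ _)).
  by rewrite derivD derivM !derivC derivX mul0r add0r add0r mulr1 hornerC.
by rewrite -(derive_val (is_derive := d1)) (derive_val (is_derive := d2)).
Qed.

(** The hinge opened to the right, which differs from [chinge l] by a line. It vanishes up to node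
    [l], and its second derivative is a multiple of one B-spline ([S2_ramp]), against which
    likelihood ratios compare. *)
Definition ramp l j : R := Num.max (xi j - xi l) 0.

Lemma rampE l j : ramp l j = hinge l j + (- xi l + 1 * xi j).
Proof.
rewrite /chinge mul1r /ramp; have [h|h] := leP (xi j) (xi l).
  by rewrite (max_idPr _) ?(max_idPl _); lra.
by rewrite (max_idPl _) ?(max_idPr _); lra.
Qed.

Lemma ramp_jump l i : (0 < i)%N -> (i.+1 < N)%N -> (0 < l)%N -> (l.+1 < N)%N ->
  jump (ramp l) i = (i == l)%:R.
Proof.
move=> i0 iN l0 lN.
have -> : jump (ramp l) i = jump (fun j => hinge l j + (- xi l + 1 * xi j)) i.
  by rewrite /cjump /cslope /dc /= !rampE.
by rewrite jumpD hinge_jump// jump_line// addr0.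
Qed.

Lemma ramp_cvx l : (0 < l)%N -> (l.+1 < N)%N -> cvx (ramp l).
Proof. by move=> l0 lN i i0 iN; rewrite ramp_jump// ler0n. Qed.

Lemma ramp0 l j : (j <= l)%N -> ramp l j = 0.
Proof. by move=> jl; apply/max_idPr; rewrite subr_le0 xi_le. Qed.

Definition S2 e y : R := spl k.-2 (dc n k k.-1 (sl e)) y.

Lemma S2_ramp i y : (0 < i)%N -> (i.+1 < N)%N ->
  S2 (ramp i) y = (k%:R - 1) / T i * B k.-2 i.+1 y.
Proof.
move=> i0 iN; rewrite /S2 /bsum (bigD1 (Ordinal iN)) //= dc_ac//.
rewrite big1 ?addr0; first by rewrite /ccurv ramp_jump// eqxx mulr1.
move=> [[|j] jN] /=; first by rewrite dc_ac0 mul0r.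
rewrite -val_eqE /= eqSS => ji; rewrite dc_ac//.
have [->|j0] := posnP j; first by rewrite ac0// mul0r.
by rewrite /ccurv ramp_jump// (negPf ji) mulr0 !mul0r.
Qed.

Lemma xi_in i : (0 < i)%N -> (i.+1 < N)%N -> [/\ 0 < xi i < n%:R,
  t i.+1 < xi i < t (i + k) & 0 < T i / k%:R].
Proof.
move=> i0 iN; have h0 : 0 < T i / k%:R by apply: divr_gt0; [exact: T_gt0'|exact: kR_gt0 n0 k3].
have [h1 h2] := xi_T i0 iN; have h3 := @tt_ge0 R n k i.+1.
have h4 := @tt_le R n k (i + k).
split.
by apply/andP; split; lra.
by apply/andP; split; lra.
exact: h0.
Qed.

(** As [e] vanishes up to [i], its second derivative is a nonnegative combination of B-splines of
    index at least [i.+1], each with a nondecreasing ratio to B-spline [i.+1]. *)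
Lemma S2_mlr e i y y' : (forall j, (j <= i)%N -> e j = 0) -> cvx e ->
  0 < y -> y <= y' -> y' < n%:R ->
  S2 e y * B k.-2 i.+1 y' <= S2 e y' * B k.-2 i.+1 y.
Proof.
move=> e0 ce y0 yy yn; rewrite /S2 /bsum !mulr_suml; apply: ler_sum => -[[|l] lN] _ /=.
  by rewrite dc_ac0 !mul0r.
rewrite dc_ac// -[leLHS]mulrA -[leRHS]mulrA; have [il|li] := leqP i l; last first.
  suff -> : ac e l = 0 by rewrite !mul0r.
  by rewrite /ccurv /cjump /cslope /dc /= !e0 ?subrr ?mulr0 ?mul0r ?subrr ?mulr0 ?mul0r//; nlia.
apply: ler_wpM2l; first by apply: ac_ge0.
by apply: B_mlr_le' => //; nlia.
Qed.

Lemma spl_left0 p c i : (0 < p)%N -> (p <= k)%N -> (k - p <= i)%N ->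
  (forall j, (j <= i)%N -> c j = 0) -> spl p c (t i.+1) = 0.
Proof.
move=> p0 pk kpi c0; have [a1|a1] := leP (t i.+1) 0.
  have -> : t i.+1 = 0 by apply/eqP; rewrite eq_le a1 tt_ge0.
  by rewrite spl_at0// c0.
apply: big1 => j _; have [ji|ij] := leqP j i; first by rewrite c0 ?mul0r.
rewrite B_out_l' ?mulr0//; first by rewrite a1 tt_le.
exact: tt_homo.
Qed.

(* The second derivative increases up to [xi_i], so the first derivative lies
   below its chord there. *)
Lemma local_monotone e i : (0 < i)%N -> (i.+1 < N)%N ->
  (forall j, (j <= i)%N -> e j = 0) -> cvx e ->
  (forall y y', 0 < y -> y <= y' -> y' <= xi i -> B k.-2 i.+1 y <= B k.-2 i.+1 y') ->
  S e (xi i) * (T i / k%:R) ^+ 2 <=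
    T i ^+ 2 * (spl k.-1 (sl e) (xi i) * (T i / k%:R) -
                (S e (xi i) - S e (xi i - T i / k%:R))).
Proof.
move=> i0 iN e0 ce fm; have [/andP[x0 xn] /andP[ax xb]] := xi_in i0 iN.
set h := T i / k%:R => h0; have [hT1 hT2] := xi_T i0 iN.
have T0 := T_gt0' R n0 k3 i0 iN.
set x := xi i in x0 xn ax xb hT1 hT2 fm *; set a := t i.+1 in ax hT1.
have a0 : 0 <= a by exact: tt_ge0.
have sl0 j : (j <= i)%N -> sl e j = 0.
  by move=> ji; rewrite /cslope /dc !e0 ?subrr ?mulr0 ?mul0r//; nlia.
have Fa : S e a = 0 by apply: spl_left0 => //; nlia.
have Qa : spl k.-1 (sl e) a = 0 by apply: spl_left0 => //; nlia.
have := @chord_bound (S e) (spl k.-1 (sl e)) (S2 e) a x h (is_derive_S n0 k3 e)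
  (is_derive_S1 n0 k3 e) Fa Qa h0.
have hL : h <= x - a by rewrite /h; lra.
(* [S2 e] is the nondecreasing ratio of [S2_mlr] times the B-spline, which increases by
   hypothesis. *)
have fm2 y y' : a < y -> y <= y' -> y' <= x -> S2 e y <= S2 e y'.
  move=> ay yy yx; have y0 := le_lt_trans a0 ay.
  have p1 : 0 < B k.-2 i.+1 y'.
    apply: B_gt0' => //; first by nlia.
      by rewrite (lt_le_trans y0 yy) (le_lt_trans yx xn).
    rewrite (lt_le_trans ay yy)/= (le_lt_trans yx)// (lt_le_trans xb)// tt_homo//; nlia.
  rewrite -(ler_pM2r p1); apply: le_trans (@S2_mlr e i y y' e0 ce y0 yy (le_lt_trans yx xn)) _.
  rewrite ler_wpM2l ?fm//; apply: S2_ge0 => //.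
  by rewrite !ltW ?(le_lt_trans yx)// (lt_le_trans y0).
move=> /(_ hL fm2) H; apply: le_trans H _; apply: ler_wpM2r.
  rewrite subr_ge0 -[S e x - _]opprB.
  have xh : x - h < x by rewrite ltrBlDr ltrDl.
  have [u /andP[hu ux] E] := derive_mvt (is_derive_S n0 k3 e) xh.
  have -> : - (S e (x - h) - S e x) = spl k.-1 (sl e) u * h by rewrite opprB E; ring.
  rewrite ler_wpM2r ?(ltW h0)//; apply: S1_homo => //; try exact: ltW.
  by apply/ltW; apply: le_lt_trans hu; rewrite subr_ge0; apply: le_trans hL _; lra.
by rewrite ler_pXn2r ?nnegrE ?subr_ge0 ?(ltW ax) ?(ltW T0)// /kgap -/a; lra.
Qed.

Lemma S1_slope e x h : cvx e -> 0 < h -> 0 <= x - h -> x + h <= n%:R ->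
  S e x - S e (x - h) <= spl k.-1 (sl e) x * h <= S e (x + h) - S e x.
Proof.
move=> ce h0 xh xn; apply/andP; split.
  have lt : x - h < x by rewrite ltrBlDr ltrDl.
  have [u /andP[hu ux] ->] := derive_mvt (is_derive_S n0 k3 e) lt.
  have -> : x - (x - h) = h by ring.
  rewrite ler_wpM2r ?(ltW h0)//; apply: S1_homo => //; lra.
have lt : x < x + h by rewrite ltrDl.
have [u /andP[hu ux] ->] := derive_mvt (is_derive_S n0 k3 e) lt.
have -> : x + h - x = h by ring.
rewrite ler_wpM2r ?(ltW h0)//; apply: S1_homo => //; lra.
Qed.

(* If the B-spline at [xi_i] still increases, use [local_monotone].  Otherwise it
   decreases to the right of [xi_i], and comparing [e] with the ramp at [xi_i] by
   likelihood ratios reduces to [local_monotone] for the reflected ramp. *)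
Lemma local_right e i : (0 < i)%N -> (i.+1 < N)%N ->
  (forall j, (j <= i)%N -> e j = 0) -> cvx e ->
  S e (xi i) * (T i / k%:R) ^+ 2 <=
    T i ^+ 2 * (S e (xi i + T i / k%:R) - 2 * S e (xi i) + S e (xi i - T i / k%:R)).
Proof.
move=> i0 iN e0 ce; have [/andP[x0 xn] /andP[ax xb]] := xi_in i0 iN.
set h := T i / k%:R => h0; have [hT1 hT2] := xi_T i0 iN; have T0 := T_gt0' R n0 k3 i0 iN.
have xh0 : 0 <= xi i - h by have := @tt_ge0 R n k i.+1; rewrite /h; lra.
have xhn : xi i + h <= n%:R by have := @tt_le R n k (i + k); rewrite /h; lra.
have /andP[s1 s2] := S1_slope ce h0 xh0 xhn.
have hf : t i.+1 < xi i < t (i.+1 + k.-2.+1).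
  by rewrite ax (lt_le_trans xb)// tt_homo//; nlia.
have [fm|fm] := B_unimodal' (ltac:(nlia) : (3 <= k.-2)%N) (introT andP (conj x0 xn)) hf.
  apply: le_trans (local_monotone i0 iN e0 ce fm) _.
  by rewrite -/h ler_wpM2l ?sqr_ge0//; lra.
pose i' := (N - i.+1)%N; have ii' : (i + i').+1 = N by rewrite /i'; nlia.
have i'0 : (0 < i')%N by rewrite /i'; nlia.
have i'N : (i'.+1 < N)%N by nlia.
have xi' : xi i' = n%:R - xi i by exact: xi_refl.
have fm' y y' : 0 < y -> y <= y' -> y' <= xi i' -> B k.-2 i'.+1 y <= B k.-2 i'.+1 y'.
  move=> y0 yy; rewrite xi' => yx.
  have E z : 0 < z <= n%:R -> B k.-2 i'.+1 z = B k.-2 i.+1 (n%:R - z).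
    move=> hz; rewrite -[z in LHS](subKr n%:R).
    apply: B_refl0; [exact: n0|nlia|nlia|lra].
  rewrite !E; [|lra|lra].
  apply: fm; lra.
(* Reflection turns the ramp at [i'] into the ramp at [i] minus a line, so this becomes an estimate
   for [ramp i] on the right of [xi i]. *)
have := @local_monotone (ramp i') i' i'0 i'N (@ramp0 i') (@ramp_cvx i' i'0 i'N) fm'.
rewrite /= (T_refl R n0 k3 ii') -/h.
have Sr j : (j < N)%N -> ramp i' (N - j.+1)%N = 1 * ramp i j - 1 * (- xi i + 1 * xi j).
  move=> jN; rewrite /ramp xi' (@xi_refl _ _ _ n0 k3 j (N - j.+1)); last by nlia.
  have [h1|h1] := leP (xi j) (xi i).
    by rewrite (max_idPl _) ?(max_idPr _); lra.
  by rewrite (max_idPr _) ?(max_idPl _); lra.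
have SR z : 0 <= z <= n%:R -> S (ramp i') (n%:R - z) = S (ramp i) z - (z - xi i).
  move=> hz; rewrite S_refl// (eq_spl _ _ Sr).
  by rewrite splB !splZ S_line//; ring.
have SQ : spl k.-1 (sl (ramp i')) (xi i') = 1 - spl k.-1 (sl (ramp i)) (xi i).
  rewrite xi' S1_refl ?x0//.
  have -> : spl k.-1 (sl (fun j => ramp i' (N - j.+1)%N)) (xi i) =
     spl k.-1 (sl (fun j => 1 * ramp i j - 1 * (- xi i + 1 * xi j))) (xi i).
    apply: eq_spl => j jN; rewrite /cslope /dc !Sr//.
    by case: j jN => //= j; apply: ltnW.
  by rewrite S1_lin S1_line//; ring.
rewrite SQ xi' SR; last by rewrite !ltW.
have -> : n%:R - xi i - h = n%:R - (xi i + h) by ring.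
rewrite SR; last by rewrite xhn andbT addr_ge0 ?ltW.
set x := xi i in x0 xn ax xb hT1 hT2 xh0 xhn s1 s2 fm *.
set a := B k.-2 i.+1 x; set b := S2 e x => HR.
have a0 : 0 < a by apply: B_gt0' => //; [nlia|rewrite x0].
have b0 : 0 <= b by apply: S2_ge0 => //; rewrite !ltW.
have kT : 0 < T i / (k%:R - 1) by apply: divr_gt0 => //; exact: k1R_gt0 n0 k3.
(* The scales [bk] and [a] make the second derivatives of [bk * ramp i] and [a * e] agree at [x]; by
   [S2_mlr] that of [d] is then nonnegative before [x] and nonpositive after it. Hence [S d x >= 0],
   and [S d] stays below its tangent at [x] on [[x, x + h]]. *)
pose bk := b * (T i / (k%:R - 1)); have bk0 : 0 <= bk.
  by apply: mulr_ge0 => //; exact: ltW.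
pose d j := bk * ramp i j - a * e j.
have d2 y : S2 d y = b * B k.-2 i.+1 y - a * S2 e y.
  rewrite /S2 S2_lin -!/(S2 _ _) S2_ramp// /bk.
  congr (_ - _); have := k1R_gt0 R n0 k3; move: T0; move: (T i) (k%:R - 1) => u v u0 v0.
  by field; rewrite !gt_eqF.
have dS y : S d y = bk * S (ramp i) y - a * S e y by rewrite splB !splZ.
have dQ y : spl k.-1 (sl d) y = bk * spl k.-1 (sl (ramp i)) y - a * spl k.-1 (sl e) y.
  exact: S1_lin.
have d2l y : 0 < y < x -> 0 <= S2 d y.
  move=> /andP[y0 yx]; rewrite d2 subr_ge0 mulrC.
  by apply: S2_mlr => //; exact: ltW.
have d2r y : x < y < x + h -> S2 d y <= 0.
  move=> /andP[xy yh]; rewrite d2 subr_le0 [leRHS]mulrC.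
  by apply: S2_mlr => //; [exact: ltW|exact: lt_le_trans yh _].
have Q0 : spl k.-1 (sl d) 0 = 0.
  rewrite spl_at0//; last by nlia.
  rewrite /cslope /dc /d !ramp0 ?e0 ?mulr0 ?subrr ?mulr0 ?mul0r//; nlia.
have F0 : S d 0 = 0 by rewrite S0// /d ramp0// e0// !mulr0 subrr.
have Qge y : 0 <= y -> y <= x -> 0 <= spl k.-1 (sl d) y.
  move=> y0 yx; rewrite -Q0; apply: derive_ge0 (is_derive_S1 n0 k3 d) y0 _ => z /andP[z0 zy].
  by apply: d2l; rewrite z0 (lt_le_trans zy).
have H1 : 0 <= S d x.
  rewrite -F0; apply: derive_ge0 (is_derive_S n0 k3 d) (ltW x0) _ => z /andP[z0 zy].
  by apply: Qge; exact: ltW.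
have H2 : S d (x + h) - S d x <= spl k.-1 (sl d) x * h.
  have lt : x < x + h by rewrite ltrDl.
  have [u /andP[xu uh] ->] := derive_mvt (is_derive_S n0 k3 d) lt.
  have -> : x + h - x = h by ring.
  rewrite ler_wpM2r ?(ltW h0)//.
  apply: derive_le0 (is_derive_S1 n0 k3 d) (ltW xu) _ => z /andP[z0 zy].
  by apply: d2r; rewrite z0 (lt_trans zy).
move: H1 H2 HR; rewrite !dS dQ subrr subr0.
move: (S (ramp i) x) (S (ramp i) (x + h)) (spl _ (sl (ramp i)) x) => Fx Fh Qi.
move: (S e x) (S e (x + h)) (S e (x - h)) (spl _ (sl e) x) s1 s2 => E0 E1 E2 Qe s1 s2 H1 H2 HR.
rewrite -(ler_pM2l a0).
have hh : 0 < h ^+ 2 by rewrite exprn_gt0.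
have TT : 0 < T i ^+ 2 by rewrite exprn_gt0.
have l1 : a * (E0 * h ^+ 2) <= bk * (Fx * h ^+ 2).
  by rewrite !(mulrA _ _ (h ^+ 2)) ler_pM2r//; lra.
have l2 : bk * (Fx * h ^+ 2) <= bk * (T i ^+ 2 * (Fh - Fx - h * Qi)).
  apply: ler_wpM2l => //; apply: le_trans HR _; rewrite -subr_ge0 le_eqVlt.
  by apply/orP; left; apply/eqP; ring.
have l3 : T i ^+ 2 * (bk * (Fh - Fx - h * Qi)) <= T i ^+ 2 * (a * (E1 - 2 * E0 + E2)).
  rewrite ler_pM2l//; apply: le_trans (_ : a * (E1 - E0 - h * Qe) <= _).
    by rewrite -subr_ge0; move: H2; rewrite -subr_ge0; congr (0 <= _); ring.
  by rewrite ler_pM2l//; lra.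
apply: (le_trans l1); apply: (le_trans l2).
by rewrite mulrCA [leRHS]mulrCA.
Qed.

End LocalEstimate.

(** * The estimate where the curvatures touch *)

Section Touching.
Variables (R : realType) (n k : nat).
Hypotheses (n0 : (0 < n)%N) (k5 : (5 <= k)%N).
Local Notation N := (n + k)%N.
Local Notation xi := (greville R n k).
Local Notation spl := (bsum n k).
Local Notation S := (spl k).
Local Notation T := (kgap R n k).
Local Notation sl := (cslope n k).
Local Notation ac := (ccurv n k).
Local Notation jump := (cjump n k).
Local Notation cvx := (cconvex n k).
Implicit Types (c e : nat -> R) (x y z : R).

Let k3 : (3 <= k)%N. Proof. by nlia. Qed.

Lemma jump_ext c c' l : (forall j, c j = c' j) -> jump c l = jump c' l.
Proof. by move=> h; rewrite /cjump /cslope /dc !h. Qed.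

Lemma jump_refl c l l' : (0 < l)%N -> (0 < l')%N -> (l + l').+1 = N ->
  jump (fun j => c (N - j.+1)%N) l' = jump c l.
Proof.
move=> l0 l'0 h; rewrite !jumpE//; [|nlia|nlia].
have e1 : (N - l'.+2 = l.-1)%N by nlia.
have e2 : (N - l'.+1 = l)%N by nlia.
have e3 : (N - l'.-1.+1 = l.+1)%N by nlia.
rewrite e1 e2 e3 (@xi_refl R n k n0 k3 l.-1 l'.+1); last by nlia.
rewrite (@xi_refl R n k n0 k3 l l') // (@xi_refl R n k n0 k3 l.+1 l'.-1); last by nlia.
have e a b : n%:R - a - (n%:R - b) = b - a :> R by ring.
by rewrite !e -(opprB (c l) (c l.-1)) -(opprB (c l.+1) (c l)) !mulNr opprK addrC.
Qed.

(** The three zeros make it possible to cut [e] at [i] into two convex sequences, each vanishing on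
    one side; [local_right] applies to one and to the reflection of the other. *)
Lemma local_convex e i : (0 < i)%N -> (i.+1 < N)%N -> cvx e ->
  e i.-1 = 0 -> e i = 0 -> e i.+1 = 0 ->
  S e (xi i) * (T i / k%:R) ^+ 2 <=
    T i ^+ 2 * (S e (xi i + T i / k%:R) - 2 * S e (xi i) + S e (xi i - T i / k%:R)).
Proof.
move=> i0 iN ce ep ei en; have [/andP[x0 xn] _] := xi_in R n0 k5 i0 iN.
set h := T i / k%:R => h0; have [] := xi_T R n0 k5 i0 iN; rewrite -/h => hT1 hT2.
have h1 := @tt_ge0 R n k i.+1; have h2 := @tt_le R n k (i + k).
pose er j := if (j <= i)%N then 0 else e j.
pose el j := if (i <= j)%N then 0 else e j.
have erl y : S e y = S er y + S el y.
  rewrite -splD; apply: eq_spl => j _; rewrite /er /el.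
  by case: ltngtP => [||->]; rewrite ?addr0 ?add0r ?ei.
have cr : cvx er.
  move=> l l0 lN; have := ce l l0 lN; rewrite /cjump /cslope /dc /=.
  have [li|il] := leqP l i.
    have -> : er l.+1 = 0.
      by rewrite /er; case: ltnP => // hl; have -> : l = i by apply/eqP; rewrite eqn_leq li.
    by rewrite {1 2 3}/er li (leq_trans (leq_pred l) li) !subrr !mulr0 !mul0r subrr.
  have -> : er l.+1 = e l.+1 by rewrite /er ltnNge (ltnW il).
  have -> : er l = e l by rewrite /er leqNgt il.
  have -> // : er l.-1 = e l.-1.
  rewrite /er; case: leqP => // hl; have -> : l.-1 = i by apply/eqP; rewrite eqn_leq hl -ltnS (ltn_predK il).
  by rewrite ei.
have cl : cvx el.
  move=> l l0 lN; have := ce l l0 lN; rewrite /cjump /cslope /dc /=.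
  have [il|li] := leqP i l.
    have -> : el l.-1 = 0.
      rewrite /el; case: leqP => // hl; have -> : l.-1 = i.-1; last by [].
      by congr _.-1; apply/eqP; rewrite eqn_leq il andbT -ltnS -(ltn_predK l0) ltnS.
    by rewrite {1 2 3}/el il (leq_trans il (leqnSn l)) !subrr !mulr0 !mul0r subrr.
  have -> : el l.-1 = e l.-1 by rewrite /el leqNgt (leq_ltn_trans (leq_pred l) li).
  have -> : el l = e l by rewrite /el leqNgt li.
  have -> // : el l.+1 = e l.+1.
  rewrite /el; case: leqP => // hl; have -> : l.+1 = i by apply/eqP; rewrite eqn_leq hl li.
  by rewrite ei.
pose i' := (N - i.+1)%N; have ii' : (i + i').+1 = N by rewrite /i'; nlia.
have i'0 : (0 < i')%N by rewrite /i'; nlia.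
have i'N : (i'.+1 < N)%N by nlia.
have xi' : xi i' = n%:R - xi i by exact: xi_refl.
have T' : T i' = T i := T_refl R n0 k3 ii'.
have er0 j : (j <= i)%N -> er j = 0 by move=> ji; rewrite /er ji.
have el0 j : (j <= i')%N -> el (N - j.+1)%N = 0.
  by move=> ji; rewrite /el ifT//; nlia.
have cl' : cvx (fun j => el (N - j.+1)%N).
  move=> l l0 lN; rewrite (@jump_refl el (N - l.+1) l)//; [|nlia..].
  by apply: cl; nlia.
have Hr := local_right n0 k5 i0 iN er0 cr; have Hl := local_right n0 k5 i'0 i'N el0 cl'.
move: Hl; rewrite xi' T' -/h.
have -> : n%:R - xi i - h = n%:R - (xi i + h) by ring.
have -> : n%:R - xi i + h = n%:R - (xi i - h) by ring.
have R2 y : 0 <= y <= n%:R -> S (fun j => el (N - j.+1)%N) (n%:R - y) = S el y.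
  move=> hy; rewrite S_refl//; apply: eq_spl => j jN; congr el; nlia.
rewrite !R2; [|lra|lra|lra] => Hl.
rewrite !erl; rewrite -subr_ge0.
move: Hr; rewrite -/h -subr_ge0 => Hr; move: Hl; rewrite -subr_ge0 => Hl.
by have := addr_ge0 Hr Hl; congr (0 <= _); ring.
Qed.

Lemma xi_step i : (0 < i)%N -> (i.+1 < N)%N ->
  T i / k%:R <= xi i.+1 - xi i /\ T i / k%:R <= xi i - xi i.-1.
Proof.
move=> i0 iN; have kk : 0 <= k%:R^-1 :> R by rewrite invr_ge0 ler0n.
split; first rewrite xiS ?(ler_wpM2r kk)//.
  by rewrite /kgap lerD2r tt_homo.
case: i i0 iN => // i _ iN; rewrite xiS// ler_wpM2r//.
by rewrite /kgap addSn lerD2l lerN2 tt_homo.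
Qed.

Lemma jump_le c i G : (0 < i)%N -> (i.+1 < N)%N ->
  (forall j, (j < N)%N -> `|c j| <= G) -> jump c i <= 4 * k%:R / T i * G.
Proof.
move=> i0 iN hG; rewrite jumpE//; have [hp hm] := xi_step i0 iN.
have h0 : 0 < T i / k%:R by have [_ _] := xi_in R n0 k5 i0 iN.
have G0 : 0 <= G by apply: le_trans (hG 0%N _); rewrite ?normr_ge0//; nlia.
have key a b w : `|a| <= G -> `|b| <= G -> T i / k%:R <= w ->
    (a - b) / w <= 2 * k%:R / T i * G.
  move=> ha hb hw; have w0 := lt_le_trans h0 hw.
  apply: (@le_trans _ _ (2 * G / w)).
    rewrite ler_pM2r ?invr_gt0//.
    by move: ha hb; rewrite !ler_norml => /andP[_ ?] /andP[? _]; lra.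
  have -> : 2 * k%:R / T i * G = 2 * G / (T i / k%:R) by rewrite invf_div; ring.
  by rewrite ler_wpM2l ?mulr_ge0// lef_pV2 ?posrE.
have hi : `|c i| <= G by apply: hG; nlia.
have hi1 : `|c i.+1| <= G by exact: hG.
have hi2 : `|c i.-1| <= G by apply: hG; nlia.
have h1 := key _ _ _ hi1 hi hp; have h2 := key _ _ _ hi2 hi hm.
have -> : 4 * k%:R / T i * G = 2 * k%:R / T i * G + 2 * k%:R / T i * G by ring.
apply: lerD => //; rewrite -mulNr opprB//.
Qed.

(* At the touching index the convex sequence [A q - c] is flat, so [local_convex]
   bounds its image by the jump of [c - S c] alone. *)
Lemma touching_bound q u c G A i : (0 < i)%N -> (i.+1 < N)%N ->
  (forall j, (j < N)%N -> S q (xi j) = q j + u j) ->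
  (forall j, (j < N)%N -> `|c j - S c (xi j)| <= G) ->
  0 <= A -> jump u i <= 0 ->
  (forall l, (0 < l)%N -> (l.+1 < N)%N -> ac c l <= A * ac q l) ->
  ac c i = A * ac q i ->
  A * u i <= (1 + 4 * k%:R ^+ 2) * G.
Proof.
move=> i0 iN hu hG A0 ju hA hi.
have iN' : (i < N)%N by nlia.
(* The subtracted line passes through [A * q - c] at nodes [i] and [i.+1]; the vanishing jump at [i]
   then gives the third zero. *)
pose s := A * sl q i.+1 - sl c i.+1.
pose a := A * q i - c i - s * xi i.
pose e j := (A * q j - 1 * c j) - (a + s * xi j).
have jE l : (0 < l)%N -> (l.+1 < N)%N -> jump e l = A * jump q l - jump c l.
  by move=> l0 lN; rewrite /e (@jumpB R n k (fun j => A * q j - 1 * c j) (fun j => a + s * xi j)) jump_line// jumpB !jumpZ; ring.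
have T0 := T_gt0' R n0 k3 i0 iN; have k0 := kR_gt0 R n0 k3; have k1 := k1R_gt0 R n0 k3.
have ce : cvx e.
  move=> l l0 lN; rewrite jE// !acE// mulrA -mulrBl mulr_ge0//.
    by rewrite subr_ge0 hA.
  by rewrite divr_ge0 ?ltW// T_gt0'.
have ji : jump e i = 0 by rewrite jE// !acE// hi mulrA subrr.
have ei : e i = 0 by rewrite /e /a; ring.
have en : e i.+1 = 0.
  have h1 := sl_mul n0 k3 q iN; have h2 := sl_mul n0 k3 c iN.
  have E : e i.+1 = A * (q i.+1 - q i) - (c i.+1 - c i) - s * (xi i.+1 - xi i).
    by rewrite /e /a; ring.
  by rewrite E -h1 -h2 /s; ring.
have ep : e i.-1 = 0.
  move: ji; rewrite jumpE// en ei subr0 mul0r !sub0r => /eqP; rewrite oppr_eq0 mulf_eq0 oppr_eq0.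
  case/orP => [/eqP//|]; rewrite invr_eq0 gt_eqF//.
  by case: (i) i0 iN => // i' _ i'N; rewrite subr_gt0 xi_lt//; nlia.
have H := local_convex i0 iN ce ep ei en.
have [hT1 hT2] := xi_T R n0 k5 i0 iN; have [/andP[x0 xn] _ h0] := xi_in R n0 k5 i0 iN.
have [hp hm] := xi_step i0 iN.
move: H hT1 hT2 h0 hp hm; set h := T i / k%:R; set x := xi i => H hT1 hT2 h0 hp hm.
pose g j := c j - S c (xi j).
have SE j : (j < N)%N -> S e (xi j) = e j + A * u j + g j.
  by move=> jN; rewrite /e !splB !splZ S_line// hu// /g; ring.
have g1 j : (j < N)%N -> `|g j| <= G by exact: hG.
have x1N : 0 <= xi i.-1 by have : (i.-1 < N)%N by [nlia]; move=> /(@xi_itv R n k n0 k3)/andP[].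
have xN : xi i.+1 <= n%:R by have /andP[] := @xi_itv R n k n0 k3 i.+1 iN.
(* The step [h] is at most the distance to either neighbouring node, so by convexity the slope
   changes less between the chords with step [h] than between those to the nodes. *)
have c1 : (S e (x + h) - S e x) / h <= (S e (xi i.+1) - S e x) / (xi i.+1 - x).
  rewrite ler_pdivrMr// mulrAC ler_pdivlMr ?(lt_le_trans h0)//.
  have := @S_cvx R n k n0 k3 e x (x + h) (xi i.+1) ce.
  move=> HH; have {HH} := HH ltac:(lra) ltac:(lra) ltac:(lra) xN.
  by rewrite -subr_ge0 => HH; rewrite -subr_ge0; move: HH; congr (0 <= _); ring.
have c2 : (S e x - S e (xi i.-1)) / (x - xi i.-1) <= (S e x - S e (x - h)) / h.
  rewrite ler_pdivlMr// mulrAC ler_pdivrMr ?(lt_le_trans h0)//.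
  have := @S_cvx R n k n0 k3 e (xi i.-1) (x - h) x ce.
  move=> HH; have {HH} := HH ltac:(lra) ltac:(lra) ltac:(lra) (ltW xn).
  by rewrite -subr_ge0 => HH; rewrite -subr_ge0; move: HH; congr (0 <= _); ring.
(* At the three nodes [e] is 0, so [S e] is [A * u] plus the error [g] there; as [jump u i <= 0],
   only [g] has to be estimated. *)
have J : jump (fun j => S e (xi j)) i = A * jump u i + jump g i.
  rewrite -jumpZ -jumpD !jumpE// !SE//; [|nlia].
  rewrite ep ei en.
  by move: (_^-1) (_^-1) => v w; ring.
have J1 : (S e (x + h) - 2 * S e x + S e (x - h)) <= h * jump (fun j => S e (xi j)) i.
  rewrite jumpE// -/x -ler_pdivrMl//.
  have -> : h^-1 * (S e (x + h) - 2 * S e x + S e (x - h)) =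
    (S e (x + h) - S e x) / h - (S e x - S e (x - h)) / h by ring.
  by rewrite lerB.
have J2 : jump (fun j => S e (xi j)) i <= 4 * k%:R / T i * G.
  rewrite J -[leRHS]add0r lerD//; first by rewrite mulr_ge0_le0.
  by apply: jump_le.
have V : S e x * h ^+ 2 <= T i ^+ 2 * (h * (4 * k%:R / T i * G)).
  apply: (le_trans H); rewrite ler_pM2l ?exprn_gt0//; apply: (le_trans J1).
  by rewrite ler_pM2l.
have V2 : S e x <= 4 * k%:R ^+ 2 * G.
  rewrite -(ler_pM2r (exprn_gt0 2 h0)); apply: (le_trans V); rewrite /h le_eqVlt.
  by apply/orP; left; apply/eqP; move: T0 k0; clear; move: (T i) (k%:R) => y z y0 z0; field; rewrite !gt_eqF.
have := SE i iN'; rewrite ei add0r -/x => V3; move: V2; rewrite V3.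
have := g1 i iN'; rewrite ler_norml => /andP[? _]; lra.
Qed.

End Touching.

(** * Lower bounds for the hinge values *)

Section HingeLowerBound.
Variables (R : realType) (n k : nat).
Hypotheses (n0 : (0 < n)%N) (k5 : (5 <= k)%N).
Local Notation N := (n + k)%N.
Local Notation t := (uknot R n k).
Local Notation xi := (greville R n k).
Local Notation spl := (bsum n k).
Local Notation S := (spl k).
Local Notation T := (kgap R n k).
Local Notation B := (ubs n k).
Local Notation sl := (cslope n k).
Local Notation Fh := (hinge_value R n k).
Implicit Types (c e : nat -> R) (x y z : R).

Let k3 : (3 <= k)%N. Proof. by nlia. Qed.

(* [g (a + s) / s^m] is nonincreasing in [s]. *)
Definition powdom (m : nat) (a : R) (g : R -> R) := forall l s : R, 0 < l <= 1 -> 0 <= s ->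
  a + s <= n%:R -> l ^+ m * g (a + s) <= g (a + l * s).

Lemma powdom_int m a g G : (forall z : R, is_derive z 1 G (g z)) -> G a = 0 ->
  powdom m a g -> powdom m.+1 a G.
Proof.
move=> dG Ga gm l s /andP[l0 l1] s0 sn.
pose H y := G (a + l * y) - l ^+ m.+1 * G (a + 1 * y).
have dH y : is_derive y 1 H (l * g (a + l * y) - l ^+ m.+1 * (1 * g (a + 1 * y))).
  have h1 := is_derive_affine (dG (a + l * y)).
  have h2 := is_deriveZ (l ^+ m.+1) (is_derive_affine (dG (a + 1 * y))).
  exact: is_deriveB h1 h2.
have := derive_ge0 dH s0; rewrite {1}/H !mulr0 !addr0 Ga mulr0 subrr /H mul1r subr_ge0.
apply=> y /andP[y0 ys]; rewrite !mul1r exprS -mulrA -mulrBr mulr_ge0 ?(ltW l0)//.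
rewrite subr_ge0; apply: gm; [by rewrite l0|exact: ltW|lra].
Qed.

(** The quotient of the B-spline by [(z - t j)^(p+2)] decreases: by the recursion, [z - t j] times
    the derivative is at most [p+2] times the B-spline. *)
Lemma B_powdom p j : powdom p.+2 (t j) (B p.+2 j).
Proof.
move=> l s /andP[l0 l1]; set a := t j; have a0 : 0 <= a := @tt_ge0 R n k j.
rewrite le_eqVlt => /predU1P[<-|s0] sn.
  rewrite mulr0 addr0 in sn *; rewrite ler_piMl ?exprn_ile1 ?(ltW l0)//.
  by apply: B_ge0 => //; rewrite a0.
move: l1; rewrite le_eqVlt => /predU1P[->|l1]; first by rewrite expr1n !mul1r.
set y := a + l * s; set y' := a + s.
have ls : 0 < l * s by exact: mulr_gt0.
have yy : y < y' by rewrite ltrD2l gtr_pMl.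
pose v : {poly R} := ('X - a%:P) ^+ p.+2.
have vE z : v.[z] = (z - a) ^+ p.+2 by rewrite horner_exp hornerXsubC.
have dvE z : v^`().[z] = p.+2%:R * (z - a) ^+ p.+1.
  by rewrite deriv_exp derivXsubC mul1r hornerMn horner_exp hornerXsubC mulr_natl.
have pos z : y <= z -> 0 < z - a.
  by move=> yz; rewrite subr_gt0; apply: lt_le_trans yz; rewrite ltrDl.
have hd z : y <= z -> is_derive z 1 (fun z => B p.+2 j z / v.[z])
   ((udbs n k p.+2 j z * v.[z] - B p.+2 j z * v^`().[z]) / v.[z] ^+ 2).
  move=> yz; apply: is_derive_ratio.
  - by rewrite vE expf_neq0// gt_eqF// pos.
  - exact: is_derive_B.
have hd' z : z \in `]y, y'[ -> is_derive z 1 (fun z => B p.+2 j z / v.[z])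
   ((udbs n k p.+2 j z * v.[z] - B p.+2 j z * v^`().[z]) / v.[z] ^+ 2).
  by rewrite in_itv /= => /andP[yz _]; apply: hd; exact: ltW.
have [|z] := MVT yy hd'.
  by apply: derivable_within_continuous => z; rewrite in_itv /= => /andP[/hd []].
rewrite in_itv /= => /andP[yz zy] e.
have zn : 0 <= z <= n%:R.
  rewrite (ltW (lt_le_trans zy sn)) andbT ltW// (le_lt_trans _ yz)//.
  by rewrite addr_ge0// ltW.
have W : (z - a) * udbs n k p.+2 j z <= p.+2%:R * B p.+2 j z.
  have b0 := @B_ge0 R n k n0 p.+1 j.+1 z zn.
  rewrite /udbs /dbs /ubs (bsS _ _ p.+1) -/(B p.+1 j z) -/(B p.+1 j.+1 z) mulrCA ler_wpM2l//.
  have h1 : 0 <= (t (j + p.+2).+1 - a) / (t (j + p.+2).+1 - t j.+1) * B p.+1 j.+1 z.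
    rewrite mulr_ge0// divr_ge0// subr_ge0 tt_homo//; first by nlia.
    by rewrite ltnS leq_addr.
  rewrite -subr_ge0; move: h1; congr (0 <= _); rewrite -/a.
  by move: (_^-1) (_^-1) => u w; ring.
have : B p.+2 j y' / v.[y'] <= B p.+2 j y / v.[y].
  rewrite -subr_le0 e; apply: mulr_le0_ge0; last by rewrite subr_ge0 ltW.
  apply: mulr_le0_ge0; last by rewrite invr_ge0 sqr_ge0.
  rewrite vE dvE exprS subr_le0.
  have -> : udbs n k p.+2 j z * ((z - a) * (z - a) ^+ p.+1) =
    ((z - a) * udbs n k p.+2 j z) * (z - a) ^+ p.+1 by ring.
  have -> : B p.+2 j z * (p.+2%:R * (z - a) ^+ p.+1) =
    (p.+2%:R * B p.+2 j z) * (z - a) ^+ p.+1 by ring.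
  by apply: ler_wpM2r => //; rewrite exprn_ge0// ltW// pos// ltW.
have v1 : v.[y] = l ^+ p.+2 * s ^+ p.+2 by rewrite vE /y addrC addKr exprMn.
have v2 : v.[y'] = s ^+ p.+2 by rewrite vE /y' addrC addKr.
have sp : 0 < s ^+ p.+2 by rewrite exprn_gt0.
have lp : 0 < l ^+ p.+2 by rewrite exprn_gt0.
rewrite v1 v2; move: (s ^+ _) (l ^+ _) sp lp => u w u0 w0.
by rewrite invfM mulrA ler_pM2r ?invr_gt0// ler_pdivlMr// mulrC.
Qed.

Lemma one_add_inv_expn_le4 (m : nat) : (1 + m%:R^-1) ^+ m <= 4 :> R.
Proof.
case: m => [|m]; first by rewrite expr0; lra.
apply: (@le_trans _ _ (expR 1)).
  have -> : expR 1 = expR (m.+1%:R^-1) ^+ m.+1 :> R.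
    by rewrite -expRM_natl divff.
  by rewrite lerXn2r ?nnegrE ?expR_ge0 ?addr_ge0 ?invr_ge0// expR_ge1Dx.
have h := @expR_ge1Dx R (- 2^-1).
have -> : 1 = 2^-1 + 2^-1 :> R by field.
rewrite expRD; have e := expRN (2^-1 : R); rewrite e in h.
have p := expR_gt0 (2^-1 : R).
have h2 : expR 2^-1 <= 2 :> R.
  rewrite -[leRHS]invrK -[leLHS]invrK lef_pV2 ?posrE ?invr_gt0//.
  by apply: le_trans h; lra.
by have := ler_pM (ltW p) (ltW p) h2 h2; lra.
Qed.

(** With [L = xi l - t l.+1], the ramp at [l] lies above a line, so its image is at least [L / k] at
    [xi l + L / k]. Going back to [xi l] shrinks the distance to [t l.+1] by the factor [1 + 1/k]
    and, by [powdom k], the value by at most [(1 + 1/k)^k <= 4]. *)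
Lemma Fh_lower_l l : (0 < l)%N -> (l.+1 < N)%N -> xi l - t l.+1 <= 4 * k%:R * Fh l.
Proof.
move=> l0 lN; have k0 := kR_gt0 R n0 k3; have lN' : (l < N)%N by nlia.
have [/andP[x0 xn] /andP[ax xb] h0] := xi_in R n0 k5 l0 lN.
have [hT1 hT2] := xi_T R n0 k5 l0 lN.
have h1 := @tt_ge0 R n k l.+1; have h2 := @tt_le R n k (l + k).
set a := t l.+1 in ax h1 hT1 *; set L := xi l - a.
have L0 : 0 < L by rewrite subr_gt0.
have LT : L <= T l by rewrite /L /kgap -/a; lra.
have kL : L / k%:R <= T l / k%:R by rewrite ler_pM2r ?invr_gt0.
have p2 : powdom k.-2 a (S2 n k (ramp R n k l)).
  move=> u s hu s0 sn; rewrite !S2_ramp//.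
  have := B_powdom; have -> : k.-2 = (k.-2.-2).+2 by nlia.
  move=> /(_ (k.-2.-2) l.+1 u s hu s0 sn) H.
  rewrite mulrCA ler_wpM2l//; apply: divr_ge0; apply: ltW.
    exact: k1R_gt0 n0 k3.
  exact: T_gt0'.
have sl0 j : (j <= l)%N -> sl (ramp R n k l) j = 0.
  by move=> ji; rewrite /cslope /dc !ramp0 ?subrr ?mulr0 ?mul0r//; nlia.
have p1 : powdom k.-1 a (spl k.-1 (sl (ramp R n k l))).
  have -> : k.-1 = k.-2.+1 by nlia.
  apply: (@powdom_int _ _ (S2 n k (ramp R n k l))) => //.
    have -> : k.-2.+1 = k.-1 by nlia.
    exact: is_derive_S1.
  by apply: spl_left0 => //; nlia.
have p0 : powdom k a (S (ramp R n k l)).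
  rewrite [X in powdom X](_ : k = k.-1.+1); last by nlia.
  apply: (@powdom_int _ _ (spl k.-1 (sl (ramp R n k l)))) => //.
    exact: is_derive_S.
  by apply: spl_left0 => //; [nlia|nlia|move=> j; apply: ramp0].
pose w : R := 1 + k%:R^-1; have w1 : 0 < w by rewrite addr_gt0 ?invr_gt0.
have := p0 w^-1 (w * L); rewrite mulKf ?gt_eqF// invr_gt0 w1 invf_le1// lerDl invr_ge0 ltW//.
have eL : w * L = L + L / k%:R by rewrite /w; ring.
have wn : a + w * L <= n%:R by rewrite eL; move: kL; rewrite /L; lra.
move=> /(_ isT (mulr_ge0 (ltW w1) (ltW L0)) wn).
have -> : a + L = xi l by rewrite /L; ring.
rewrite [S _ (xi l)]hinge_flip// exprVn -ler_pdivlMl ?invr_gt0 ?exprn_gt0// invrK => H.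
have mono : S (ramp R n k l) (a + w * L) >= L / k%:R.
  have -> : L / k%:R = - xi l + 1 * (a + w * L) by rewrite eL /L; ring.
  rewrite -(S_line n0 k3); apply: le_spl => //.
    by rewrite wn addr_ge0// mulr_ge0 ?ltW.
  by move=> j _; rewrite /ramp mul1r addrC le_max lexx.
have F0 : 0 <= Fh l.
  apply: spl_ge0 => //; first exact: xi_itv.
  by move=> j _; rewrite le_max lexx orbT.
have := le_trans mono H; rewrite ler_pdivrMr// => H2.
apply: (le_trans H2); rewrite mulrAC; apply: ler_wpM2r => //.
by apply: ler_wpM2r (one_add_inv_expn_le4 _); exact: ltW.
Qed.

Lemma Fh_lower_r l : (0 < l)%N -> (l.+1 < N)%N -> t (l + k) - xi l <= 4 * k%:R * Fh l.
Proof.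
move=> l0 lN.
pose l' := (N - l.+1)%N; have ll' : (l + l').+1 = N by rewrite /l'; nlia.
have l'0 : (0 < l')%N by rewrite /l'; nlia.
have l'N : (l'.+1 < N)%N by nlia.
have := Fh_lower_l l'0 l'N; rewrite (Fh_refl R n0 k3 ll') (xi_refl R n0 k3 ll').
rewrite (@tt_refl R n k n0 (l + k) l'.+1); last by nlia.
by congr (_ <= _); ring.
Qed.

Lemma tt_nat j : (j <= n + k)%N -> t j = (j - k)%:R.
Proof. by move=> jn; rewrite /uknot; congr _%:R; nlia. Qed.

Lemma Fh_T_lower l : (2 * k < n)%N -> (0 < l)%N -> (l.+1 < N)%N ->
  1 <= 4 * k%:R ^+ 2 * (Fh l * (T l / (k%:R - 1))).
Proof.
move=> kn; wlog ll : l / (l.*2 <= N)%N => [W l0 lN|l0 lN].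
  have [h|h] := leqP l.*2 N; first exact: W.
  have ll' : ((N - l.+1) + l).+1 = N by nlia.
  rewrite (Fh_refl R n0 k3 ll') (T_refl R n0 k3 ll').
  apply: W; nlia.
have k0 := kR_gt0 R n0 k3; have k1 := k1R_gt0 R n0 k3; have T0 := T_gt0' R n0 k3 l0 lN.
suff H : k%:R - 1 <= 4 * k%:R ^+ 2 * Fh l * T l.
  by rewrite [X in _ * X]mulrA [leRHS]mulrA ler_pdivlMr// mul1r mulrA.
have TE : T l = (l - (l.+1 - k))%:R.
  rewrite /kgap !tt_nat; [|nlia..].
  by rewrite addnK -natrB//; nlia.
(* At [l = 1] the gap is 1 and the mean of the two one-sided bounds is too weak; the right one
   alone, with [t k.+1 - xi 1 = 1 - 1/k], is enough. For larger [l] the gap is at least 2. *)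
have [l1|l1] := leqP l 1.
  have e : l = 1%N by nlia.
  have := Fh_lower_r l0 lN; rewrite TE e.
  have -> : xi 1 = k%:R^-1.
    have := @xiS R n k 0; rewrite xi0// subr0 add0n !tt_nat; [|nlia..].
    have -> : (k.+1 - k = 1)%N by nlia.
    have -> : (1 - k = 0)%N by nlia.
    by move=> ->; rewrite subr0 mul1r.
  rewrite tt_nat ?addnK; last by nlia.
  have -> : (2 - k = 0)%N by nlia.
  rewrite subn0 mulr1; set F := Fh 1 => HF.
  have -> : k%:R - 1 = k%:R * (1 - k%:R^-1) :> R by rewrite mulrBr mulr1 divff// gt_eqF.
  have -> : 4 * k%:R ^+ 2 * F = k%:R * (4 * k%:R * F) by ring.
  by rewrite ler_pM2l.
have T2 : 2 <= T l by rewrite TE ler_nat; nlia.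
have HF : T l / 2 <= 4 * k%:R * Fh l.
  by have := Fh_lower_l l0 lN; have := Fh_lower_r l0 lN; rewrite /kgap; lra.
have : k%:R * (T l / 2 * T l) <= k%:R * (4 * k%:R * Fh l * T l).
  by rewrite ler_pM2l// ler_pM2r.
have -> : k%:R * (4 * k%:R * Fh l * T l) = 4 * k%:R ^+ 2 * Fh l * T l by ring.
apply: le_trans.
apply: (@le_trans _ _ (k%:R * 2)); first lra.
by rewrite ler_pM2l//; have := ler_pM (ler0n R 2) (ler0n R 2) T2 T2; lra.
Qed.

End HingeLowerBound.

(** * The comparison sequence *)

Section Weights.
Variables (R : realType) (n k : nat).
Hypotheses (n0 : (0 < n)%N) (k5 : (5 <= k)%N).
Local Notation N := (n + k)%N.
Local Notation xi := (greville R n k).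
Local Notation spl := (bsum n k).
Local Notation S := (spl k).
Local Notation T := (kgap R n k).
Local Notation ac := (ccurv n k).
Local Notation jump := (cjump n k).
Local Notation cvx := (cconvex n k).
Local Notation hinge := (chinge R n k).
Local Notation Fh := (hinge_value R n k).
Implicit Types (c e : nat -> R) (x y z : R).

Let k3 : (3 <= k)%N. Proof. by nlia. Qed.

Hypothesis kn : (2 * k < n)%N.

Let xiN' j : (j < N)%N -> 0 <= xi j <= n%:R. Proof. exact: xi_itv. Qed.

(** Subtracting a hinge that carries the break of [q] at [l] leaves a convex sequence; Jensen's
    inequality at [l] gives the bound. *)
Lemma ac_Fh_le q l : cvx q -> (0 < l)%N -> (l.+1 < N)%N ->
  ac q l * (Fh l * (T l / (k%:R - 1))) <= S q (xi l) - q l.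
Proof.
move=> cq l0 lN; set w := ac q l; pose a := w * (T l / (k%:R - 1)).
have k1 := k1R_gt0 R n0 k3; have T0 := T_gt0' R n0 k3 l0 lN.
have cz : cvx (fun j => q j - a * hinge l j).
  move=> i i0 iN; rewrite jumpB jumpZ hinge_jump//.
  have [->|il] := eqVneq i l; first by rewrite mulr1 acE// subrr.
  by rewrite mulr0 subr0; apply: cq.
have := jensen n0 k3 cz l0 lN; rewrite splB splZ -/(Fh l) /chinge subrr maxxx mulr0 subr0.
by rewrite (_ : w * _ = a * Fh l); [lra|rewrite /a; ring].
Qed.

Lemma cvx_q2 : cvx (qcoef R n k).
Proof.
move=> l l0 lN; rewrite acE// ac_q2// mul1r divr_ge0 ?ltW ?T_gt0'//.
exact: k1R_gt0 n0 k3.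
Qed.

Let k1 : (1 < k)%N. Proof. by nlia. Qed.

Lemma vr_lower l : (0 < l)%N -> (l.+1 < N)%N -> 1 <= 4 * k%:R ^+ 2 * qdefect R n k l.
Proof.
move=> l0 lN; have := ac_Fh_le cvx_q2 l0 lN.
rewrite ac_q2// mul1r spl_q2// -/(qdefect R n k l) => h.
apply: le_trans (Fh_T_lower R n0 k5 kn l0 lN) _; rewrite ler_wpM2l//.
Qed.

Definition smooth c j : R := S c (xi j).
Definition inner j : R := ((0 < j) && (j.+1 < N))%N%:R.
(* The coefficients of [x (n - x) / 2]. *)
Definition bump j : R := n%:R * xi j / 2 - qcoef R n k j.

Lemma smooth_end c j : (j < N)%N -> ~~ ((0 < j) && (j.+1 < N))%N -> smooth c j = c j.
Proof.
move=> jN; rewrite negb_and -leqNgt leqn0 => /orP[/eqP ->|h].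
  by rewrite /smooth xi0// S0.
by have -> : j = N.-1 by [nlia]; rewrite /smooth xiN// Sn.
Qed.

Lemma q2_end j : (j < N)%N -> ~~ ((0 < j) && (j.+1 < N))%N -> qcoef R n k j = xi j ^+ 2 / 2.
Proof. by move=> jN je; rewrite -(smooth_end (qcoef R n k) jN je) /smooth spl_q2. Qed.

Lemma smooth_bump j : smooth bump j = bump j - qdefect R n k j.
Proof.
rewrite /smooth (@eq_spl R n k k _ (fun j => (0 + n%:R / 2 * xi j) - qcoef R n k j)).
  by rewrite splB S_line// spl_q2// /bump /qdefect; ring.
by move=> i _; rewrite /bump; ring.
Qed.

Lemma bump_ge0 j : (j < N)%N -> 0 <= bump j.
Proof.
move=> jN; have /andP[h1 h2] := xiN' jN.
have : qcoef R n k j <= xi j ^+ 2 / 2.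
  have [/andP[j0 jN']|je] := boolP ((0 < j) && (j.+1 < N))%N; last by rewrite q2_end.
  by have := jensen n0 k3 cvx_q2 j0 jN'; rewrite spl_q2.
have : xi j * xi j <= n%:R * xi j by rewrite ler_wpM2r.
by rewrite /bump expr2; lra.
Qed.

Lemma vr_inner j : (j < N)%N -> inner j <= 4 * k%:R ^+ 2 * qdefect R n k j.
Proof.
move=> jN; rewrite /inner.
have [/andP[j0 jN']|je] := boolP ((0 < j) && (j.+1 < N))%N; first exact: vr_lower.
by rewrite /qdefect q2_end// subrr mulr0.
Qed.

(** A crude bound for [bump]: it governs how many iterations are taken, but not the constants in the
    statement of [weights]. *)
Let bmax := \sum_(j < N) bump j.

Lemma bump_le j : (j < N)%N -> bump j <= bmax * inner j.
Proof.
move=> jN; rewrite /inner.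
have [/andP[j0 jN']|je] := boolP ((0 < j) && (j.+1 < N))%N.
  rewrite mulr1 /bmax (bigD1 (Ordinal jN))//= lerDl sumr_ge0// => i _.
  exact: bump_ge0.
rewrite mulr0 /bump q2_end//; move: je; rewrite negb_and -leqNgt leqn0.
case/orP => [/eqP ->|h]; first by rewrite xi0// expr2 !(mul0r, mulr0) subrr.
have -> : j = N.-1 by nlia.
by rewrite xiN// expr2 subrr.
Qed.

Lemma bmax_ge0 : 0 <= bmax.
Proof. by apply: sumr_ge0 => j _; apply: bump_ge0. Qed.

Local Notation P m := (iter m smooth inner).

Lemma smooth_le c c' j : (j < N)%N -> (forall i, (i < N)%N -> c i <= c' i) ->
  smooth c j <= smooth c' j.
Proof. by move=> jN h; apply: le_spl => //; exact: xiN'. Qed.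

Lemma iter_inner m j : (j < N)%N -> 0 <= P m j <= inner j.
Proof.
elim: m j => [|m IH] j jN /=; first by rewrite lexx ler0n.
apply/andP; split.
  apply: spl_ge0 => //; first exact: xiN'.
  by move=> i iN; have /andP[] := IH i iN.
have [ji|je] := boolP ((0 < j) && (j.+1 < N))%N; last first.
  by rewrite smooth_end//; have /andP[] := IH j jN.
rewrite [leRHS]/inner ji; have <- : smooth (fun=> 1) j = 1 by rewrite /smooth spl_cst.
apply: smooth_le => // i iN; have /andP[_ h] := IH i iN; apply: (le_trans h).
by rewrite /inner; case: (_ && _)%N; rewrite ?ler01.
Qed.

Lemma iter_bump m j : (j < N)%N -> 0 <= iter m smooth bump j <= bmax * P m j.
Proof.
elim: m j => [|m IH] j jN /=; first by rewrite bump_le// bump_ge0.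
apply/andP; split.
  apply: spl_ge0 => //; first exact: xiN'.
  by move=> i iN; have /andP[] := IH i iN.
have -> : bmax * smooth (P m) j = smooth (fun i => bmax * P m i) j by rewrite /smooth splZ.
by apply: smooth_le => // i iN; have /andP[] := IH i iN.
Qed.

(* [bump - smooth bump = qdefect] is bounded below inside, so summing its iterates
   forces those of [inner] to tend to zero. *)
Lemma iter_inner_decay m j : (j < N)%N ->
  m%:R * P m j + 4 * k%:R ^+ 2 * iter m smooth bump j <= 4 * k%:R ^+ 2 * bump j.
Proof.
elim: m j => [|m IH] j jN; first by rewrite mul0r add0r.
have H : m%:R * P m.+1 j + 4 * k%:R ^+ 2 * iter m.+1 smooth bump j <=
    4 * k%:R ^+ 2 * smooth bump j.
  have := @smooth_le (fun i => m%:R * P m i + 4 * k%:R ^+ 2 * iter m smooth bump i)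
    (fun i => 4 * k%:R ^+ 2 * bump i) j jN IH.
  by rewrite /smooth splD !splZ.
have /andP[_ h] := iter_inner m.+1 jN.
have := vr_inner jN; move: H; rewrite smooth_bump => H1 H2.
have -> : m.+1%:R = m%:R + 1 :> R by rewrite -natr1.
by rewrite mulrDl mul1r; move: H1; rewrite mulrBr; lra.
Qed.

Lemma iter_smooth_small eps : 0 < eps -> exists L : nat, forall j, (j < N)%N -> P L.+1 j <= eps.
Proof.
move=> e0; pose X := 4 * k%:R ^+ 2 * bmax / eps.
exists (Num.truncn X) => j jN; set L := (Num.truncn X).+1.
have hL : X < L%:R by exact: truncnS_gt.
have k2 : 0 <= 4 * k%:R ^+ 2 :> R by rewrite mulr_ge0// sqr_ge0.
have X0 : 0 <= X by apply: divr_ge0 (ltW e0); exact: mulr_ge0 k2 bmax_ge0.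
have := iter_inner_decay L jN; have /andP[b0 _] := iter_bump L jN.
have /andP[P0 _] := iter_inner L jN.
have hb : bump j <= bmax.
  apply: le_trans (bump_le jN) _; rewrite ler_piMr ?bmax_ge0// /inner.
  by case: (_ && _)%N.
have h1 := ler_wpM2l k2 hb; have h2 := mulr_ge0 k2 b0 => H.
have : L%:R * P L j <= L%:R * eps.
  apply: (@le_trans _ _ (4 * k%:R ^+ 2 * bmax)); first lra.
  by rewrite -ler_pdivrMr// ltW.
by rewrite ler_pM2l// (le_lt_trans X0 hL).
Qed.

Lemma jump_inner l : (0 < l)%N -> (l.+1 < N)%N -> jump inner l <= 0.
Proof.
move=> l0 lN; rewrite jumpE//; have [h1 h2] := xi_step R n0 l0 lN.
have [_ _ h0] := xi_in R n0 k5 l0 lN.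
have il : inner l = 1 by rewrite /inner l0 lN.
have i1 j : inner j <= 1 by rewrite /inner; case: (_ && _)%N.
rewrite il subr_le0; apply: (@le_trans _ _ 0).
  by rewrite mulr_le0_ge0 ?subr_le0// invr_ge0 (le_trans (ltW h0)).
apply: divr_ge0; first by rewrite subr_ge0.
exact: le_trans (ltW h0) h2.
Qed.

Lemma cvx_iter q m : cvx q -> cvx (iter m smooth q).
Proof. by move=> cq; elim: m => //= m IH; apply: cvx_S. Qed.

(** A truncated Neumann series for [S q - q = 1] at the inner nodes: for
    [q = sum_(i <= L) smooth^i q0] the difference telescopes to [smooth^(L+1) q0 - q0], whose first
    term is tiny. The start [q0] is the convex sequence [- inner], made strictly convex by
    [- eta * bump]. *)
Lemma weights : exists q u : nat -> R, [/\ cvx q,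
  forall l, (0 < l)%N -> (l.+1 < N)%N -> 0 < ac q l,
  forall j, (j < N)%N -> S q (xi j) = q j + u j,
  forall l, (0 < l)%N -> (l.+1 < N)%N -> jump u l <= 0 &
  forall l, (0 < l)%N -> (l.+1 < N)%N -> 9/10 <= u l <= 11/10].
Proof.
have b0 := bmax_ge0; have kr := kR_gt0 R n0 k3; have kr1 := k1R_gt0 R n0 k3.
(* [eta] keeps [eta * bump] below 1/10. [tau] bounds the remainder: its jump is at most
   [4 k tau / T = eta / (k T)], below the jump [eta T / (k - 1)] that [bump] secures for [q0], so
   the jumps of [u] are nonpositive. *)
pose eta := (10 * (1 + bmax))^-1; pose tau := eta / (4 * k%:R ^+ 2).
have eta0 : 0 < eta by rewrite invr_gt0; lra.
have etab : eta * (1 + bmax) = 1/10 by rewrite /eta; field; rewrite gt_eqF//; lra.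
have tau0 : 0 < tau by rewrite divr_gt0// mulr_gt0// exprn_gt0.
have [L hL] := @iter_smooth_small (tau / 2) (divr_gt0 tau0 (ltr0Sn R 1)).
pose q0 j := -1 * inner j - eta * bump j.
have itE m j : iter m smooth q0 j = -1 * P m j - eta * iter m smooth bump j.
  elim: m j => //= m IH j; rewrite /smooth.
  rewrite (@eq_spl R n k k _ (fun j => -1 * P m j - eta * iter m smooth bump j)).
    by rewrite splB !splZ.
  by move=> i _; rewrite IH.
have jq0 l : (0 < l)%N -> (l.+1 < N)%N -> eta * (T l / (k%:R - 1)) <= jump q0 l.
  move=> l0 lN; rewrite jumpB !jumpZ.
  have -> : jump bump l = - (T l / (k%:R - 1)).
    have -> : jump bump l = jump (fun j => (0 + n%:R / 2 * xi j) - qcoef R n k j) l.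
      by apply: jump_ext => j; rewrite /bump; ring.
    by rewrite (@jumpB R n k (fun j => 0 + _ * _)) jump_line// acE// ac_q2//; ring.
  by have := jump_inner l0 lN; lra.
have Tk l : (0 < l)%N -> (l.+1 < N)%N -> 0 < T l / (k%:R - 1).
  by move=> l0 lN; rewrite divr_gt0// T_gt0'.
have cq0 : cvx q0.
  move=> l l0 lN; apply: le_trans (jq0 l l0 lN).
  by apply: mulr_ge0; apply: ltW => //; apply: Tk.
pose q m j := \sum_(i < m) iter i smooth q0 j.
have jq m l : jump (q m.+1) l = jump (q m) l + jump (iter m smooth q0) l.
  by rewrite -jumpD; apply: jump_ext => j; rewrite /q big_ord_recr.
have jq1 m l : (0 < l)%N -> (l.+1 < N)%N -> jump q0 l <= jump (q m.+1) l.
  move=> l0 lN; elim: m => [|m IH].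
    by rewrite le_eqVlt; apply/orP; left; apply/eqP; apply: jump_ext => j; rewrite /q big_ord1.
  by rewrite jq; have := cvx_iter m.+1 cq0 l0 lN; lra.
have small j : (j < N)%N -> - tau <= iter L.+1 smooth q0 j <= 0.
  move=> jN; rewrite itE; have /andP[p0 _] := iter_inner L.+1 jN.
  have /andP[h1 h2] := iter_bump L.+1 jN; have h3 := hL j jN.
  have h4 : eta * iter L.+1 smooth bump j <= 1 * P L.+1 j.
    apply: (@le_trans _ _ (eta * (bmax * P L.+1 j))); first by rewrite ler_pM2l.
    rewrite mulrA ler_wpM2r//; lra.
  have h5 : 0 <= eta * iter L.+1 smooth bump j by rewrite mulr_ge0// ltW.
  by apply/andP; split; lra.
have eta1 : eta <= 1/10.
  by rewrite -etab ler_peMr//; [exact: ltW|lra].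
have tau1 : tau <= eta.
  rewrite /tau ler_pdivrMr ?mulr_gt0 ?exprn_gt0// ler_peMr ?ltW//.
  have : 1 <= k%:R :> R by rewrite ler1n; nlia.
  by move=> h; have := ler_pM ler01 ler01 h h; rewrite expr2; lra.
exists (q L.+1), (fun j => iter L.+1 smooth q0 j - q0 j); split.
- by move=> l l0 lN; apply: le_trans (jq1 L l l0 lN); exact: cq0.
- move=> l l0 lN; have := jq1 L l l0 lN; rewrite [leRHS]acE// => h.
  rewrite -(pmulr_lgt0 _ (Tk l l0 lN)); apply: lt_le_trans h.
  by apply: lt_le_trans (jq0 l l0 lN); rewrite mulr_gt0// Tk.
- move=> j jN; elim: L.+1 => [|m IH] /=.
    rewrite subrr addr0 /q !big_ord0 /bsum big1// => i _.
    by rewrite big_ord0 mul0r.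
  have -> : S (q m.+1) (xi j) = S (q m) (xi j) + smooth (iter m smooth q0) j.
    by rewrite -splD; apply: eq_spl => i _; rewrite /q big_ord_recr.
  by rewrite IH /q big_ord_recr /=; ring.
- move=> l l0 lN; rewrite jumpB subr_le0; apply: le_trans (jq0 l l0 lN).
  apply: (@le_trans _ _ (4 * k%:R / T l * tau)).
    apply: (jump_le n0 k5 l0 lN) => j jN; have /andP[h1 h2] := small j jN.
    by rewrite ler_norml h1 (le_trans h2)// ltW.
  have T1 := T_ge1 R n0 k3 l0 lN; have T0 := T_gt0' R n0 k3 l0 lN.
  have -> : 4 * k%:R / T l * tau = eta / (k%:R * T l).
    rewrite /tau; move: (T l) T0 kr => x x0 kr; field.
    by rewrite !gt_eqF.
  rewrite ler_pM2l// -[leLHS]mul1r ler_pdivrMr ?mulr_gt0//.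
  have -> : T l / (k%:R - 1) * (k%:R * T l) = (T l * T l) * (k%:R / (k%:R - 1)) by ring.
  have h1 : 1 <= k%:R / (k%:R - 1) :> R by rewrite ler_pdivlMr// mul1r; lra.
  have h2 := ler_pM ler01 ler01 T1 T1; rewrite mul1r in h2.
  by have := ler_pM ler01 ler01 h2 h1; rewrite mul1r.
- move=> l l0 lN; have lN' : (l < N)%N by nlia.
  have /andP[h1 h2] := small l lN'.
  have il : inner l = 1 by rewrite /inner l0 lN.
  have bl : eta * bump l <= eta * bmax.
    by rewrite ler_pM2l//; apply: le_trans (bump_le lN') _; rewrite il mulr1.
  have bl0 : 0 <= eta * bump l by rewrite mulr_ge0 ?bump_ge0// ltW.
  rewrite /q0 il; apply/andP; split; lra.
Qed.

(** The maximal ratio [A] satisfies [9/10 A <= (1 + 4 k^2) G] by [touching_bound], and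
    [ccurv q <= 4 k^2 * 11/10] by [ac_Fh_le] and [Fh_T_lower]; 44/9 is [10/9 * 4 * 11/10]. *)
Lemma ac_bound_weights c G : (forall j, (j < N)%N -> `|c j - S c (xi j)| <= G) ->
  forall l, (0 < l)%N -> (l.+1 < N)%N ->
  `|ac c l| <= 44 / 9 * k%:R ^+ 2 * (1 + 4 * k%:R ^+ 2) * G.
Proof.
move=> hG; have [q [u [cq wq hu ju ub]]] := weights.
have h1 : (1 < N)%N by nlia.
pose D := [pred i : 'I_N | (0 < i)%N && (i.+1 < N)%N].
have D1 : D (Ordinal h1) by rewrite inE /=; nlia.
case: (@arg_maxP _ _ _ (Ordinal h1) D (fun i => `|ac c i| / ac q i) D1) => i /andP[i0 iN] hi.
pose A := `|ac c i| / ac q i.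
have hA l : (0 < l)%N -> (l.+1 < N)%N -> `|ac c l| <= A * ac q l.
  move=> l0 lN; have lN' : (l < N)%N by nlia.
  by rewrite -ler_pdivrMr ?wq//; apply: (hi (Ordinal lN')); rewrite inE /= l0.
have A0 : 0 <= A by rewrite divr_ge0// ltW// wq.
have eA : `|ac c i| = A * ac q i by rewrite divfK// gt_eqF// wq.
have H : A * u i <= (1 + 4 * k%:R ^+ 2) * G.
  have [ci|ci] := leP 0 (ac c i).
    apply: (touching_bound n0 k5 i0 iN hu hG) => //; first exact: ju.
      by move=> l l0 lN; apply: le_trans (hA l l0 lN); exact: ler_norm.
    by rewrite -eA ger0_norm.
  have aN l : ac (fun j => -1 * c j) l = - ac c l by rewrite /ccurv jumpZ; ring.
  apply: (@touching_bound R n k n0 k5 q u (fun j => -1 * c j) G A i i0 iN hu) => //.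
  - by move=> j jN; rewrite splZ -mulrBr normrM normrN1 mul1r hG.
  - exact: ju.
  - by move=> l l0 lN; rewrite aN; apply: le_trans (hA l l0 lN); rewrite -normrN ler_norm.
  - by rewrite aN -eA ltr0_norm.
have G0 : 0 <= G by apply: le_trans (hG _ h1).
have HA : A <= 10 / 9 * ((1 + 4 * k%:R ^+ 2) * G).
  have /andP[u1 _] := ub i i0 iN; have := ler_wpM2l A0 u1; lra.
move=> l l0 lN; apply: le_trans (hA l l0 lN) _.
have w0 := wq l l0 lN; have lN' : (l < N)%N by nlia.
have W : ac q l <= 4 * k%:R ^+ 2 * (11 / 10).
  have := ac_Fh_le cq l0 lN; rewrite hu// [q l + _]addrC addrK => h.
  have /andP[_ u2] := ub l l0 lN.
  have := ler_wpM2l (ltW w0) (Fh_T_lower R n0 k5 kn l0 lN); rewrite mulr1 => h3.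
  apply: (le_trans h3); rewrite mulrCA ler_wpM2l//; exact: le_trans u2.
apply: le_trans (ler_pM A0 (ltW w0) HA W) _.
by rewrite le_eqVlt; apply/orP; left; apply/eqP; field.
Qed.

End Weights.

Delimit Scope Z_scope with BZ.

(** * Diagonal dominance for small degrees *)

Section RowCheck.
Variables (k : nat) (M : Z).
Local Open Scope Z_scope.

(** The cap at [n] is left out: for large [n] the checked rows stay clear of it. *)
Definition zt (j : nat) : Z := Z.of_nat (j - k)%N.

(** Entry [i] of the row of degree [p] stands for index [r - p + i]; the index thus shifts by one
    from degree to degree, whence the prepended 0. Division by 0 is 0, as in [bs]. *)
Definition znext (X : Z) (r p : nat) (w : seq Z) : seq Z :=
  [seq let j := (r - p.+1 + i)%N in
     (X - Z.of_nat k * zt j) * nth 0 (0 :: w) i /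
       (Z.of_nat k * (zt (j + p.+1) - zt j)) +
     (Z.of_nat k * zt (j + p.+1).+1 - X) * nth 0 w i /
       (Z.of_nat k * (zt (j + p.+1).+1 - zt j.+1))
  | i <- iota 0 p.+2].

(* The B-splines of degree [p] on piece [r] at [X / k], scaled by [M] and
   rounded down. *)
Fixpoint zrow (X : Z) (r p : nat) : seq Z :=
  if p is p'.+1 then znext X r p' (zrow X r p') else [:: M].

Definition zsum (f : nat -> Z) m := foldr (fun i a => f i + a) 0 (iota 0 m).
Definition zs1 l := zsum (fun i => zt (l + i.+1)) k.
Definition zs2 l := zsum (fun i => zt (l + i.+1) * zt (l + i.+1)) k.
Definition zT l := zt (l + k) - zt l.+1.

Definition zF r l := let X := zs1 l in let w := zrow X r k in
  zsum (fun i => Z.max (X - zs1 (r - k + i)) 0 * nth 0 w i) k.+1.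

(** [r] is the piece containing the node. The last test is [b <= a * (2 T / (k - 1) * hinge_value -
    qdefect)] times [2 k^2 (k - 1) M], with a lower bound in place of [hinge_value]. *)
Definition zcheck (a b : Z) (l : nat) : bool :=
  let K := Z.of_nat k in let X := zs1 l in
  let r := (k + Z.to_nat (X / K))%N in
  [&& K * zt r <=? X, X <=? K * zt r.+1, (r <= 3 * k)%N &
  2 * K * K * (K - 1) * M * b <=?
    a * (4 * K * zT l * zF r l - (K * zs2 l - X * X) * M)].

End RowCheck.

(* Lower bounds for [4 d + 2 epsilon zeta(3/2)], as fractions. *)
Definition row_const (k : nat) : Z * Z :=
  match k with
  | 3%N => (24, 1)%BZ
  | 4%N => (140, 3)%BZ
  | 5%N => (84, 1)%BZ
  | _ => (2 ^ Z.of_nat k.+1, 1)%BZ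
  end.

Definition row_ok k :=
  let: (a, b) := row_const k in all (zcheck k (2 ^ 36)%BZ a b) (iota 1 (k.*2 - k./2)).

(* From row [2 k - k / 2] on, all knots involved are simple and the rows agree. *)
Lemma rows_ok : all row_ok (iota 3 18).
Proof. by vm_compute. Qed.

Section RowTransfer.
Variables (R : realType) (n k : nat).
Hypotheses (n0 : (0 < n)%N) (k3 : (3 <= k)%N) (kn : (4 * k + 4 <= n)%N).
Local Notation N := (n + k)%N.
Local Notation t := (uknot R n k).
Local Notation xi := (greville R n k).
Local Notation spl := (bsum n k).
Local Notation S := (spl k).
Local Notation T := (kgap R n k).
Local Notation hinge := (chinge R n k).
Local Notation Fh := (hinge_value R n k).
Local Notation vr := (qdefect R n k).

Definition phi (z : Z) : R := (int_of_Z z)%:~R.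

Lemma phiD a b : phi (a + b)%BZ = phi a + phi b.
Proof. by rewrite -rmorphD -[in RHS](rmorphD int_of_Z). Qed.

Lemma phiN a : phi (- a)%BZ = - phi a.
Proof. by rewrite -rmorphN -[in RHS](rmorphN int_of_Z). Qed.

Lemma phiB a b : phi (a - b)%BZ = phi a - phi b.
Proof. by rewrite phiD phiN. Qed.

Lemma phiM a b : phi (a * b)%BZ = phi a * phi b.
Proof. by rewrite -rmorphM -[in RHS](rmorphM int_of_Z). Qed.

Lemma phi_nat m : phi (Z.of_nat m) = m%:R.
Proof.
have e : int_of_Z (Z.of_nat m) = m by lia.
by rewrite /phi e -pmulrn.
Qed.

Lemma phi_le a b : (a <= b)%BZ -> phi a <= phi b.
Proof. by move=> ab; rewrite ler_int; lia. Qed.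

Lemma phi_max a : phi (Z.max a 0) = Num.max (phi a) 0.
Proof.
have [h|h] := Z.le_ge_cases a 0.
  by rewrite Z.max_r// (max_idPr _)//; apply: phi_le h.
by rewrite Z.max_l// (max_idPl _)//; apply: phi_le h.
Qed.

Lemma phi_div a b : (0 <= a)%BZ -> (0 <= b)%BZ ->
  0 <= phi (a / b)%BZ /\ phi (a / b)%BZ <= phi a / phi b.
Proof.
move=> a0 b0; have [->|bn] := Z.eq_dec b 0.
  by rewrite Zdiv_0_r invr0 mulr0; split.
have bp : (0 < b)%BZ by lia.
split; first by have := phi_le (Z.div_pos a b a0 bp).
have p0 : 0 < phi b.
  apply: lt_le_trans (_ : phi 1%BZ <= _); first exact: ltr01.
  by apply: phi_le; lia.
rewrite ler_pdivlMr// mulrC -phiM.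
exact: phi_le (Z.mul_div_le _ _ bp).
Qed.

Lemma phi_sum f m : phi (zsum f m) = \sum_(i < m) phi (f i).
Proof.
rewrite -(big_mkord xpredT (fun i => phi (f i))) /index_iota subn0 /zsum.
elim: (iota 0 m) => [|i s IH]; first by rewrite big_nil.
by rewrite big_cons /= phiD IH.
Qed.

Lemma phi_zt j : (j <= n + k)%N -> phi (zt k j) = t j.
Proof. by move=> jn; rewrite phi_nat /uknot; congr _%:R; nlia. Qed.

Lemma phi_zs1 l : (l <= n)%N -> phi (zs1 k l) = s1 t k l.
Proof.
move=> ln; rewrite phi_sum; apply: eq_bigr => i _.
by apply: phi_zt; have := ltn_ord i; move: (nat_of_ord i) => j; nlia.
Qed.

Lemma phi_zs2 l : (l <= n)%N -> phi (zs2 k l) = s2 t k l.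
Proof.
move=> ln; rewrite phi_sum; apply: eq_bigr => i _.
by rewrite phiM expr2 phi_zt//; have := ltn_ord i; move: (nat_of_ord i) => j; nlia.
Qed.

Lemma phi_ge0 z : 0 <= phi z -> (0 <= z)%BZ.
Proof. by rewrite /phi ler0z; lia. Qed.

Lemma zt_den a b : (a <= b)%N -> (0 <= Z.of_nat k * (zt k b - zt k a))%BZ.
Proof. by move=> ab; apply: Z.mul_nonneg_nonneg; rewrite /zt; lia. Qed.

(** On its piece the recursion has nonnegative weights, so rounding down at each step keeps a lower
    bound, and that is the direction in which [zcheck] uses it. *)
Lemma zrow_le M X r p i (x : R) : (0 <= M)%BZ -> k%:R * x = phi X -> (k <= r)%N -> (r + k < N)%N ->
  t r <= x <= t r.+1 -> (p <= k)%N ->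
  0 <= phi (nth 0%BZ (zrow k M X r p) i) /\
  phi (nth 0%BZ (zrow k M X r p) i) <= phi M * bs t r p (r - p + i) x.
Proof.
move=> M0 hx kr rn hr.
have th := @tt_homo R n k n0.
have w0 : 0 <= phi M by exact: (@phi_le 0%BZ).
have b0 p' j : 0 <= phi M * bs t r p' j x by rewrite mulr_ge0 ?bs_ge0.
have k0 : 0 < k%:R :> R by rewrite ltr0n; nlia.
elim: p i => [|p IH] i pk.
  case: i => [|i] /=; last by rewrite nth_nil.
  by rewrite subn0 addn0 /bs eqxx mulr1.
rewrite [zrow _ _ _ _]/=; have [ip|pi] := ltnP i p.+2; last first.
  by rewrite nth_default ?size_map ?size_iota//; split.
rewrite (nth_map 0%N) ?size_iota// nth_iota// add0n.
set j := (r - p.+1 + i)%N.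
have jr : (j <= r)%N by rewrite /j; nlia.
have jl : (r < (j + p.+1).+1)%N by rewrite /j; nlia.
have jn : ((j + p.+1).+1 <= n + k)%N by rewrite /j; nlia.
have c1 : 0 <= x - t j.
  by case/andP: hr => h _; rewrite subr_ge0 (le_trans _ h)// th.
have c2 : 0 <= t (j + p.+1).+1 - x.
  by case/andP: hr => _ h; rewrite subr_ge0 (le_trans h)// th.
have KE a : (a <= n + k)%N -> phi (X - Z.of_nat k * zt k a)%BZ = k%:R * (x - t a).
  by move=> an; rewrite phiB phiM phi_nat phi_zt// -hx; ring.
have KE' a : (a <= n + k)%N -> phi (Z.of_nat k * zt k a - X)%BZ = k%:R * (t a - x).
  by move=> an; rewrite phiB phiM phi_nat phi_zt// -hx; ring.
have [u0 u1] : 0 <= phi (nth 0%BZ (0%BZ :: zrow k M X r p) i) /\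
    phi (nth 0%BZ (0%BZ :: zrow k M X r p) i) <= phi M * bs t r p j x.
  rewrite /j; case: (i) => [|i']; first by split.
  have := IH i' (ltnW pk); have -> // : (r - p.+1 + i'.+1 = r - p + i')%N by nlia.
have [v0 v1] := IH i (ltnW pk).
have ej : (r - p + i = j.+1)%N by rewrite /j; nlia.
rewrite ej in v1.
move: u0 u1; move: (nth 0%BZ (0%BZ :: zrow k M X r p) i) => u u0 u1.
move: v0 v1; move: (nth 0%BZ (zrow k M X r p) i) => v v0 v1.
have jp : (j <= j + p.+1)%N by rewrite leq_addr.
have jp' : (j.+1 <= (j + p.+1).+1)%N by rewrite ltnS leq_addr.
have a1 : (0 <= (X - Z.of_nat k * zt k j) * u)%BZ.
  apply: phi_ge0; rewrite phiM KE; last by nlia.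
  by rewrite mulr_ge0// mulr_ge0// ltW.
have a2 : (0 <= (Z.of_nat k * zt k (j + p.+1).+1%N - X) * v)%BZ.
  apply: phi_ge0; rewrite phiM KE'; last by nlia.
  by rewrite mulr_ge0// mulr_ge0// ltW.
have [l0 l1] := phi_div a1 (zt_den jp).
have [r0 r1] := phi_div a2 (zt_den jp').
rewrite phiD; split; first by rewrite addr_ge0.
apply: le_trans (lerD l1 r1) _; rewrite bsS mulrDr lerD//.
  rewrite !phiM KE ?phiB ?phi_zt ?phi_nat; [|nlia..].
  rewrite -[k%:R * _ * _]mulrA -mulf_div divff ?gt_eqF// mul1r.
  rewrite [leRHS]mulrCA [leLHS]mulrAC ler_wpM2l// divr_ge0// subr_ge0 th//; nlia.
rewrite !phiM KE' ?phiB ?phi_zt ?phi_nat; [|nlia..].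
rewrite -[k%:R * _ * _]mulrA -mulf_div divff ?gt_eqF// mul1r.
rewrite [leRHS]mulrCA [leLHS]mulrAC ler_wpM2l// divr_ge0// subr_ge0 th//; nlia.
Qed.

Lemma spl_window p (c : nat -> R) r x : (p <= k)%N -> (p <= r < N)%N ->
  \sum_(j < N) c j * bs t r p j x = \sum_(i < p.+1) c (r - p + i)%N * bs t r p (r - p + i) x.
Proof.
move=> pk /andP[pr rN]; pose f j := c j * bs t r p j x.
have f0 j : (r < j)%N || (j + p < r)%N -> f j = 0.
  by move=> h; rewrite /f bs_out// mulr0.
rewrite -(big_mkord xpredT f) (@big_cat_nat _ _ _ (r - p)%N) //=; last by nlia.
rewrite [X in _ + X](@big_cat_nat _ _ _ r.+1) //=; last by nlia.
rewrite [X in X + _]big_nat big1 ?add0r => [|i hi]; last by apply: f0; nlia.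
rewrite [X in _ + X]big_nat [X in _ + X]big1 ?addr0 => [|i hi]; last by apply: f0; nlia.
rewrite -{1}[(r - p)%N]add0n big_addn (_ : (r.+1 - (r - p) = p.+1)%N); last by nlia.
by rewrite big_mkord; apply: eq_bigr => i _; rewrite /f addnC.
Qed.

Lemma Fh_window l r : (k <= r < N)%N -> t r <= xi l <= t r.+1 -> (r < k + n)%N ->
  k%:R * Fh l = \sum_(i < k.+1) Num.max (s1 t k l - s1 t k (r - k + i)) 0 *
     bs t r k (r - k + i) (xi l).
Proof.
move=> /andP[kr rN] hr rn; have k0 : 0 < k%:R :> R by rewrite ltr0n; nlia.
have e : Fh l = \sum_(j < N) hinge l j * bs t r k j (xi l).
  apply: eq_bigr => j _; congr (_ * _); have ek : k = k.-1.+1 by nlia.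
  rewrite [X in ubs _ _ X]ek [X in bs _ _ X]ek; apply: B_piece => //.
  by rewrite kr.
rewrite e spl_window ?kr// mulr_sumr; apply: eq_bigr => i _.
have m u v : k%:R * Num.max (u / k%:R - v / k%:R) 0 = Num.max (u - v) 0 :> R.
  have e2 : u - v = k%:R * (u / k%:R - v / k%:R) by field; rewrite gt_eqF.
  rewrite e2; case: (leP (u / k%:R - v / k%:R) 0) => h.
    by rewrite mulr0 (max_idPr _)// mulr_ge0_le0// ltW.
  by rewrite (max_idPl _)// mulr_ge0// ltW.
by rewrite mulrA /hinge m.
Qed.

Lemma row_val a b l M : (0 < l)%N -> (l <= k.*2)%N -> (0 < M)%BZ -> (0 < b)%BZ -> (0 <= a)%BZ ->
  zcheck k M a b l -> 1 <= phi a / phi b * (2 * (T l / (k%:R - 1)) * Fh l - vr l).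
Proof.
move=> l0 lk M0 b0 a0; rewrite /zcheck; set r := (k + _)%N.
case/and4P => /Z.leb_le h1 /Z.leb_le h2 h3 /Z.leb_le h4.
have k0 : 0 < k%:R :> R by rewrite ltr0n; nlia.
have k1 : 0 < k%:R - 1 :> R by rewrite subr_gt0 ltr1n; nlia.
have rk : (k <= r)%N by exact: leq_addr.
have ln : (l <= n)%N by nlia.
have hx : k%:R * xi l = phi (zs1 k l) by rewrite phi_zs1// /greville mulrC divfK// gt_eqF.
have hr : t r <= xi l <= t r.+1.
  move: h1 h2 => /phi_le h1 /phi_le h2; move: h1 h2.
  rewrite !phiM -hx !phi_zt ?phi_nat; [|nlia..].
  by rewrite !ler_pM2l// => -> ->.
have M1 : 0 < phi M by apply: lt_le_trans (@phi_le 1 M _); [exact: ltr01|lia].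
have b1 : 0 < phi b by apply: lt_le_trans (@phi_le 1 b _); [exact: ltr01|lia].
have a1 : 0 <= phi a by exact: (@phi_le 0%BZ).
have HF : phi (zF k M r l) <= phi M * (k%:R * Fh l).
  rewrite (@Fh_window l r) ?rk//=; [|nlia..].
  rewrite phi_sum mulr_sumr; apply: ler_sum => i _.
  rewrite phiM phi_max phiB !phi_zs1; [|by move: (ltn_ord i); move: (nat_of_ord i) => j; nlia..].
  rewrite mulrCA ler_wpM2l ?le_max ?lexx ?orbT//.
  by have [] := @zrow_le M (zs1 k l) r k i (xi l) (ltac:(lia)) hx rk (ltac:(nlia)) hr (leqnn _).
have eT : phi (zT k l) = T l by rewrite phiB /kgap !phi_zt//; nlia.
have phi1 : phi 1 = 1 by [].
have phi2 : phi 2 = 2 by rewrite -[2%BZ]/(1 + 1)%BZ phiD phi1.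
have phi4 : phi 4 = 4 by rewrite -[4%BZ]/(2 + 2)%BZ phiD phi2; ring.
move: h4 => /phi_le.
rewrite !phiM [phi (Z.sub (Z.mul _ _) _)]phiB !phiM eT !phiB !phiM phi1 phi2 phi4 !phi_nat phi_zs1// phi_zs2//.
have -> : vr l = (k%:R * s2 t k l - s1 t k l * s1 t k l) / (2 * k%:R ^+ 2 * (k%:R - 1)).
  rewrite /qdefect /qcoef /greville; move: (s1 _ _ _) (s2 _ _ _) k0 k1; clear.
  by move: (k%:R : R) => x u v x0 x1; field; rewrite !gt_eqF.
have T0 : 0 <= T l by apply: ltW; apply: T_gt0' => //; nlia.
move: HF k0 k1 M1 b1 a1 T0; clear; move: (s1 _ _ _) (s2 _ _ _) (Fh l) (T l).
move: (phi (zF k M r l)) (phi M) (phi a) (phi b) (k%:R : R) => f m A q K u v F t HF K0 K1 m0 b0 A0 t0 H.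
have H2 : A * (4 * K * t * f) <= A * (4 * K * t * (m * (K * F))).
  by rewrite !ler_wpM2l// !mulr_ge0// ltW.
have H3 : 2 * K * K * (K - 1) * m * q <= (2 * K * K * (K - 1) * m * q) *
    (A / q * (2 * (t / (K - 1)) * F - (K * v - u * u) / (2 * K ^+ 2 * (K - 1)))).
  have -> : (2 * K * K * (K - 1) * m * q) *
    (A / q * (2 * (t / (K - 1)) * F - (K * v - u * u) / (2 * K ^+ 2 * (K - 1)))) =
    A * (4 * K * t * (m * (K * F))) - A * ((K * v - u * u) * m).
    by field; rewrite !gt_eqF.
  by move: H; rewrite mulrBr; lra.
rewrite -(ler_pM2l (_ : 0 < 2 * K * K * (K - 1) * m * q)) ?mulr1//.
by rewrite !mulr_gt0.
Qed.

Lemma t_shift j s : (k <= j)%N -> (j + s <= n + k)%N -> t (j + s)%N = t j + s%:R.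
Proof. by move=> kj jn; rewrite /uknot -natrD; congr _%:R; nlia. Qed.

Lemma s1_shift j s : (k <= j)%N -> (j + s <= n)%N ->
  s1 t k (j + s) = s1 t k j + k%:R * s%:R.
Proof.
move=> kj jn; rewrite /s1 mulr_natl -[k in _ *+ k]card_ord -sumr_const -big_split.
apply: eq_bigr => i _; rewrite addnAC t_shift//; have := ltn_ord i; move: (nat_of_ord i) => q; nlia.
Qed.

Lemma s2_shift j s : (k <= j)%N -> (j + s <= n)%N ->
  s2 t k (j + s) = s2 t k j + 2 * s%:R * s1 t k j + k%:R * s%:R ^+ 2.
Proof.
move=> kj jn; have -> : k%:R * s%:R ^+ 2 = \sum_(i < k) s%:R ^+ 2 :> R.
  by rewrite sumr_const card_ord mulr_natl.
rewrite /s2 /s1 mulr_sumr -!big_split /=.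
apply: eq_bigr => i _; rewrite addnAC t_shift//; first by ring.
  by have := ltn_ord i; move: (nat_of_ord i) => q; nlia.
by have := ltn_ord i; move: (nat_of_ord i) => q; nlia.
Qed.

(** [k <= xi l] puts the node in a piece of index at least [2 k], so every B-spline alive there has
    index at least [k] and sees equally spaced knots only. *)
Lemma val_shift l s : (k <= l)%N -> k%:R <= xi l -> (l + s + k < n)%N ->
  [/\ T (l + s) = T l, Fh (l + s) = Fh l & vr (l + s) = vr l].
Proof.
move=> kl xk ln; have k0 : 0 < k%:R :> R by rewrite ltr0n; nlia.
have k1 : 0 < k%:R - 1 :> R by rewrite subr_gt0 ltr1n; nlia.
have xS : xi (l + s) = xi l + s%:R.
  by rewrite /greville s1_shift//; [field; rewrite gt_eqF|nlia].
split.
- have e1 : (l + s + k = l + k + s)%N by nlia.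
  rewrite /kgap e1 -addSn !t_shift; [ring|nlia..].
- have hx : 0 <= xi l <= n%:R.
    by apply: (@xi_itv R n k n0 k3); nlia.
  have xl : xi l <= l%:R.
    rewrite /greville ler_pdivrMr// mulrC.
    have k5' : (0 < k)%N by nlia.
    rewrite mulr_natl -[k in _ *+ k]card_ord -sumr_const /s1.
    apply: ler_sum => i _; rewrite /uknot ler_nat; have := ltn_ord i; move: (nat_of_ord i) => q; nlia.
  have [r [hr r1 r2]] : exists r, [/\ t r <= xi l <= t r.+1, (k + k <= r)%N & (r <= k + l)%N].
    exists (pc n k (xi l)); split; first exact: tt_pc.
      rewrite /pc leq_add2l leq_min; apply/andP; split; last by nlia.
      by rewrite truncn_ge_nat// (le_trans _ xk).
    rewrite /pc leq_add2l geq_min; apply/orP; left.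
    by rewrite -ltnS truncn_lt_nat ?(le_lt_trans xl) ?ltr_nat//; case/andP: hx.
  have hr' : t (r + s) <= xi (l + s) <= t (r + s).+1.
    rewrite xS -addSn (@t_shift r s) ?(@t_shift r.+1 s); [|nlia..].
    by move: hr; rewrite !lerD2r.
  apply: (mulfI (lt0r_neq0 k0)); rewrite (@Fh_window _ (r + s)) //; [|nlia..].
  rewrite (@Fh_window l r) //; [|nlia..].
  apply: eq_bigr => i _; have e : (r + s - k + i = (r - k + i) + s)%N by nlia.
  rewrite e xS !s1_shift; [|by move: (ltn_ord i); move: (nat_of_ord i) => q; nlia..].
  congr (Num.max _ 0 * _); first by ring.
  apply: bs_shift => u hu; apply: t_shift; first by nlia.
  by move: (ltn_ord i) hu; move: (nat_of_ord i) => q; nlia.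
- rewrite /qdefect xS /qcoef s1_shift ?s2_shift//; [|nlia..].
  rewrite /greville; move: (s1 _ _ _) (s2 _ _ _) (s%:R) k0 k1; clear.
  by move: (k%:R : R) => x u v w x0 x1; field; rewrite !gt_eqF.
Qed.

Lemma xi_interior_ge : k%:R <= xi (k.*2 - k./2)%N.
Proof.
have k0 : 0 < k%:R :> R by rewrite ltr0n; nlia.
rewrite /greville ler_pdivlMr// -natrM.
have -> : s1 t k (k.*2 - k./2) = (\sum_(i < k) (k - k./2 + i.+1))%:R.
  rewrite /s1 natr_sum; apply: eq_bigr => i _; rewrite /uknot; congr _%:R.
  by move: (ltn_ord i); move: (nat_of_ord i) => q; nlia.
rewrite ler_nat.
have e m a : ((\sum_(i < m) (a + i.+1)).*2 = (m * a).*2 + m * m.+1)%N.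
  by elim: m => [|m IH]; rewrite ?big_ord0// big_ord_recr /= doubleD IH; nlia.
by rewrite -leq_double e; nlia.
Qed.

Lemma rows_bound a b : row_const k = (a, b) -> (k <= 20)%N ->
  forall l, (0 < l)%N -> (l.+1 < N)%N ->
  1 <= phi a / phi b * (2 * (T l / (k%:R - 1)) * Fh l - vr l).
Proof.
move=> eab k20.
have ab : (0 < b)%BZ /\ (0 <= a)%BZ.
  have p m : (0 < 2 ^ Z.of_nat m)%BZ by apply: Z.pow_pos_nonneg; lia.
  by move: eab (p k.+1); case: (k) => [|[|[|[|[|[|m]]]]]] [<- <-]; lia.
have ok : row_ok k by apply: (allP rows_ok); rewrite mem_iota; nlia.
have H l : (0 < l)%N -> (l <= k.*2 - k./2)%N ->
    1 <= phi a / phi b * (2 * (T l / (k%:R - 1)) * Fh l - vr l).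
  move=> l0 lk; have [b0 a0] := ab; apply: (row_val l0 _ _ b0 a0 _); [nlia| |].
    exact: (ltac:(lia) : (0 < 2 ^ 36)%BZ).
  move: ok; rewrite /row_ok eab => /allP; apply; rewrite mem_iota; nlia.
have H2 l : (0 < l)%N -> (l.*2 <= N)%N ->
    1 <= phi a / phi b * (2 * (T l / (k%:R - 1)) * Fh l - vr l).
  move=> l0 lN; have [/H|lk] := leqP l (k.*2 - k./2); first exact.
  have e : l = (k.*2 - k./2 + (l - (k.*2 - k./2)))%N by nlia.
  rewrite e; have [|||-> -> ->] := @val_shift (k.*2 - k./2) (l - (k.*2 - k./2)).
  - by nlia.
  - exact: xi_interior_ge.
  - by nlia.
  - by apply: H; nlia.
move=> l l0 lN; have [/H2|h] := leqP l.*2 N; first exact.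
have ll' : ((N - l.+1) + l).+1 = N by nlia.
rewrite (Fh_refl R n0 k3 ll') (T_refl R n0 k3 ll') (vr_refl R n0 k3 ll').
by apply: H2; nlia.
Qed.

Lemma phi_pow2 m : phi (2 ^ Z.of_nat m)%BZ = 2 ^+ m.
Proof.
elim: m => [|m IH]; first by rewrite expr0.
rewrite Nat2Z.inj_succ Z.pow_succ_r ?phiM ?IH ?exprS; last by lia.
by rewrite -[2%BZ]/(Z.of_nat 2) phi_nat.
Qed.

(** At 21 the two sides are about 3.81 and 4.19 million; afterwards the left side grows by at most
    [(22/21)^4 < 2] per degree. *)
Lemma pow2_quartic m : (21 <= m)%N ->
  44 / 9 * m%:R ^+ 2 * (1 + 4 * m%:R ^+ 2) <= 2 ^+ m.+1 :> R.
Proof.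
move=> hm; rewrite -(subnKC hm); move: (m - 21)%N => {hm}m; elim: m => [|m IH].
  have e11 : 2 ^+ 11 = 2048 :> R by ring.
  rewrite addn0 (exprM 2 11 2) e11; lra.
rewrite addnS [X in _ <= X]exprS; move: IH; rewrite -(natr1 (21 + m)).
have : 21 <= (21 + m)%:R :> R by rewrite ler_nat leq_addr.
move: (2 ^+ _) ((21 + m)%:R : R) => P x x21 IH.
have h1 : (x + 1) ^+ 2 <= (22 / 21) ^+ 2 * x ^+ 2.
  by rewrite -exprMn lerXn2r ?nnegrE; lra.
have x2 : 0 <= x ^+ 2 by exact: sqr_ge0.
have y2 : 0 <= (x + 1) ^+ 2 by exact: sqr_ge0.
have h2 := ler_pM y2 y2 h1 h1; have z2 := mulr_ge0 x2 x2.
by apply: (@le_trans _ _ (2 * (44 / 9 * x ^+ 2 * (1 + 4 * x ^+ 2)))); lra.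
Qed.

Definition threshold : R :=
  match k with 3%N => 24 | 4%N => 140 / 3 | 5%N => 84 | _ => 2 ^+ k.+1 end.

Lemma ac_bound c G P : (forall j, (j < N)%N -> `|c j - S c (xi j)| <= G) ->
  threshold <= P -> forall l, (0 < l)%N -> (l.+1 < N)%N -> `|ccurv n k c l| <= P * G.
Proof.
move=> hG hP l l0 lN; have G0 : 0 <= G by apply: le_trans (hG 0%N _); [exact: normr_ge0|nlia].
apply: (@le_trans _ _ (threshold * G)); last by rewrite ler_wpM2r.
have [k20|k20] := leqP k 20; last first.
  have k5 : (5 <= k)%N by nlia.
  have kn2 : (2 * k < n)%N by nlia.
  apply: le_trans (ac_bound_weights n0 k5 kn2 hG l0 lN) _; rewrite ler_wpM2r//.
  have -> : threshold = 2 ^+ k.+1.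
    by rewrite /threshold; case: (k) k20 => [|[|[|[|[|[|k']]]]]].
  exact: pow2_quartic.
case e : (row_const k) => [a b].
have E : phi a / phi b = threshold.
  move: e; rewrite /threshold; have := phi_pow2 k.+1.
  case: (k) => [|[|[|[|[|[|m]]]]]] p [<- <-]; rewrite ?p ?divr1//.
apply: (@ac_bound_dd R n k n0 k3 c G threshold) => //.
- by rewrite /threshold; case: (k) => [|[|[|[|[|[|m]]]]]]; rewrite ?exprn_gt0//; lra.
- by move=> i i0 iN; rewrite -E; apply: rows_bound.
- by move=> i i0 iN; apply: hG; nlia.
Qed.

End RowTransfer.

(** * Divided differences *)

Section DividedDifference.
Variable R : realType.
Implicit Types (f g : R -> R) (u : nat -> R) (x y z : R).

(** Differs from [truncpow] at exponent 0, where it is a step function; the induction on the degree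
    starts there. *)
Definition tpow p y z : R := if y < z then (z - y) ^+ p else 0.

Lemma truncpowE p y : truncpow p.+1 y = tpow p.+1 y.
Proof.
apply/funext => z; rewrite /truncpow /tpow; case: ltP => h.
  by rewrite (max_idPl _)// subr_ge0 ltW.
by rewrite (max_idPr _) ?expr0n// subr_le0.
Qed.

Lemma tpowS p y z : tpow p.+1 y z = (z - y) * tpow p y z.
Proof. by rewrite /tpow; case: ltP => h; rewrite ?exprS ?mulr0. Qed.

Lemma derive1_local f (P : {poly R}) z r : 0 < r ->
  (forall w, `|w - z| < r -> f w = P.[w]) -> derive1 f z = P^`().[z].
Proof.
move=> r0 h; have dP := is_derive_poly P z.
have df : is_derive z 1 f P^`().[z].
  apply/is_deriveP => e e0; move/is_deriveP: dP => /(_ e e0) [r' r'0 hr].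
  exists (Num.min r r'); first by rewrite lt_min r0.
  move=> w; rewrite lt_min => /andP[w1 w2].
  by rewrite !h ?subrr ?normr0//; apply: hr.
by rewrite derive1E derive_val.
Qed.

Lemma derive1n_tpow p y m z : y != z ->
  derive1n m (tpow p y) z = if y < z then (('X - y%:P) ^+ p)^`(m).[z] else 0.
Proof.
elim: m z => [|m IH] z yz.
  rewrite derive1n0 derivn0 /tpow horner_exp hornerXsubC//.
pose P := if y < z then (('X - y%:P) ^+ p)^`(m) else 0 : {poly R}.
have zy0 : 0 < `|z - y| by rewrite normr_gt0 subr_eq0 eq_sym.
rewrite derive1nS (@derive1_local _ P z `|z - y|)//.
  by rewrite /P derivnS; case: ifP => // _; rewrite deriv0 horner0.
move=> w wz; rewrite IH /P.
  suff -> : (y < w) = (y < z) by case: ifP => // _; rewrite horner0.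
  move: wz yz zy0; have [h|h|->] := ltgtP y z; last by [].
    by rewrite (gtr0_norm (_ : 0 < z - y)) ?subr_gt0// ltr_norml => /andP[h1 _] _ _; lra.
  by rewrite (ltr0_norm (_ : z - y < 0)) ?subr_lt0// ltr_norml => /andP[_ h1] _ _; apply/negbTE; rewrite -leNgt; lra.
by apply: contraTneq wz => ->; rewrite -leNgt distrC.
Qed.

Lemma derivn_XsubC_mul (Q : {poly R}) y m :
  (('X - y%:P) * Q)^`(m.+1) = ('X - y%:P) * Q^`(m.+1) + Q^`(m) *+ m.+1.
Proof.
elim: m => [|m IH].
  by rewrite derivn1 derivM derivXsubC mul1r derivn1 derivn0 mulr1n addrC.
rewrite derivnS IH derivD derivM derivXsubC mul1r derivMn -!derivnS.
by rewrite [Q^`(m.+1) + _]addrC -addrA -mulrS.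
Qed.

Lemma derive1n_tpowS p y m z : y != z ->
  derive1n m.+1 (tpow p.+1 y) z =
  (z - y) * derive1n m.+1 (tpow p y) z + derive1n m (tpow p y) z *+ m.+1.
Proof.
move=> yz; rewrite !derive1n_tpow//; case: ifP => _; last by rewrite mulr0 mul0rn addr0.
by rewrite exprS derivn_XsubC_mul hornerD hornerM hornerXsubC hornerMn.
Qed.

Lemma divdiffS f u m : divdiff f u m.+1 =
  if u 0%N == u m.+1 then derive1n m.+1 f (u 0%N) / m.+1`!%:R
  else (divdiff f (u \o S) m - divdiff f u m) / (u m.+1 - u 0%N).
Proof. by []. Qed.

Lemma eq_divdiff f u v m : (forall i, (i <= m)%N -> u i = v i) ->
  divdiff f u m = divdiff f v m.
Proof.
elim: m u v => [|m IH] u v h /=; first by rewrite h.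
rewrite !h//; case: ifP => // _; congr ((_ - _) / _).
  by apply: IH => i im; apply: h.
by apply: IH => i im; apply: h; apply: leqW.
Qed.

Lemma divdiff_const f u m a : (forall i, (i <= m)%N -> u i = a) ->
  divdiff f u m = derive1n m f a / m`!%:R.
Proof.
by case: m => [|m] h /=; rewrite !h// ?derive1n0 ?divr1// eqxx.
Qed.

(* Leibniz rule for the factor [z - y], once for either end knot. *)
Lemma divdiff_tpowS p y u m : {homo u : i j / (i <= j)%N >-> i <= j} ->
  (forall i, y != u i) ->
  divdiff (tpow p.+1 y) u m.+1 =
    (u m.+1 - y) * divdiff (tpow p y) u m.+1 + divdiff (tpow p y) u m /\
  divdiff (tpow p.+1 y) u m.+1 =
    (u 0%N - y) * divdiff (tpow p y) u m.+1 + divdiff (tpow p y) (u \o S) m.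
Proof.
elim: m u => [|m IH] u hu yu.
  rewrite !divdiffS; have [e|ne] := eqVneq (u 0%N) (u 1%N).
    rewrite -e !divr1 derive1n_tpowS// derive1n0 mulr1n /= -e.
    by split.
  have d : u 1%N - u 0%N != 0 by rewrite subr_eq0 eq_sym.
  by rewrite /= !tpowS; split; field.
have [e|ne] := eqVneq (u 0%N) (u m.+2).
  have cu i : (i <= m.+2)%N -> u i = u 0%N.
    by move=> im; apply/eqP; rewrite eq_le {1}e !hu.
  have E : divdiff (tpow p y) u m.+1 = divdiff (tpow p y) (u \o S) m.+1.
    rewrite (@divdiff_const _ _ _ (u 0%N)); last by move=> i im; apply: cu; apply: leqW.
    by rewrite (@divdiff_const _ _ _ (u 0%N))// => i im; apply: cu.
  rewrite -E -e; suff H : divdiff (tpow p.+1 y) u m.+2 =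
    (u 0%N - y) * divdiff (tpow p y) u m.+2 + divdiff (tpow p y) u m.+1 by [].
  rewrite !(@divdiff_const _ _ _ (u 0%N)) ?derive1n_tpowS//; last first.
    by move=> i im; apply: cu; apply: leqW.
  rewrite mulrDl mulrA; congr (_ + _); rewrite factS natrM.
  have f0 : (m.+1)`!%:R != 0 :> R by rewrite pnatr_eq0 -lt0n fact_gt0.
  rewrite -[X in X / _]mulr_natr; move: (derive1n _ _ _) => w.
  have m0 : m.+2%:R != 0 :> R by rewrite pnatr_eq0.
  move: (m.+2%:R : R) ((m.+1)`!%:R : R) m0 f0 => a b a0 b0.
  by field; rewrite a0 b0.
have uS : {homo (u \o S) : i j / (i <= j)%N >-> i <= j} by move=> i j ij; apply: hu.
have [h1 _] := IH (u \o S) uS (fun i => yu i.+1).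
have [_ h2] := IH u hu yu.
have d : u m.+2 - u 0%N != 0 by rewrite subr_eq0 eq_sym.
have unf f : divdiff f u m.+2 = (divdiff f (u \o S) m.+1 - divdiff f u m.+1) / (u m.+2 - u 0%N).
  by rewrite divdiffS (negPf ne).
rewrite !unf h1 h2 /=; split; by field.
Qed.

Variable t : nat -> R.
Hypothesis t_homo : {homo t : i j / (i <= j)%N >-> i <= j}.

(** Both forms of the Leibniz rule, inserted in the two terms of the divided difference, give the
    Cox-de Boor recursion. If all its knots coincide, a divided difference of order [p.+1] of a
    [p]-th power vanishes. *)
Lemma divdiff_bs p j r y : t r < y < t r.+1 -> (forall i, y != t i) ->
  (t (j + p.+1)%N - t j) * divdiff (tpow p y) (fun i => t (j + i)%N) p.+1 = bs t r p j y.
Proof.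
move=> hr yt; elim: p j => [|p IH] j.
  rewrite addn1 /= addn0 addn1 /bs; have [e|ne] := eqVneq (t j) (t j.+1).
    rewrite -e subrr mul0r; case: eqP => // ej; move: hr.
    by rewrite -ej -e => /andP[a b]; have := lt_trans a b; rewrite ltxx.
  rewrite mulrC divfK ?subr_eq0 1?eq_sym// /tpow !expr0.
  case/andP: hr => r1 r2; have [e|jr|rj] := ltngtP j r; last 1 first.
  - by rewrite rj r2 ltNge (ltW r1) subr0.
  - have h : t j.+1 < y by apply: le_lt_trans r1; apply: t_homo.
    by rewrite !ltNge (ltW h) (le_trans (t_homo _) (ltW h))// subrr.
  - have h : y < t j by apply: lt_le_trans r2 _; apply: t_homo.
    by rewrite h (lt_le_trans h)// ?subrr// t_homo.
have us : {homo (fun i => t (j + i)%N) : a b / (a <= b)%N >-> a <= b}.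
  by move=> a b ab; apply: t_homo; rewrite leq_add2l.
pose v i := t (j.+1 + i)%N.
have vs : {homo v : a b / (a <= b)%N >-> a <= b}.
  by move=> a b ab; apply: t_homo; rewrite leq_add2l.
have [_ h2] := divdiff_tpowS p p us (fun i => yt (j + i)%N).
have [h1 _] := divdiff_tpowS p p vs (fun i => yt (j.+1 + i)%N).
have ve : (fun i => t (j + i)%N) \o S = v by apply/funext => i; rewrite /v /= addnS.
have z0 a : t (a + p.+1)%N = t a -> divdiff (tpow p y) (fun i => t (a + i)%N) p.+1 = 0.
  move=> ea; rewrite (@divdiff_const _ _ _ (t a)); last first.
    move=> i ip; apply/eqP; rewrite eq_le -{1}ea !t_homo ?leq_addr//.
    by rewrite leq_add2l.
  rewrite derive1n_tpow//; case: ifP; rewrite ?mul0r// => _.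
  by rewrite derivn_poly0 ?horner0 ?mul0r// size_exp_XsubC.
have Q a : divdiff (tpow p y) (fun i => t (a + i)%N) p.+1 = bs t r p a y / (t (a + p.+1)%N - t a).
  have [e|ne] := eqVneq (t (a + p.+1)%N) (t a); first by rewrite z0// e subrr invr0 mulr0.
  by rewrite -IH mulrAC divff ?mul1r// subr_eq0.
have [e|ne] := eqVneq (t j) (t (j + p.+2)%N).
  have e1 : t (j + p.+1)%N = t j.
    by apply/eqP; rewrite eq_le {1}e !t_homo ?leq_addr// leq_add2l.
  have e2 : t j.+1 = t j.
    by apply/eqP; rewrite eq_le {1}e !t_homo ?leqnSn// -addn1 leq_add2l.
  by rewrite bsS -e subrr mul0r e1 subrr invr0 mulr0 mul0r add0r -addnS -e e2 subrr invr0 mulr0 mul0r.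
have -> : divdiff (tpow p.+1 y) (fun i => t (j + i)%N) p.+2 =
  (divdiff (tpow p.+1 y) v p.+1 - divdiff (tpow p.+1 y) (fun i => t (j + i)%N) p.+1) / (t (j + p.+2)%N - t j).
  by rewrite divdiffS addn0 (negPf ne) -ve.
rewrite mulrC divfK ?subr_eq0 1?eq_sym// h1 h2 ve Q /v (Q j.+1) addn0.
rewrite bsS -addnS !addSn !addnS.
by move: (divdiff _ _ p) (_^-1) (_^-1) => *; ring.
Qed.

End DividedDifference.

(** * The given operator in scaled form *)

Section Schoenberg.
Variables (R : realType) (n k : nat).
Hypotheses (n0 : (0 < n)%N) (k2 : (2 <= k)%N).
Local Notation N := (n + k)%N.
Local Notation t := (uknot R n k).
Local Notation xi := (greville R n k).
Local Notation S := (bsum n k k).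
Local Notation B := (ubs n k).
Implicit Types (c : int -> R) (x y z : R) (l : nat).

Local Notation ix l := (l%:Z - k%:Z).

Let nR : 0 < n%:R :> R. Proof. by rewrite ltr0n. Qed.

Lemma knotE i : knot R n (ix i) = t i / n%:R.
Proof.
rewrite /knot subr_le0 lez_nat /uknot; case: leqP => [ik|ki].
  by rewrite (_ : minn (i - k) n = 0%N) ?mul0r//; nlia.
have -> : ix i = (i - k)%:Z by nlia.
rewrite lez_nat; case: leqP => [ni|ni].
  by rewrite divff// gt_eqF.
by [].
Qed.

Lemma nodeE l : node R n k (ix l) = xi l / n%:R.
Proof.
rewrite /node /greville -mulrA [_^-1 * _]mulrC mulrA; congr (_ / _).
rewrite /s1 mulr_suml big_add1 /= big_mkord; apply: eq_bigr => i _.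
have -> : ix l + i.+1%:Z = ix (l + i.+1)%N by move: (nat_of_ord i) => j; nlia.
exact: knotE.
Qed.

Lemma raw_B l r y : (k <= r < k + n)%N -> t r < n%:R * y < t r.+1 ->
  bspline_raw n k (ix l) y = B k l (n%:R * y).
Proof.
move=> hrn hr; have th := @tt_homo R n k n0.
pose t' i := t i / n%:R.
have t'h : {homo t' : i j / (i <= j)%N >-> i <= j}.
  by move=> i j ij; rewrite ler_pM2r ?invr_gt0// th.
have tE i : t i = n%:R * t' i by rewrite mulrC divfK// gt_eqF.
have hr' : t' r < y < t' r.+1 by move: hr; rewrite !tE !ltr_pM2l.
have yt i : y != t' i.
  case/andP: hr' => h1 h2; have [ir|ri] := leqP i r.
    by rewrite gt_eqF// (le_lt_trans (t'h _ _ ir)).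
  by rewrite lt_eqF// (lt_le_trans h2)// t'h.
have kk : k = k.-1.+1 by nlia.
have e i : ix l + i%:Z = ix (l + i)%N by nlia.
rewrite /bspline_raw e !knotE (@eq_divdiff _ _ _ (fun i => t' (l + i)%N)); last first.
  by move=> i _; rewrite e knotE.
rewrite [X in truncpow X]kk truncpowE -kk (divdiff_bs t'h k l hr' yt).
have <- : bs t r k l (n%:R * y) = bs t' r k l y by apply: bs_scale; rewrite ?gt_eqF.
rewrite [X in B X]kk (@B_piece R n k n0 r k.-1 l (n%:R * y))// -?kk//.
by case/andP: hr => h1 h2; rewrite !ltW.
Qed.

Lemma B_cvg l x : B k l (n%:R * y) @[y --> x] --> B k l (n%:R * x).
Proof.
have -> : k = k.-2.+2 by nlia.
have d := @is_derive_B R n k.-2.+2 n0 k.-2 l (0 + n%:R * x).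
have := is_derive_cvg (is_derive_affine d); rewrite add0r.
by under eq_fun do rewrite add0r.
Qed.

(** On the open piece next to [x] the raw formula is the continuous function [B], so the one-sided
    limit is its value. *)
Lemma bspline_B l x : 0 <= x <= 1 -> bspline n k (ix l) x = B k l (n%:R * x).
Proof.
move=> /andP[x0 x1]; rewrite /bspline; case: ltP => [xlt|xge].
  apply/cvg_lim => //.
  have nx0 : 0 <= n%:R * x by rewrite mulr_ge0// ltW.
  have [q /andP[q1 q2]] : exists q : nat, q%:R <= n%:R * x < q.+1%:R.
    by exists (Num.truncn (n%:R * x)); exact: truncn_itv.
  have qn : (q < n)%N.
    rewrite -(ltr_nat R); apply: le_lt_trans q1 _.
    by rewrite -[ltRHS]mulr1 ltr_pM2l.
  apply: cvg_trans (cvg_at_right_filter (@B_cvg l x)); apply: near_eq_cvg.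
  near=> y; apply/esym; apply: (@raw_B l (k + q)); first by nlia.
  have xy : x < y by near: y; exact: nbhs_right_gt.
  rewrite -addnS !tt_mid//; last exact: ltnW.
  rewrite (le_lt_trans q1) ?ltr_pM2l//= mulrC -ltr_pdivlMr//.
  near: y; apply: nbhs_right_lt; rewrite ltr_pdivlMr// mulrC//.
have -> : x = 1 by apply/eqP; rewrite eq_le x1.
apply/cvg_lim => //; apply: cvg_trans (cvg_at_left_filter (@B_cvg l 1)); apply: near_eq_cvg.
near=> y; apply/esym; apply: (@raw_B l (k + n.-1)); first by nlia.
have yl : y < 1 by near: y; exact: nbhs_left_lt.
rewrite -addnS (ltn_predK n0) !tt_mid ?leq_pred//.
rewrite -[X in _ && (_ < X)]mulr1 ltr_pM2l// yl andbT mulrC -ltr_pdivrMr//.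
near: y; apply: nbhs_left_gt; rewrite ltr_pdivrMr// mul1r ltr_nat; nlia.
Unshelve. all: by end_near. Qed.

Lemma sum_bindex (F : int -> R) : \sum_(j <- bindex n k) F j = \sum_(l < N) F (ix l).
Proof.
by rewrite /bindex big_map -(big_mkord xpredT (fun l => F (ix l))) /index_iota subn0.
Qed.

Lemma splineE c x : 0 <= x <= 1 -> spline n k c x = S (fun l => c (ix l)) (n%:R * x).
Proof. by move=> hx; rewrite /spline sum_bindex; apply: eq_bigr => l _; rewrite bspline_B. Qed.

Lemma S_cvg (c : nat -> R) x : S c (n%:R * y) @[y --> x] --> S c (n%:R * x).
Proof.
suff H p : p.+2 = k -> bsum n k p.+2 c (n%:R * y) @[y --> x] --> bsum n k p.+2 c (n%:R * x).
  by have := H k.-2; have -> : k.-2.+2 = k; [nlia|exact].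
move=> pk; have d := @is_derive_spl R n k n0 p c (0 + n%:R * x) (eq_leq pk).
have := is_derive_cvg (is_derive_affine d); rewrite add0r.
by under eq_fun do rewrite add0r.
Qed.

Lemma schoenbergE f x : 0 <= x <= 1 ->
  schoenberg n k f x = S (fun l => f (xi l / n%:R)) (n%:R * x).
Proof.
move=> hx; have E y : 0 <= y <= 1 ->
    spline n k (fun j => f (node R n k j)) y = S (fun l => f (xi l / n%:R)) (n%:R * y).
  by move=> hy; rewrite splineE//; apply: eq_spl => l _; rewrite nodeE.
rewrite /schoenberg; case: ltP => [_|x1]; first exact: E.
have -> : x = 1 by apply/eqP; rewrite eq_le x1 andbT; case/andP: hx.
apply/cvg_lim => //; apply: cvg_trans (cvg_at_left_filter (@S_cvg _ 1)); apply: near_eq_cvg.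
near=> y; apply/esym; apply: E; apply/andP; split; apply: ltW.
  by near: y; apply: nbhs_left_gt.
by near: y; exact: nbhs_left_lt.
Unshelve. all: by end_near. Qed.

End Schoenberg.

(** Continuity supplies the bound without which [sup] would be a default value. *)
Lemma supnorm_ge (R : realType) (g : R -> R) x :
  {within `[0, 1], continuous g} -> 0 <= x <= 1 -> `|g x| <= supnorm g.
Proof.
move=> cg hx; have cn : {within `[0, 1], continuous (fun y => `|g y|)}.
  by move=> y; exact: (cvg_norm (cg y)).
have [c _ hc] := EVT_max ler01 cn.
apply: ub_le_sup; last by exists x => //; rewrite /= in_itv.
by exists `|g c| => _ [y hy <-]; apply: hc; move: hy; rewrite /= !in_itv.
Qed.

Lemma supnorm_le (R : realType) (g : R -> R) M :
  (forall x, 0 <= x <= 1 -> `|g x| <= M) -> supnorm g <= M.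
Proof.
move=> h; apply: ge_sup; first by exists `|g 0|, 0 => //; rewrite /= in_itv /= lexx ler01.
by move=> _ [x hx <-]; apply: h; move: hx; rewrite /= in_itv.
Qed.

(** * The modulus of smoothness *)

Section Omega.
Variables (R : realType) (n k : nat).
Hypotheses (k3 : (3 <= k)%N) (kn : (4 * k + 4 <= n)%N).

Let n0 : (0 < n)%N. Proof. by nlia. Qed.
Let k2 : (2 <= k)%N. Proof. by nlia. Qed.

Lemma omega2_le (f : R -> R) (P : R) : {within `[0, 1], continuous f} -> 1 <= P -> threshold R k <= P ->
  omega2 f (n%:R^-1 / Num.sqrt P) <= 5 * supnorm (fun x => f x - schoenberg n k f x).
Proof.
move=> cf P1 hP; set G := supnorm _.
pose c l := f (greville R n k l / n%:R); pose S y := bsum n k k c (n%:R * y).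
have nR : 0 < n%:R :> R by rewrite ltr0n.
have gS x : 0 <= x <= 1 -> `|f x - S x| <= G.
  move=> hx.
  have -> : G = supnorm (fun y => f y - S y).
    congr sup; apply/seteqP; split=> _ [y hy <-]; exists y => //; move: hy; rewrite /= in_itv /= => hy;
      by rewrite (schoenbergE n0 k2).
  apply: (@supnorm_ge R (fun y => f y - S y)) => // y.
  have cS : {within `[0, 1], continuous S}.
    by apply: continuous_subspaceT => z; apply: S_cvg.
  exact: (cvgB (cf y) (cS y)).
have xi01 l : (l < n + k)%N -> 0 <= greville R n k l / n%:R <= 1.
  move=> lN; have /andP[h1 h2] := @xi_itv R n k n0 k3 l lN.
  by rewrite divr_ge0//= ler_pdivrMr// mul1r.
have hc l : (l < n + k)%N -> `|c l - bsum n k k c (greville R n k l)| <= G.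
  move=> lN; have := gS _ (xi01 l lN).
  have e : n%:R * (greville R n k l / n%:R) = greville R n k l by rewrite mulrC divfK// gt_eqF.
  by rewrite /S e.
have hA := ac_bound n0 k3 kn hc hP.
have G0 : 0 <= G by apply: le_trans (gS 0 _); rewrite ?lexx ?ler01.
have P0 : 0 < P by rewrite (lt_le_trans ltr01).
have sP : 0 < Num.sqrt P by rewrite sqrtr_gt0.
have d0 : 0 < n%:R^-1 / Num.sqrt P :> R by rewrite divr_gt0 ?invr_gt0.
have key eta x : 0 < eta -> eta < n%:R^-1 / Num.sqrt P -> 0 <= x -> x <= 1 - 2 * eta ->
    `|f x - 2 * f (x + eta) + f (x + 2 * eta)| <= 5 * G.
  move=> e0 ed x0 x1.
  have ne2 : n%:R * (2 * eta) = 2 * (n%:R * eta) by ring.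
  have xn : n%:R * x + 2 * (n%:R * eta) <= n%:R.
    by rewrite -ne2 -mulrDr -[leRHS]mulr1 ler_pM2l//; lra.
  have := S_second n0 k3 hA (mulr_ge0 (ltW nR) x0) (mulr_ge0 (ltW nR) (ltW e0)) xn.
  rewrite -ne2 -!mulrDr -/(S x) -/(S (x + eta)) -/(S (x + 2 * eta)) => H.
  have ne : n%:R * eta <= (Num.sqrt P)^-1.
    by rewrite mulrC -ler_pdivlMr// mulrC ltW.
  have H2 : P * G * (n%:R * eta) ^+ 2 <= G.
    have h0 : 0 <= n%:R * eta by rewrite mulr_ge0 ?ltW.
    have h1 : (n%:R * eta) ^+ 2 <= P^-1.
      by rewrite -[P in P^-1](sqr_sqrtr (ltW P0)) -exprVn lerXn2r ?nnegrE ?invr_ge0 ?(ltW sP).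
    apply: (@le_trans _ _ (P * G * P^-1)); first by rewrite ler_wpM2l// mulr_ge0// ltW.
    by rewrite mulrAC divff ?mul1r// gt_eqF.
  have g1 := gS x (ltac:(lra)); have g2 := gS (x + eta) (ltac:(lra)).
  have g3 := gS (x + 2 * eta) (ltac:(lra)).
  move: g1 g2 g3 H H2; rewrite !ler_norml.
  by move=> /andP[a1 a2] /andP[b1 b2] /andP[c1 c2] /andP[q1 q2] H2; apply/andP; split; lra.
have s1 : 1 <= Num.sqrt P by have := ler_wsqrtr P1; rewrite sqrtr1.
have n2 : 2 <= n%:R :> R by rewrite ler_nat; nlia.
(* With [delta <= 1/2] the inner suprema are over nonempty sets, as [ge_sup] requires. *)
have dh : n%:R^-1 / Num.sqrt P <= 1/2 :> R.
  rewrite ler_pdivrMr//; have : n%:R^-1 <= 2^-1 :> R by rewrite lef_pV2 ?posrE.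
  by lra.
apply: ge_sup.
  have h2 : 0 < n%:R^-1 / Num.sqrt P / 2 :> R by rewrite divr_gt0.
  eexists; exists (n%:R^-1 / Num.sqrt P / 2) => //.
  rewrite /= in_itv /= h2 /=; move: d0; move: (_ / _) => u u0; lra.
move=> _ [eta he <-]; move: he; rewrite /= in_itv /= => /andP[e0 ed].
apply: ge_sup.
  by eexists; exists 0 => //; rewrite /= in_itv /= lexx; lra.
move=> _ [x hx <-]; move: hx; rewrite /= in_itv /= => /andP[x0 x1].
exact: key.
Qed.

End Omega.

(** * Lower bounds for the constants *)

Lemma sum_even_odd (V : nmodType) (F : nat -> V) m :
  \sum_(j < m.*2.+1) F j = \sum_(l < m.+1) F l.*2 + \sum_(l < m) F l.*2.+1.
Proof.
elim: m => [|m IH]; first by rewrite !big_ord_recr !big_ord0 /= addr0.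
rewrite doubleS 2!big_ord_recr /= IH [X in _ = X + _]big_ord_recr.
rewrite [X in _ = _ + X]big_ord_recr /= -!addrA; congr (_ + _).
by rewrite [RHS]addrC !addrA.
Qed.

(** Half the sum of the expansions of [(1 + 1)^(2m)] and [(1 - 1)^(2m)]. *)
Lemma sum_bin_even (R : realType) m : (0 < m)%N ->
  \sum_(l < m.+1) ('C(m.*2, l.*2))%:R = 2 ^+ m.*2.-1 :> R.
Proof.
move=> m0; have h1 := exprDn (1 : R) 1 m.*2; have h2 := exprDn (1 : R) (-1) m.*2.
rewrite (sum_even_odd (fun i => 1 ^+ (m.*2 - i) * 1 ^+ i *+ 'C(m.*2, i))) in h1.
rewrite (sum_even_odd (fun i => 1 ^+ (m.*2 - i) * (-1) ^+ i *+ 'C(m.*2, i))) in h2.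
have e : m.*2 = m.*2.-1.+1 by lia.
have z : (1 - 1 : R) ^+ m.*2 = 0 by rewrite subrr e expr0n.
rewrite z in h2.
have E1 (a : R) : a = 1 \/ a = -1 -> \sum_(l < m.+1) 1 ^+ (m.*2 - l.*2) * a ^+ l.*2 *+ 'C(m.*2, l.*2) =
    \sum_(l < m.+1) ('C(m.*2, l.*2))%:R.
  move=> ha; apply: eq_bigr => l _; rewrite expr1n mul1r -mul2n exprM.
  by case: ha => ->; rewrite ?sqrrN expr1n expr1n.
have E2 : \sum_(l < m) 1 ^+ (m.*2 - l.*2.+1) * (-1) ^+ l.*2.+1 *+ 'C(m.*2, l.*2.+1) =
   - \sum_(l < m) 1 ^+ (m.*2 - l.*2.+1) * 1 ^+ l.*2.+1 *+ 'C(m.*2, l.*2.+1) :> R.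
  rewrite -sumrN; apply: eq_bigr => l _; rewrite !expr1n !mul1r exprS -mul2n exprM sqrrN expr1n expr1n.
  by rewrite mulr1 mulNrn.
rewrite E1 ?E2 in h2; last by right.
rewrite E1 in h1; last by left.
have p : (1 + 1 : R) ^+ m.*2 = 2 * 2 ^+ m.*2.-1 by rewrite [in LHS]e exprS.
by rewrite p in h1; move: h1 h2; lra.
Qed.

Section Chebyshev.
Variable R : realType.
Local Open Scope complex_scope.

Lemma Re_sum m (F : 'I_m -> R[i]) : complex.Re (\sum_(j < m) F j) = \sum_(j < m) complex.Re (F j).
Proof. by apply: (big_morph (@complex.Re R)) => // -[a b] [c d]. Qed.

Lemma normcX (z : R[i]) m : ComplexField.Normc.normc (z ^+ m) = ComplexField.Normc.normc z ^+ m.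
Proof. by elim: m => [|m IH]; rewrite ?ComplexField.Normc.normc1// !exprS ComplexField.Normc.normcM IH. Qed.

Lemma Re_le_normc (z : R[i]) : `|complex.Re z| <= ComplexField.Normc.normc z.
Proof. by case: z => a b /=; rewrite -sqrtr_sqr ler_wsqrtr// lerDl sqr_ge0. Qed.

(* With [x = sin^2 u] this is [cos (2 m u)]. *)
Lemma chebyshev_le1 m (x : R) : 0 <= x <= 1 ->
  `|\sum_(l < m.+1) (-1) ^+ l * ('C(m.*2, l.*2))%:R * (x ^+ l * (1 - x) ^+ (m - l))| <= 1.
Proof.
move=> /andP[x0 x1]; pose a := Num.sqrt (1 - x); pose b := Num.sqrt x.
have a2 : a ^+ 2 = 1 - x by rewrite sqr_sqrtr// subr_ge0.
have b2 : b ^+ 2 = x by rewrite sqr_sqrtr.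
pose z : R[i] := a%:C + 'i * b%:C.
have nz : ComplexField.Normc.normc z = 1.
  rewrite /z /ComplexField.Normc.normc; simpc => /=; rewrite a2 b2 subrK sqrtr1 //.
have := Re_le_normc (z ^+ m.*2); rewrite normcX nz expr1n.
congr (`|_| <= _).
have ReZ (r : R) (w : R[i]) : complex.Re (r%:C * w) = r * complex.Re w.
  by case: w => u v; simpc.
have i2 l : ('i : R[i]) ^+ (2 * l) = ((-1) ^+ l)%:C.
  by rewrite exprM sqr_i rmorphXn rmorphN1.
pose G j : R := 'C(m.*2, j)%:R * (a ^+ (m.*2 - j) * b ^+ j) * complex.Re ('i ^+ j : R[i]).
have ez : complex.Re (z ^+ m.*2) = \sum_(j < m.*2.+1) G j.
  rewrite /z exprDn Re_sum; apply: eq_bigr => j _.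
  rewrite /G -ReZ; congr complex.Re.
  rewrite exprMn -mulr_natl !rmorphM !rmorphXn rmorph_nat /=.
  by ring.
rewrite ez (sum_even_odd G) [X in _ + X]big1 ?addr0.
  apply: eq_bigr => l _; rewrite /G -!mul2n -mulnBr i2 !exprM a2 b2.
  by rewrite -[complex.Re _]/((-1) ^+ l); ring.
move=> l _; rewrite /G -!mul2n [(_ : R[i]) ^+ _]exprSr i2 ReZ.
by rewrite -[complex.Re _]/(0 : R) !mulr0.
Qed.

End Chebyshev.

Section DeBoor.
Variables (R : realType) (k : nat).
Hypothesis k2 : (2 <= k)%N.
Local Notation t := (uknot R 1 k).

Lemma bs_bernstein p i (x : R) : (p <= k)%N ->
  bs t k p (k - p + i) x = 'C(p, i)%:R * (x ^+ i * (1 - x) ^+ (p - i)).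
Proof.
elim: p i => [|p IH] i pk.
  rewrite subn0; case: i => [|i]; first by rewrite addn0 /bs eqxx bin0 !expr0 !mulr1.
  by rewrite bs_out ?bin0n ?mul0r//; lia.
have tl j : (j <= k)%N -> t j = 0.
  by move=> jk; rewrite /uknot (_ : minn (j - k) 1 = 0%N)//; nlia.
have tr j : (k < j)%N -> t j = 1.
  by move=> jk; rewrite /uknot (_ : minn (j - k) 1 = 1%N)//; nlia.
have [ip|pi] := ltnP p.+1 i.
  by rewrite bin_small// mul0r bs_out//; nlia.
have e : ((k - p.+1 + i).+1 = k - p + i)%N by nlia.
rewrite bsS e IH; last by nlia.
rewrite (tr (k - p.+1 + i + p.+1).+1); last by nlia.
case: i pi e => [|i] pi e.
  rewrite !addn0 in e *; rewrite (tl (k - p.+1)%N) ?(tl (k - p)%N) ?(tl (_ + _)%N); [|nlia..].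
  by rewrite !subn0 !bin0 !subr0 invr0 divr1 exprS !expr0; ring.
have -> : (k - p.+1 + i.+1 = k - p + i)%N by nlia.
rewrite IH; last by nlia.
rewrite (tl (k - p + i)%N) ?(tr (_ + p.+1)%N); [|nlia..].
rewrite !subr0 divr1 binS natrD subSS.
have [ip|pi'] := ltnP i p.
  rewrite (tl (k - p + i.+1)%N); last by nlia.
  have -> : (p - i = (p - i.+1).+1)%N by nlia.
  by rewrite subr0 divr1 !exprS; ring.
have -> : i = p by nlia.
by rewrite (@bin_small p p.+1)// subnn !expr0 exprS; ring.
Qed.

Lemma spline_bernstein (a : nat -> R) (x : R) : 0 <= x <= 1 ->
  spline 1 k (fun j => a (absz (j + k%:Z))) x =
  \sum_(l < k.+1) a l * ('C(k, l)%:R * (x ^+ l * (1 - x) ^+ (k - l))).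
Proof.
move=> hx; rewrite (splineE (ltn0Sn 0) k2)//; apply: eq_bigr => l _.
have -> : absz ((nat_of_ord l)%:Z - k%:Z + k%:Z) = l by rewrite subrK absz_nat.
by rewrite mul1r -(bs_bernstein l x (leqnn k)) subnn add0n /ubs /pc minn0 addn0.
Qed.

Variable d : R.
Hypothesis hd : de_boor_constant k d.

Lemma d_gt0 : 0 < d. Proof. by case: hd. Qed.

Lemma de_boor_bin l : (l <= k)%N -> 'C(k.*2, l.*2)%:R <= d * 'C(k, l)%:R.
Proof.
move=> lk; pose a j : R := (-1) ^+ j * 'C(k.*2, j.*2)%:R / 'C(k, j)%:R.
have [h _] := (hd.2 1%N (ltn0Sn 0) (fun j => a (absz (j + k%:Z)))).
have bk j : (j <= k)%N -> 0 < 'C(k, j)%:R :> R by move=> jk; rewrite ltr0n bin_gt0.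
have S1 : supnorm (spline 1 k (fun j => a (absz (j + k%:Z)))) <= 1.
  apply: supnorm_le => x hx; rewrite spline_bernstein//.
  have := chebyshev_le1 k hx; congr (`|_| <= _); apply: eq_bigr => j _.
  rewrite /a mulrA; congr (_ * _); rewrite divfK// gt_eqF// bk//.
  by rewrite -ltnS ltn_ord.
have := le_trans h S1; rewrite mulrC ler_pdivrMr ?d_gt0// mul1r => h2.
have : `|a l| <= d.
  apply: le_trans h2.
  have -> : `|a l| = `|a (absz ((l%:Z - k%:Z) + k%:Z))| by rewrite subrK absz_nat.
  apply: (@le_bigmax_seq _ _ _ _ _ (l%:Z - k%:Z) xpredT (fun j => `|a (absz (j + k%:Z))|)) => //.
  by apply/mapP; exists l => //; rewrite mem_iota; nlia.
by rewrite /a !normrM normrX normrN1 expr1n mul1r normfV !ger0_norm// ler_pdivrMr// bk.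
Qed.

(** Summing [de_boor_bin] over [l] gives [2^(2k - 1) <= d * 2^k], with no estimate of single
    binomial coefficients. *)
Lemma de_boor_pow2 : 2 ^+ k.+1 <= 4 * d.
Proof.
have : \sum_(l < k.+1) 'C(k.*2, l.*2)%:R <= \sum_(l < k.+1) d * 'C(k, l)%:R :> R.
  by apply: ler_sum => l _; apply: de_boor_bin; rewrite -ltnS ltn_ord.
rewrite -mulr_sumr sum_bin_even; last by nlia.
have -> : \sum_(l < k.+1) 'C(k, l)%:R = 2 ^+ k :> R.
  have -> : 2 = 1 + 1 :> R by ring.
  by rewrite exprDn; apply: eq_bigr => l _; rewrite !expr1n mulr1.
have -> : k.*2.-1 = (k.-1 + k)%N by nlia.
rewrite exprD ler_pM2r ?exprn_gt0// => h.
have -> : k.+1 = (2 + k.-1)%N by nlia.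
have e4 : 2 ^+ 2 = 4 :> R by ring.
by rewrite exprD e4 ler_pM2l.
Qed.

(** For degrees 4 and 5 the single coefficient [l = 2] gives more than the sum does: [4 * 70 / 6]
    and [4 * 210 / 10]. *)
Lemma threshold_le : k != 3%N -> threshold R k <= 4 * d.
Proof.
have H := de_boor_bin; have P := de_boor_pow2.
move: H P; rewrite /threshold; case: (k) => [|[|[|[|[|[|m]]]]]] H P // _.
- have := H 2%N isT; have -> : 'C(8, 4) = 70%N by []. 
  by have -> : 'C(4, 2) = 6%N by []; lra.
- have := H 2%N isT; have -> : 'C(10, 4) = 210%N by [].
  by have -> : 'C(5, 2) = 10%N by []; lra.
Qed.

End DeBoor.

(** * Bounds on epsilon and zeta *)

Section Epsilon.
Variables (R : realType) (n : nat).
Hypothesis n16 : (16 <= n)%N.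

Let n0 : (0 < n)%N. Proof. by nlia. Qed.

(** B-spline 7 has the knots 4, ..., 8, and node [q.+1] is [q] before division by [n]; these are the
    values of the cardinal cubic B-spline at integers. *)
Lemma cubic_bspline q : (5 <= q <= 7)%N ->
  bspline n 3 (7%:Z - 3%:Z) (node R n 3 (q.+1%:Z - 3%:Z)) = if q == 6%N then 4/6 else 1/6.
Proof.
move=> hq; have hR : 0 < n%:R :> R by rewrite ltr0n.
have tE j : (3 <= j <= 16)%N -> uknot R n 3 j = (j - 3)%:R.
  by move=> hj; rewrite /uknot; congr _%:R; nlia.
have x01 : greville R n 3 q.+1 = q%:R.
  rewrite /greville /s1 !big_ord_recr big_ord0 /= add0r !tE; [|nlia..].
  have -> : (q.+1 + 1 - 3 = q - 1)%N by nlia.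
  have -> : (q.+1 + 2 - 3 = q)%N by nlia.
  have -> : (q.+1 + 3 - 3 = q + 1)%N by nlia.
  by rewrite natrB ?natrD; [field|nlia].
rewrite nodeE// x01 (@bspline_B R n 3) //; last first.
  by rewrite divr_ge0//= ler_pdivrMr// mul1r ler_nat; nlia.
have -> : n%:R * (q%:R / n%:R) = q%:R :> R by rewrite mulrC divfK// gt_eqF.
rewrite (@B_piece R n 3 n0 (q + 3)%N 2 7 q%:R); last 2 first.
- by nlia.
- by rewrite !tE; [rewrite addnK lexx ler_nat; nlia|nlia|nlia].
have t7 : uknot R n 3 7 = 4 by rewrite tE.
have t8 : uknot R n 3 8 = 5 by rewrite tE.
have t9 : uknot R n 3 9 = 6 by rewrite tE.
have t10 : uknot R n 3 10 = 7 by rewrite tE.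
have t11 : uknot R n 3 11 = 8 by rewrite tE.
move: hq; case: q {x01} => [|[|[|[|[|[|[|[|q]]]]]]]] // _; rewrite !bsS /bs /=.
all: rewrite -?[(7 + 3)%N]/10%N -?[(7 + 2)%N]/9%N -?[(7 + 1)%N]/8%N -?[(8 + 2)%N]/10%N -?[(8 + 1)%N]/9%N -?[(9 + 1)%N]/10%N.
all: rewrite ?t7 ?t8 ?t9 ?t10 ?t11.
all: by field.
Qed.

(** One term is enough: with values 1/6, 4/6, 1/6 at the three nodes it is [(-1)^2 / (1/6) = 6], and
    [6 >= 2^2]. *)
Lemma epsilon_ge2 : 2 <= epsilon R n 3.
Proof.
have e2 : 2 = Num.sqrt (2 ^+ 2) :> R by rewrite sqrtr_sqr ger0_norm.
rewrite /epsilon [leLHS]e2; apply: ler_wsqrtr.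
pose i0 : int := 8%:Z - 3%:Z.
have i0b : i0 \in bindex n 3 by apply/mapP; exists 8 => //; rewrite mem_iota; nlia.
pose F i : R := \sum_(j <- bindex n 3)
      (bspline n 3 j (node R n 3 i) - 2 * bspline n 3 j (node R n 3 (i - 1)) +
       bspline n 3 j (node R n 3 (i - 2))) ^+ 2 /
      nonzero_or_one (bspline n 3 j (node R n 3 i)).
apply: le_trans (@le_bigmax_seq _ _ _ _ 0 i0 (fun i => 2 - 3%:Z <= i) F i0b isT).
rewrite /F sum_bindex.
have h7 : (7 < n + 3)%N by nlia.
have e1 : i0 - 1 = 7%:Z - 3%:Z by [].
have e2' : i0 - 2 = 6%:Z - 3%:Z by [].
rewrite e1 e2' (bigD1 (Ordinal h7)) //= !cubic_bspline //=.
rewrite -[leLHS]addr0; apply: lerD.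
  rewrite /nonzero_or_one ifF; last by apply/negbTE; lra.
  lra.
apply: sumr_ge0 => l _; apply: divr_ge0; first exact: sqr_ge0.
rewrite /nonzero_or_one; case: ifP => // _.
have hR : 0 < n%:R :> R by rewrite ltr0n.
have hx : 0 <= node R n 3 i0 <= 1.
  have /andP[a b] := @xi_itv R n 3 n0 isT 8 (ltac:(nlia)).
  by rewrite nodeE// divr_ge0//= ler_pdivrMr// mul1r.
rewrite bspline_B//; apply: B_ge0 => //; case/andP: hx => a b.
apply/andP; split; first by apply: mulr_ge0 => //; exact: ltW.
by rewrite -[leRHS]mulr1 ler_pM2l.
Qed.

End Epsilon.

(** The partial sums increase from 1, and they are bounded because
    [1/m^(3/2) <= 2/sqrt(m-1) - 2/sqrt m] telescopes; convergence is what gives [limn] its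
    meaning. *)
Lemma zeta_ge1 (R : realType) : 1 <= zeta (3 / 2 : R).
Proof.
have rE m : riemannR (3 / 2 : R) m = (m.+1%:R * Num.sqrt m.+1%:R)^-1.
  rewrite /riemannR; congr (_^-1); have -> : 3 / 2 = 1 + 2^-1 :> R by field.
  by rewrite powRD ?pnatr_eq0 ?implybT// powRr1// powR12_sqrt.
have nd : nondecreasing_seq (series (riemannR (3 / 2 : R))).
  by apply/nondecreasing_seqP => m; rewrite seriesSr lerDl rE invr_ge0 mulr_ge0 ?sqrtr_ge0.
have s1 : series (riemannR (3 / 2 : R)) 1 = 1.
  by rewrite /series /= big_nat1 rE sqrtr1 mulr1 invr1.
have bd m : series (riemannR (3 / 2 : R)) m.+1 <= 3 - 2 / Num.sqrt m.+1%:R.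
  elim: m => [|m IH]; first by rewrite s1 sqrtr1; lra.
  rewrite seriesSr rE; apply: le_trans (lerD IH (lexx _)) _.
  set a := Num.sqrt m.+1%:R; set b := Num.sqrt m.+2%:R.
  have a0 : 0 < a by rewrite sqrtr_gt0.
  have b0 : 0 < b by rewrite sqrtr_gt0.
  have a2 : a ^+ 2 = m.+1%:R by rewrite sqr_sqrtr.
  have b2 : b ^+ 2 = m.+2%:R by rewrite sqr_sqrtr.
  have ab : b ^+ 2 = a ^+ 2 + 1 by rewrite a2 b2 natr1.
  have ab' : a <= b by rewrite ler_wsqrtr// ler_nat.
  rewrite -b2 -subr_ge0.
  have -> : 3 - 2 / b - (3 - 2 / a + (b ^+ 2 * b)^-1) =
      (2 * b ^+ 3 - 2 * a * b ^+ 2 - a) / (a * b ^+ 3).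
    by field; rewrite !gt_eqF.
  apply: divr_ge0; last by rewrite mulr_ge0 ?exprn_ge0 ?ltW.
  have -> : 2 * b ^+ 3 - 2 * a * b ^+ 2 - a =
      (b - a) + b * (b - a) ^+ 2 + b * (b ^+ 2 - a ^+ 2 - 1) by ring.
  have e0 : b ^+ 2 - a ^+ 2 - 1 = 0 by rewrite ab; ring.
  rewrite e0 mulr0 addr0 addr_ge0 ?subr_ge0//.
  by apply: mulr_ge0 (sqr_ge0 _); exact: ltW.
have cv : cvgn (series (riemannR (3 / 2 : R))).
  apply: nondecreasing_is_cvgn => //; exists 3 => _ [[|m] _ <-].
    by rewrite /series /= big_geq.
  by apply: le_trans (bd m) _; rewrite gerBl divr_ge0// sqrtr_ge0.
by have := nondecreasing_cvgn_le nd cv 1%N; rewrite s1.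
Qed.

Lemma epsilon_ge0 (R : realType) n k : 0 <= epsilon R n k.
Proof. exact: sqrtr_ge0. Qed.

Theorem corollary3 (R : realType) (k : nat) (hk : (3 <= k)%N)
    (d : R) (hd : de_boor_constant k d) :
  exists n0 : nat, forall n : nat, (0 < n)%N -> (n0 <= n)%N ->
    forall f : R -> R, {within `[0, 1], continuous f} ->
      let h : R := n%:R^-1 in
      let delta : R :=
        h / Num.sqrt (4 * d + 2 * epsilon R n k * zeta (3 / 2)) in
      omega2 f delta <= 5 * supnorm (fun x => f x - schoenberg n k f x).
Proof.
(* This keeps the finitely many special rows clear of the right end, and it is 16 for [k = 3], as
   [epsilon_ge2] requires. *)
exists (4 * k + 4)%N => n _ kn f cf /=.
have k2 : (2 <= k)%N by exact: ltnW.
have e0 := epsilon_ge0 R n k; have z1 := zeta_ge1 R.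
have z0 : 0 <= 2 * epsilon R n k * zeta (3 / 2).
  by rewrite !mulr_ge0// (le_trans ler01).
have thr : threshold R k <= 4 * d + 2 * epsilon R n k * zeta (3 / 2).
  have [k3|k3] := eqVneq k 3%N; last first.
    by apply: le_trans (threshold_le k2 hd k3) _; rewrite lerDl.
  have n16 : (16 <= n)%N by rewrite (leq_trans _ kn)// k3.
  have := epsilon_ge2 R n16; rewrite -k3 => e2.
  (* The coefficient [l = 2] gives [d >= 5], so [4 d >= 20]; the term [2 * epsilon * zeta(3/2) >= 4]
     supplies the rest of 24. *)
  have d5 := de_boor_bin k2 hd k2.
  have ez := ler_pM (ler0n R 2) ler01 e2 z1.
  move: d5; rewrite k3 /threshold.
  have -> : 'C(3.*2, 2.*2) = 15%N by [].
  have -> : 'C(3, 2) = 3%N by [].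
  by move: ez; rewrite k3; lra.
apply: omega2_le => //; apply: le_trans thr.
rewrite /threshold; case: (k) => [|[|[|[|[|[|m]]]]]]; rewrite ?exprn_ege1 ?ler1n//; lra.
Qed.
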